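(* Let $0<\alpha,\beta<1$. If $\Theta$ is a $2\times2$ Hermitian matrix or $\Theta=\{0\}\times\mathbb C^2$, then non-degenerate eigenvalues of the self-adjoint extension $\boldsymbol A_\Theta=\boldsymbol A_0+\mathbf B\Theta\mathbf B^*$ of the minimal Jacobi operator have multiplicity one.
   Context: **Operators.** Let $p(x)=(1-x)^{\alpha+1}(1+x)^{\beta+1}$, $\ell_{\alpha,\beta}[f](x)=-\frac{1}{(1-x)^\alpha(1+x)^\beta}[p(x)f'(x)]'$ in $\mathcal H=L^2[(-1,1),(1-x)^\alpha(1+x)^\beta]$, and $\mathcal D_{\max}^{(\alpha,\beta)}=\{f\in\mathcal H: f,f'\in AC_{loc}(-1,1),\ \ell_{\alpha,\beta}[f]\in\mathcal H\}$. The minimal operator is the adjoint of $\ell_{\alpha,\beta}$ on $\mathcal D_{\max}^{(\alpha,\beta)}$. For $f\in\mathcal D_{\max}^{(\alpha,\beta)}$ put $$\Gamma_0f=\begin{pmatrix}\lim_{x\to1^-}p(x)f'(x)\\ \lim_{x\to-1^+}-p(x)f'(x)\end{pmatrix},\qquad \Gamma_1f=\begin{pmatrix}\lim_{x\to1^-}\big(f(x)-\frac{(1-x)f'(x)}\alpha\big)\\ \lim_{x\to-1^+}\big(f(x)+\frac{(1+x)f'(x)}\beta\big)\end{pmatrix}.$$ For a self-adjoint linear relation $\Theta$ in $\mathbb C^2$, $\boldsymbol A_\Theta=\boldsymbol A_0+\mathbf B\Theta\mathbf B^*$ is the self-adjoint operator acting by $\ell_{\alpha,\beta}$ on $\{f\in\mathcal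 D_{\max}^{(\alpha,\beta)}:\{\Gamma_0f,\Gamma_1f\}\in\Theta\}$; for a Hermitian matrix $\Theta$ the condition is $\Gamma_1f=\Theta\Gamma_0f$. (Here $\mathbf B$ is multiplication by a row of two functionals extending the components of $\Gamma_0$ to the form domain of $\boldsymbol A_0$, and the sum is taken in the form sense.) $\boldsymbol A_0$ has domain $\ker\Gamma_1$; $\boldsymbol A_\infty$ has domain $\ker\Gamma_0$ and corresponds to $\Theta=\{0\}\times\mathbb C^2$. All these operators have discrete spectrum. **Special functions** (with $1/\Gamma=0$ at poles of $\Gamma$): $$c_1(z)=\frac{-\Gamma(\alpha+1)\Gamma(-\beta)}{\Gamma(-z+\alpha)\Gamma(z-\beta+1)},\quad c_2(z)=\frac{\beta2^{\alpha+\beta+1}\Gamma(\alpha+1)\Gamma(\beta)}{\Gamma(z+1)\Gamma(-z+\alpha+\beta)},\quad c_4(z)=\frac{\beta\Gamma(1-\alpha)\Gamma(\beta)}{\alpha\Gamma(z-\alpha+1)\Gamma(-z+\beta)}.$$ **Weyl function.** With $\lambda=(-z-1)(-z+\alpha+\beta)$, the Weyl function of $\{\mathbb C^2,\Gamma_0,\Gamma_1\}$ (characterized by $\Gamma_1f=M_\infty(\lambda)\Gamma_0f$ for $\ell_{\alpha,\beta}[f]=\lambda f$, $f\in\mathcal D_{\max}^{(\alpha,\beta)}$) is $M_\infty(\lambda)=\frac1{c_2(z)}\begin{pmatrix}-c_4(z)&1\\1&-c_1(z)\end{pmatrix}$. **Degenerate eigenvalues.** For a Hermitian matrix $\Theta=(\Theta_{ij})$,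 an eigenvalue $\lambda\in\rho(\boldsymbol A_\infty)$ of $\boldsymbol A_\Theta$ is degenerate if, for $z$ with $\lambda=(-z-1)(-z+\alpha+\beta)$ (either choice), $\Theta_{11}=-\frac{c_4(z)}{c_2(z)}$, $\Theta_{21}=\frac1{c_2(z)}$ and $\Theta_{22}=-\frac{c_1(z)}{c_2(z)}$, i.e. $\Theta=M_\infty(\lambda)$. An eigenvalue is non-degenerate if it is not degenerate (in particular all eigenvalues are non-degenerate for $\Theta=\{0\}\times\mathbb C^2$). *)

(* Defs.v *)
From HB Require Import structures.
From mathcomp Require Import all_boot all_order all_algebra.
From mathcomp Require Import complex.
From mathcomp Require Import all_classical all_reals all_analysis.
Import Order.TTheory GRing.Theory Num.Theory.
Import numFieldNormedType.Exports.

Set Implicit Arguments.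
Unset Strict Implicit.
Unset Printing Implicit Defensive.

Local Open Scope classical_set_scope.
Local Open Scope ring_scope.
Local Open Scope complex_scope.

Local Notation Re := complex.Re.
Local Notation Im := complex.Im.

Section ComplexFunctions.
Variable R : realType.
Implicit Types (f : R -> R[i]) (z : R[i]).

(* Limits, derivatives and absolute continuity of complex-valued functions are
   taken componentwise. *)
Definition climit {T : Type} (F : set_system T) (u : T -> R[i]) : R[i] :=
  lim ((fun t => Re (u t)) @ F) +i* lim ((fun t => Im (u t)) @ F).

Definition cderivable f (x : R) : Prop :=
  derivable (fun t => Re (f t)) x 1 /\ derivable (fun t => Im (f t)) x 1.

Definition cderive f (x : R) : R[i] :=
  derive1 (fun t => Re (f t)) x +i* derive1 (fun t => Im (f t)) x.

Definition abs_cont (a b : R) (h : R -> R) : Prop :=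
  forall e : R, 0 < e -> exists2 d : R, 0 < d &
    forall (n : nat) (u v : 'I_n -> R),
      (forall i, a <= u i /\ u i <= v i /\ v i <= b) ->
      (forall i j, i != j -> v i <= u j \/ v j <= u i) ->
      \sum_(i < n) (v i - u i) < d ->
      \sum_(i < n) `|h (v i) - h (u i)| < e.

Definition AC_loc f : Prop :=
  forall a b : R, -1 < a -> a < b -> b < 1 ->
    abs_cont a b (fun t => Re (f t)) /\ abs_cont a b (fun t => Im (f t)).

Definition cexp z : R[i] :=
  (expR (Re z))%:C * (cos (Im z) +i* sin (Im z)).

(* Gauss's product
     1 / Gamma(z) = lim_n z (z + 1) ... (z + n) / (n! n^z),
   which converges for every complex z and vanishes at 0, -1, -2, ... *)
Definition rGamma z : R[i] :=
  climit \oo (fun n : nat =>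
    (\prod_(k < n.+1) (z + k%:R)) / (n`!%:R * cexp (z * (ln (n%:R : R))%:C))).

(* At a pole, [Gamma z = 0], hence [(Gamma z)^-1 = 0]: this is the convention
   1 / Gamma = 0 used in the functions [c1], [c2], [c4]. *)
Definition Gamma z : R[i] := (rGamma z)^-1.

End ComplexFunctions.

Section Jacobi.
Variables (R : realType) (alpha beta : R).
Local Notation C := R[i].
Local Notation mu := (@lebesgue_measure R).
Local Notation J := (`]-1, 1[%classic : set R).
Implicit Types (f g h : R -> C) (lambda z : C).

Definition weight (x : R) : R := (1 - x) `^ alpha * (1 + x) `^ beta.

Definition p (x : R) : R := (1 - x) `^ (alpha + 1) * (1 + x) `^ (beta + 1).

(* Elements of H = L^2((-1, 1), weight) are represented by functions on R, of
   which only the restriction to (-1, 1), up to a null set, is relevant. *)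
Definition eqH f g : Prop := {ae mu, forall x, J x -> f x = g x}.

Definition normH f : R :=
  Num.sqrt (\int[mu]_(x in J) ((Re (f x) ^+ 2 + Im (f x) ^+ 2) * weight x))%R.

(* Measurability on the library's reals is Borel measurability; a Lebesgue
   measurable function is one that agrees a.e. with a Borel measurable one. *)
Definition inH f : Prop :=
  exists g, [/\ eqH f g,
    measurable_fun J (fun x => Re (g x)),
    measurable_fun J (fun x => Im (g x)) &
    (\int[mu]_(x in J)
       ((Re (g x) ^+ 2 + Im (g x) ^+ 2) * weight x)%:E < +oo)%E].

(* Operators in H, given by their graphs. *)
Definition operator := (R -> C) -> (R -> C) -> Prop.

Definition in_eigenspace (A : operator) lambda f : Prop :=
  A f (fun x => lambda * f x).

Definition is_eigenvalue (A : operator) lambda : Prop :=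
  exists2 f, in_eigenspace A lambda f & ~ eqH f (fun=> 0).

(* The eigenspace has dimension n. *)
Definition has_multiplicity (A : operator) lambda (n : nat) : Prop :=
  exists e : 'I_n -> (R -> C),
    [/\ forall i, in_eigenspace A lambda (e i),
        forall c : 'I_n -> C,
          eqH (fun x => \sum_i c i * e i x) (fun=> 0) -> forall i, c i = 0 &
        forall f, in_eigenspace A lambda f ->
          exists c : 'I_n -> C, eqH f (fun x => \sum_i c i * e i x)].

(* A - lambda is a bijection from the domain of A onto H, with bounded
   inverse. *)
Definition resolvent_set (A : operator) lambda : Prop :=
  exists K : R, forall g, inH g ->
    exists f, [/\
      exists2 h, A f h & eqH (fun x => h x - lambda * f x) g,
      normH f <= K * normH g &
      forall f' h', A f' h' -> eqH (fun x => h' x - lambda * f' x) g ->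
        eqH f' f].

Definition jacobi f (x : R) : C :=
  - ((weight x)^-1)%:C * cderive (fun t => (p t)%:C * cderive f t) x.

Definition Dmax f : Prop :=
  [/\ inH f, forall x, J x -> cderivable f x,
      AC_loc f, AC_loc (cderive f) & inH (jacobi f)].

Definition Gamma0 f : 'cV[C]_2 := \col_(i < 2)
  if i == 0
  then climit (1 : R)^'- (fun x => (p x)%:C * cderive f x)
  else climit (-1 : R)^'+ (fun x => - ((p x)%:C * cderive f x)).

Definition Gamma1 f : 'cV[C]_2 := \col_(i < 2)
  if i == 0
  then climit (1 : R)^'- (fun x => f x - (1 - x)%:C * cderive f x / alpha%:C)
  else climit (-1 : R)^'+ (fun x => f x + (1 + x)%:C * cderive f x / beta%:C).

Definition lin_relation := set ('cV[C]_2 * 'cV[C]_2).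

Definition graph_rel (Theta : 'M[C]_2) : lin_relation :=
  [set uv | uv.2 = Theta *m uv.1].

(* {0} x C^2 *)
Definition infty_rel : lin_relation := [set uv | uv.1 = 0].

(* The extension A_Theta = A_0 + B Theta B^*. *)
Definition A_ (T : lin_relation) : operator := fun f g =>
  [/\ Dmax f, T (Gamma0 f, Gamma1 f) & eqH g (jacobi f)].

Definition c1 z : C :=
  - (Gamma (alpha%:C + 1) * Gamma (- beta%:C))
  / (Gamma (- z + alpha%:C) * Gamma (z - beta%:C + 1)).

Definition c2 z : C :=
  beta%:C * (2 `^ (alpha + beta + 1))%:C
    * Gamma (alpha%:C + 1) * Gamma beta%:C
  / (Gamma (z + 1) * Gamma (- z + alpha%:C + beta%:C)).

Definition c4 z : C :=
  beta%:C * Gamma (1 - alpha%:C) * Gamma beta%:C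
  / (alpha%:C * Gamma (z - alpha%:C + 1) * Gamma (- z + beta%:C)).

Definition spectral_param z : C :=
  (- z - 1) * (- z + alpha%:C + beta%:C).

(* The conditions on z are invariant under z |-> alpha + beta - 1 - z, which
   exchanges the two solutions of [lambda = spectral_param z]. *)
Definition degenerate (T : lin_relation) lambda : Prop :=
  exists Theta : 'M[C]_2,
    [/\ Theta \is hermsymmx, T = graph_rel Theta,
        resolvent_set (A_ infty_rel) lambda &
        forall z, lambda = spectral_param z ->
          [/\ Theta 0 0 = - (c4 z / c2 z),
              Theta 1 0 = 1 / c2 z &
              Theta 1 1 = - (c1 z / c2 z)]].

End Jacobi.

(* Main.v *)
(** An absolutely continuous f' solving the equation is continuously
    differentiable, because the equation expresses f'' almost everywhere by a
    continuous function of x, f, f'. So eigenfunctions of A_Theta are classical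
    solutions, which form a two-dimensional space. If the eigenspace is not a
    line, every solution satisfies the boundary condition, so Theta is a matrix
    that maps Gamma_0 f to Gamma_1 f for all solutions f. With
    (Gamma_0, Gamma_1) = ((0, c_2), (1, -c_1)) for the solution
    u = F(z + 1, -z + alpha + beta; alpha + 1; (1 - x) / 2) regular at 1 (Gauss's
    summation and Euler's transformation), and ((c_2, 0), (-c_4, 1)) for the
    solution v regular at -1, this forces c_2 <> 0 and Theta = M_oo(lambda).
    Moreover c_2 is the Wronskian of u and v, which are square integrable, so
    that c_2 <> 0 makes Green's function a bounded inverse of A_oo - lambda:
    lambda lies in the resolvent set of A_oo, and the eigenvalue is
    degenerate. *)

Require Import Defs.
From HB Require Import structures.
From mathcomp Require Import all_boot all_order all_algebra.
From mathcomp Require Import complex.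
From mathcomp Require Import all_classical all_reals all_analysis.
From mathcomp Require Import measurable_realfun.
From mathcomp Require Import ring lra zify.
Import Order.TTheory GRing.Theory Num.Theory.
Import numFieldNormedType.Exports Normc.

Set Implicit Arguments.
Unset Strict Implicit.
Unset Printing Implicit Defensive.

Local Open Scope classical_set_scope.
Local Open Scope ring_scope.

(** * Absolutely continuous functions *)

(** The difficulty sits at the ends of the interval. At -1 the series of u need not converge,
    because c - a - b = -beta is negative. Two identities lead to convergent series: Euler's
    transformation extracts the factor ((1 + x) / 2)^(-beta) and yields the limit of p u', and the
    contiguous relation that raises c by one turns the combination in Gamma_1 into a multiple of
    F(a, b; c + 1; .). The parameters a and b are complex, but a + b = alpha + beta + 1 is real and
    nonnegative, which makes the coefficients accessible to estimates of Raabe type. Everything at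
    -1 is obtained from 1 by x |-> -x, which exchanges alpha and beta. Fundamental systems are
    recognized by their Wronskian, which is read off from the boundary data at one end, so no
    existence theorem for differential equations enters. Degeneracy speaks of both roots z of the
    quadratic equation for lambda: the Weyl matrix is therefore computed for an arbitrary root,
    while a single root suffices for the resolvent. *)

Section AlmostEverywhere.
Variable R : realType.
Local Notation mu := (@lebesgue_measure R).
Implicit Types (P Q S T : R -> Prop).

Lemma ae_filterS P Q : (forall x, P x -> Q x) ->
  {ae mu, forall x, P x} -> {ae mu, forall x, Q x}.
Proof. by apply: filterS; exact: (ae_filter_ringOfSetsType mu). Qed.

Lemma ae_filterS2 P Q S : (forall x, P x -> Q x -> S x) ->
  {ae mu, forall x, P x} -> {ae mu, forall x, Q x} -> {ae mu, forall x, S x}.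
Proof. by apply: filterS2; exact: (ae_filter_ringOfSetsType mu). Qed.

Lemma ae_filterS3 P Q S T : (forall x, P x -> Q x -> S x -> T x) ->
  {ae mu, forall x, P x} -> {ae mu, forall x, Q x} -> {ae mu, forall x, S x} ->
  {ae mu, forall x, T x}.
Proof. by apply: filterS3; exact: (ae_filter_ringOfSetsType mu). Qed.

End AlmostEverywhere.

Section AbsoluteContinuity.
Variable R : realType.
Implicit Types (a b c d e x y : R) (h : R -> R).
Local Notation mu := (@lebesgue_measure R).
Local Notation TV := (@total_variation R).

(** The cells of several partitions are naturally indexed by a dependent pair type, not by some
    ['I_n]. *)
Lemma abs_cont_finType a b h e : abs_cont a b h -> 0 < e -> exists2 d, 0 < d &
  forall (I : finType) (u v : I -> R),
    (forall i, a <= u i /\ u i <= v i /\ v i <= b) ->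
    (forall i j, i != j -> v i <= u j \/ v j <= u i) ->
    \sum_i (v i - u i) < d -> \sum_i `|h (v i) - h (u i)| < e.
Proof.
move=> ach e0; have [d d0 H] := ach _ e0; exists d => // I u v uv dis sd.
have bij : {on [pred i : I | true], bijective (@enum_val I predT)}.
  by apply: onW_bij; exact: enum_val_bij.
rewrite (reindex _ bij)/=; apply: (H _ (u \o enum_val) (v \o enum_val)) => //.
- by move=> i /=; exact: uv.
- by move=> i j ij; apply: dis; apply: contra ij => /eqP/enum_val_inj ->.
- by rewrite (reindex _ bij)/= in sd.
Qed.

Lemma abs_contS a b c d h : a <= c -> d <= b -> abs_cont a b h -> abs_cont c d h.
Proof.
move=> ac db ach e e0; have [r r0 H] := ach _ e0; exists r => // n u v uv.
apply: H => i; have [? [? ?]] := uv i.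
by rewrite (le_trans ac)//; split => //; split => //; exact: le_trans db.
Qed.

Lemma abs_cont_lin a b h (k : R -> R) (r s : R) : abs_cont a b h -> abs_cont a b k ->
  abs_cont a b (fun x => r * h x + s * k x).
Proof.
move=> ach ack e e0.
pose m := `|r| + `|s| + 1.
have m0 : 0 < m by rewrite /m; have := normr_ge0 r; have := normr_ge0 s; lra.
have em0 : 0 < e / m by rewrite divr_gt0.
have [d d0 Hd] := ach _ em0; have [d' d'0 Hd'] := ack _ em0.
exists (Num.min d d'); first by rewrite lt_min d0.
move=> n u v uv dis; rewrite lt_min => /andP[sd sd'].
have {Hd} H1 := Hd n u v uv dis sd; have {Hd'} H2 := Hd' n u v uv dis sd'.
apply: (@le_lt_trans _ _ (`|r| * \sum_(i < n) `|h (v i) - h (u i)|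
    + `|s| * \sum_(i < n) `|k (v i) - k (u i)|)).
  rewrite !mulr_sumr -big_split/=; apply: ler_sum => i _.
  rewrite (_ : _ - _ = r * (h (v i) - h (u i)) + s * (k (v i) - k (u i))); last by ring.
  by rewrite (le_trans (ler_normD _ _))// !normrM.
apply: (@le_lt_trans _ _ (`|r| * (e / m) + `|s| * (e / m))).
  by apply: lerD; apply: ler_wpM2l => //; exact: ltW.
by rewrite -mulrDl mulrA ltr_pdivrMr// mulrC ltr_pM2l// /m ltrDl.
Qed.

Lemma abs_cont_within_continuous a b h : a < b -> abs_cont a b h ->
  {within `[a, b], continuous h}.
Proof.
move=> ab ach.
apply/subspace_continuousP => x /=; rewrite in_itv/= => /andP[ax xb].
apply/cvgrPdist_lt => e e0.
have [d d0 H] := ach _ e0.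
exists d => //= y; rewrite /ball_/= => xy; rewrite in_itv/= => /andP[ay yb].
pose u := Num.min x y; pose v := Num.max x y.
have uv : u <= v by rewrite /u /v ge_min le_max lexx.
have := H 1%N (fun=> u) (fun=> v); rewrite !big_ord1.
have -> : `|h v - h u| = `|h x - h y|.
  by rewrite /u /v; case: (ltP x y) => _ //; rewrite distrC.
apply.
- by move=> _; rewrite /u /v ge_max le_min ax ay xb yb.
- by move=> i j; rewrite !ord1.
- move: xy; rewrite /u /v; case: (ltP x y) => xy.
    by rewrite ltr0_norm ?subr_lt0// opprB.
  by rewrite ger0_norm// subr_ge0.
Qed.

Lemma itv_partition_sorted a b s (i j : nat) : itv_partition a b s ->
  (i <= j)%N -> (j <= size s)%N -> nth b (a :: s) i <= nth b (a :: s) j.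
Proof.
move=> [ps _] ij js.
have srt : sorted <=%R (a :: s).
  by apply: sub_path ps => x y /ltW.
by rewrite (sorted_leq_nth le_trans lexx _ srt)// inE/= ltnS// (leq_trans ij).
Qed.

(** The cells of all partitions [s i] together form one disjoint family of the same total length, so
    the [d] that serves for [h] also serves for its variation. *)
Lemma abs_cont_variation a b h e : abs_cont a b h -> 0 < e -> exists2 d, 0 < d &
  forall (n : nat) (u v : 'I_n -> R) (s : 'I_n -> seq R),
    (forall i, a <= u i /\ u i <= v i /\ v i <= b) ->
    (forall i j, i != j -> v i <= u j \/ v j <= u i) ->
    \sum_(i < n) (v i - u i) < d ->
    (forall i, itv_partition (u i) (v i) (s i)) ->
    \sum_(i < n) variation (u i) (v i) h (s i) < e.
Proof.
move=> ach e0; have [d d0 H] := abs_cont_finType ach e0; exists d => //.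
move=> n u v s uv dis sd ps.
pose I := {i : 'I_n & 'I_(size (s i))}.
pose U (t : I) := nth (v (tag t)) (u (tag t) :: s (tag t)) (tagged t).
pose V (t : I) := nth (v (tag t)) (u (tag t) :: s (tag t)) (tagged t).+1.
have sumE (G : forall i : 'I_n, 'I_(size (s i)) -> R) :
    \sum_(i < n) \sum_(k < size (s i)) G i k = \sum_(t : I) G (tag t) (tagged t).
  by rewrite (@sig_big_dep _ _ _ _ (fun i => 'I_(size (s i))) predT (fun _ _ => true) G).
have -> : \sum_(i < n) variation (u i) (v i) h (s i) = \sum_t `|h (V t) - h (U t)|.
  rewrite -(sumE (fun i k => `|h (nth (v i) (u i :: s i) k.+1) - h (nth (v i) (u i :: s i) k)|)).
  by apply: eq_bigr => i _; rewrite /variation big_mkord.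
apply: H.
- move=> [i k]; rewrite /U /V /=.
  have [aui [uvi vib]] := uv i.
  split; last split.
  + by rewrite (le_trans aui)// (itv_partition_nth_ge _ (ps i))// ltnS ltnW.
  + by have := itv_partition_sorted (ps i) (leqnSn k) (ltn_ord k).
  + exact: le_trans (@itv_partition_nth_le _ _ _ _ _ k.+1 (ltn_ord k) (ps i)) vib.
- move=> [i k] [j l] ne; rewrite /U /V /=.
  case: (eqVneq i j) ne => [ij|ij] ne.
    subst j.
    have kl : k != l by apply: contra ne => /eqP ->.
    case: (ltngtP k l) kl => kl; last by move/eqP; case; exact: val_inj.
    + by left; have := itv_partition_sorted (ps i) kl (ltnW (ltn_ord l)).
    + by right; have := itv_partition_sorted (ps i) kl (ltnW (ltn_ord k)).
  have ge m (t : 'I_(size (s m))) : u m <= nth (v m) (u m :: s m) t.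
    by rewrite (itv_partition_nth_ge _ (ps m))// ltnS ltnW.
  have le m (t : 'I_(size (s m))) : nth (v m) (u m :: s m) t.+1 <= v m.
    by rewrite (itv_partition_nth_le _ (ps m))// ltnS.
  by case: (dis _ _ ij) => dij; [left|right];
    exact: (le_trans (le _ _) (le_trans dij (ge _ _))).
- rewrite -(sumE (fun i k => nth (v i) (u i :: s i) k.+1 - nth (v i) (u i :: s i) k)).
  rewrite (le_lt_trans _ sd)//; apply: ler_sum => i _.
  rewrite -(big_mkord xpredT (fun k => nth (v i) (u i :: s i) k.+1 - nth (v i) (u i :: s i) k)).
  by rewrite telescope_sumr// (itv_partition_nth_size _ (ps i)).
Qed.

Lemma bounded_variation_cat a c b h : a <= c -> c <= b ->
  bounded_variation a c h -> bounded_variation c b h -> bounded_variation a b h.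
Proof.
move=> ac cb /(bounded_variationP _ ac) fac /(bounded_variationP _ cb) fcb.
apply/bounded_variationP; first exact: le_trans cb.
by rewrite (total_variationD h ac cb) fin_numD fac.
Qed.

(** On an interval shorter than the [d] belonging to 1 the variation is at most 1, and finitely many
    steps of length [d / 2] cover [a, b]. *)
Lemma abs_cont_bounded_variation a b h : a <= b -> abs_cont a b h ->
  bounded_variation a b h.
Proof.
move=> ab ach; have [d d0 H] := abs_cont_variation ach (@ltr01 R).
have loc x y : a <= x -> x <= y -> y <= b -> y - x < d -> bounded_variation x y h.
  move=> ax xy yb yxd; exists 1 => _ [s ps <-]; apply/ltW.
  have := H 1%N (fun=> x) (fun=> y) (fun=> s); rewrite !big_ord1; apply => //.
  by move=> i j; rewrite !ord1.
have step n : bounded_variation a (Num.min b (a + n%:R * (d / 2))) h.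
  elim: n => [|n ih]; first by rewrite mul0r addr0 (min_idPr ab); exact: bounded_variationxx.
  have nd0 : 0 <= n%:R * (d / 2) by rewrite mulr_ge0// divr_ge0// ltW.
  apply: (bounded_variation_cat _ _ ih).
  - by rewrite le_min ab lerDl.
  - rewrite le_min ge_min lexx/= ge_min; apply/orP; right.
    by rewrite lerD2l ler_wpM2r ?ler_nat// divr_ge0// ltW.
  - apply: loc.
    + by rewrite le_min ab lerDl.
    + rewrite le_min ge_min lexx/= ge_min; apply/orP; right.
      by rewrite lerD2l ler_wpM2r ?ler_nat// divr_ge0// ltW.
    + by rewrite ge_min lexx.
    + rewrite ltrBlDr; case: (leP b (a + n%:R * (d / 2))) => bn.
        by rewrite gt_min; apply/orP; left; rewrite ltrDr.
      rewrite gt_min; apply/orP; right; rewrite -natr1 mulrDl mul1r.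
      by lra.
have [n bn] : exists n : nat, b <= a + n%:R * (d / 2).
  exists (Num.bound ((b - a) / (d / 2))).
  rewrite -lerBlDl -ler_pdivrMr ?divr_gt0//.
  by apply/ltW/archi_boundP/divr_ge0; [rewrite subr_ge0 | apply/ltW/divr_gt0].
by have := step n; rewrite (min_idPl bn).
Qed.

(** The increments of the total variation are the variations over the single intervals; nearly
    optimal partitions reduce them to [abs_cont_variation]. *)
Lemma abs_cont_total_variation a b h : a <= b -> abs_cont a b h ->
  abs_cont a b (fun x => fine (TV a x h)).
Proof.
move=> ab ach e e0.
have e20 : 0 < e / 2 by rewrite divr_gt0.
have [d d0 H] := abs_cont_variation ach e20; exists d => // n u v uv dis sd.
have BV := abs_cont_bounded_variation ab ach.
have TVuv i : (TV a (v i) h = TV a (u i) h + TV (u i) (v i) h)%E.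
  by have [? [? ?]] := uv i; exact: total_variationD.
have fu i : TV a (u i) h \is a fin_num.
  have [? [? ?]] := uv i; apply/bounded_variationP => //.
  by apply: (bounded_variationl _ _ BV) => //; exact: (@le_trans _ _ (v i)).
have fuv i : TV (u i) (v i) h \is a fin_num.
  have [? [? ?]] := uv i; apply/bounded_variationP => //.
  apply: (bounded_variationl _ (_ : v i <= b)) => //.
  by apply: (bounded_variationr _ _ BV) => //; exact: (@le_trans _ _ (v i)).
(* Half of [e] is spread over the [n] intervals as the defect of nearly optimal partitions; [n.+1]
   avoids a division by zero. *)
have sE i : exists2 s, itv_partition (u i) (v i) s &
    `|fine (TV a (v i) h) - fine (TV a (u i) h)| <=
    variation (u i) (v i) h s + e / 2 / n.+1%:R.
  have [? [uvi ?]] := uv i.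
  have e3 : 0 < e / 2 / n.+1%:R by rewrite divr_gt0.
  have : (TV (u i) (v i) h - (e / 2 / n.+1%:R)%:E < TV (u i) (v i) h)%E.
    by rewrite -(fineK (fuv i)) -EFinB lte_fin ltrBlDr ltrDl.
  move=> /ereal_sup_gt[_ [_ [s ps <-] <-]] lts; exists s => //.
  rewrite TVuv fineD// addrAC subrr add0r ger0_norm; last first.
    by rewrite fine_ge0// total_variation_ge0.
  rewrite -lerBlDr -lee_fin EFinB fineK//; exact: ltW.
have /choice[s sP] : forall i, exists s, itv_partition (u i) (v i) s /\
    `|fine (TV a (v i) h) - fine (TV a (u i) h)| <=
    variation (u i) (v i) h s + e / 2 / n.+1%:R.
  by move=> i; have [s ? ?] := sE i; exists s.
have {}H := H n u v s uv dis sd (fun i => (sP i).1).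
apply: (@le_lt_trans _ _ (\sum_(i < n) (variation (u i) (v i) h (s i) + e / 2 / n.+1%:R))).
  by apply: ler_sum => i _; exact: (sP i).2.
rewrite big_split/= sumr_const card_ord [X in _ < X]splitr.
apply: ltr_leD => //; rewrite -[leLHS]mulr_natr -mulrA ler_piMr//; first exact: ltW.
by rewrite mulrC ler_pdivrMr// mul1r ler_nat.
Qed.

End AbsoluteContinuity.

(* Extended by constants outside [a, b], F defines a Stieltjes measure dominated
   by the Lebesgue measure; the density is its Radon-Nikodym derivative. *)
Section Density.
Variables (R : realType) (a b : R) (F : R -> R).
Hypotheses (ab : a < b) (Fnd : {in `[a, b] &, nondecreasing_fun F})
  (acF : abs_cont a b F).
Local Notation mu := (@lebesgue_measure R).

Let clamp (x : R) := Num.min b (Num.max a x).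

Let clamp_in x : clamp x \in `[a, b].
Proof.
by rewrite in_itv/= /clamp le_min ge_min le_max !lexx (ltW ab).
Qed.

Let clamp_le (x y : R) : x <= y -> clamp x <= clamp y.
Proof.
move=> xy; rewrite /clamp le_min ge_min lexx/= ge_min; apply/orP; right.
by rewrite ge_max !le_max lexx xy orbT.
Qed.

Let clamp_sub (x y : R) : x <= y -> clamp y - clamp x <= y - x.
Proof.
move: ab => ab'; rewrite /clamp !minEle !maxEle => xy.
by do !case: ifPn; rewrite -?ltNge; lra.
Qed.

Let clamp_id (x : R) : a <= x -> x <= b -> clamp x = x.
Proof. by move=> ax xb; rewrite /clamp (max_idPr ax) (min_idPr xb). Qed.

Let G x := F (clamp x).

Let G_nd : nondecreasing G.
Proof. by move=> x y xy; apply: Fnd => //; exact: clamp_le. Qed.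

Let G_ac e : 0 < e -> exists2 d, 0 < d &
    forall (n : nat) (u v : 'I_n -> R),
      (forall i, u i <= v i) ->
      (forall i j, i != j -> v i <= u j \/ v j <= u i) ->
      \sum_(i < n) (v i - u i) < d ->
      \sum_(i < n) (G (v i) - G (u i)) < e.
Proof.
move=> e0; have [d d0 H] := acF e0; exists d => // n u v uv dis sd.
rewrite (eq_bigr (fun i => `|F (clamp (v i)) - F (clamp (u i))|)); last first.
  by move=> i _; rewrite ger0_norm// subr_ge0 G_nd.
apply: (H n (clamp \o u) (clamp \o v)) => /=.
- move=> i; have := clamp_in (u i); have := clamp_in (v i).
  by rewrite !in_itv/= => /andP[_ ->] /andP[-> _]; rewrite clamp_le.
- by move=> i j /dis[] h; [left|right]; exact: clamp_le.
- by rewrite (le_lt_trans _ sd)//; apply: ler_sum => i _; exact: clamp_sub.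
Qed.

Let G_rc : right_continuous G.
Proof.
apply: right_continuousW => x; apply/cvgrPdist_lt => e e0.
have [d d0 H] := G_ac e0.
exists d => //= y; rewrite /ball_/= => xy.
have h (p q : R) : p <= q -> q - p < d -> `|G q - G p| < e.
  move=> pq qpd; have := H 1%N (fun=> p) (fun=> q); rewrite !big_ord1.
  rewrite ger0_norm ?subr_ge0 ?G_nd//; apply => // i j; by rewrite !ord1.
have [xy'|/ltW xy'] := leP x y.
  by rewrite distrC h//; rewrite distrC ger0_norm ?subr_ge0// in xy.
by rewrite h//; rewrite ger0_norm ?subr_ge0// in xy.
Qed.

HB.instance Definition _ := isCumulative.Build R _ R G G_nd G_rc.

Let nu := lebesgue_stieltjes_measure G.

Let nu_oc (x y : R) : x <= y -> nu `]x, y] = (G y - G x)%:E.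
Proof.
move=> xy; rewrite /nu /lebesgue_stieltjes_measure/=.
rewrite /measure_extension measurable_mu_extE/=; last exact: is_ocitv.
exact: wlength_itv_bnd.
Qed.

(** The intervals [I n] exhaust the line, and outside [a, b] nothing is added to the mass F b - F
    a. *)
Let nu_fin : fin_num_fun nu.
Proof.
apply: lty_fin_num_fun.
pose I (n : nat) : set R := `](a - n%:R), (b + n%:R)]%classic.
have T : setT = \bigcup_n I n.
  apply/seteqP; split => // x _.
  exists (Num.bound (`|a - x| + `|b - x|)) => //=.
  have h := @archi_boundP R (`|a - x| + `|b - x|) (addr_ge0 (normr_ge0 _) (normr_ge0 _)).
  rewrite /I/= in_itv/=; apply/andP; split.
    have := ler_norm (a - x); have := normr_ge0 (b - x); lra.
  have := ler_norm (- (b - x)); rewrite normrN; have := normr_ge0 (a - x); lra.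
have nd : nondecreasing_seq I.
  move=> m n mn; apply/subsetPset => x; rewrite /I/= !in_itv/=.
  have : (m%:R : R) <= n%:R by rewrite ler_nat.
  by move=> h /andP[h1 h2]; apply/andP; split; lra.
have bnd n : (nu (I n) <= (F b - F a)%:E)%E.
  have n0 : (0 : R) <= n%:R by [].
  have cb : clamp (b + n%:R) = b.
    by rewrite /clamp; apply/min_idPl; rewrite le_max lerDl n0 orbT.
  have ca : clamp (a - n%:R) = a.
    rewrite /clamp (_ : Num.max a (a - n%:R) = a); first by apply/min_idPr/ltW.
    by apply/max_idPl; rewrite lerBlDr lerDl.
  rewrite /I nu_oc ?/G ?cb ?ca//; move: ab; lra.
rewrite T.
have mI n : measurable (I n) by exact: measurable_itv.
have cv : nu \o I @ \oo --> nu (\bigcup_n I n).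
  by apply: nondecreasing_cvg_mu => //; exact: bigcupT_measurable.
apply: (@le_lt_trans _ _ (F b - F a)%:E); last exact: ltry.
rewrite -[leLHS](cvg_lim (@ereal_hausdorff R) cv); apply: lime_le; first by apply/cvg_ex; eexists; exact: cv.
by apply: nearW => n; exact: bnd.
Qed.

HB.instance Definition _ := Measure.on nu.
HB.instance Definition _ := @Measure_isFinite.Build _ _ _ nu nu_fin.

(** An open set is a countable disjoint union of open intervals. Every finite subfamily has total
    length below [d], hence [nu]-mass below [e], and the bound passes to the sum. *)
Let nu_open (U : set R) (e d : R) :
  (forall (n : nat) (u v : 'I_n -> R),
      (forall i, u i <= v i) ->
      (forall i j, i != j -> v i <= u j \/ v j <= u i) ->
      \sum_(i < n) (v i - u i) < d ->
      \sum_(i < n) (G (v i) - G (u i)) < e) ->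
  open U -> (mu U < d%:E)%E -> (nu U <= e%:E)%E.
Proof.
move=> H oU Ud.
pose I := open_disjoint_itv oU.
have UE : U = \bigcup_q I q := @open_disjoint_itv_bigcup _ _ oU.
have trI : trivIset setT I := @open_disjoint_itv_trivIset _ _ oU.
have oI q : open (I q) := @open_disjoint_itv_open _ _ oU q.
have mI q : measurable (I q) by exact: open_measurable.
have /choice[c cP] : forall q, exists c : R * R,
    c.1 <= c.2 /\ I q = `]c.1, c.2[%classic.
  move=> q; have iI : is_interval (I q) := @open_disjoint_itv_is_interval _ _ oU q.
  have Iq : (mu (I q) < +oo)%E.
    apply: le_lt_trans (lt_trans Ud (ltry _)).
    apply: le_measure; first exact: (mem_set (mI q)).
      exact: (mem_set (open_measurable oU)).
    by rewrite UE => t It; exists q.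
  have [I0|/set0P I0] := eqVneq (I q) set0.
    by exists (0, 0); split => //=; rewrite I0 set_itvoo0.
  have := RhullK (mem_set iI).
  (* A nonempty interval of finite measure has finite ends; being open, it coincides with its
     interior. *)
  set J := Rhull (I q); move: J => J JI; rewrite -JI in Iq I0.
  move: Iq; rewrite (lebesgue_measure_itv J).
  case: J JI I0 => [[bx x|[]] [by_ y|[]]] JI [z /=]; rewrite in_itv/= ?andbF//= => zJ.
  - move=> _; exists (x, y) => /=; split.
      by move: zJ; case: bx {JI}; case: by_ => /= /andP[];
        do ?[move=> /ltW]; [ | | | ]; move=> h1 h2; rewrite (le_trans h1)// ?ltW.
    have := oI q; rewrite -JI => /interior_id <-.
    exact: interior_itv_bnd.
  - by rewrite ltry ltxx.
  - by rewrite ltNyr ltxx.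
have musum n : \sum_(i < n) ((c i).2 - (c i).1) < d.
  rewrite -lte_fin; apply: le_lt_trans Ud.
  rewrite [in leRHS]UE measure_bigcup//.
  apply: le_trans (nneseries_lim_ge n _) => //.
  rewrite big_mkord -sumEFin; rewrite [leRHS](eq_bigl xpredT) => [|i]; last by rewrite in_setT.
  apply: lee_sum => i _.
  rewrite (cP i).2 [leRHS](lebesgue_measure_itv `](c i).1, (c i).2[)/= lte_fin.
  by case: ltP => // /[dup] h; have := (cP i).1; rewrite lee_fin subr_le0.
  by move=> i _; exact: mI.
rewrite UE measure_bigcup//; last by move=> i _; exact: mI.
apply: lime_le; first exact: is_cvg_nneseries.
apply: nearW => n; rewrite big_mkord; rewrite [leLHS](eq_bigl xpredT) => [|i]; last by rewrite in_setT.
apply: (@le_trans _ _ (\sum_(i < n) (G (c i).2 - G (c i).1)%:E)%E).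
  apply: lee_sum => i _; rewrite (cP i).2 -nu_oc ?(cP i).1//.
  by apply: le_measure; rewrite ?inE//; exact: subset_itv_oo_oc.
rewrite sumEFin lee_fin; apply/ltW.
(* A component may be empty, and its coinciding ends may lie inside another interval, against the
   required separation. Such pairs are moved to the point [m], to the left of all others. *)
pose m := \big[Num.min/0]_(i < n) (c i).1.
have mle (i : 'I_n) : m <= (c i).1 by rewrite /m; exact: bigmin_le_cond.
pose u (i : 'I_n) := if (c i).1 < (c i).2 then (c i).1 else m.
pose v (i : 'I_n) := if (c i).1 < (c i).2 then (c i).2 else m.
have uvE (f : R -> R) (i : 'I_n) : f (c i).2 - f (c i).1 = f (v i) - f (u i).
  rewrite /u /v; case: ltP => // h; rewrite subrr.
  have /eqP -> : (c i).1 == (c i).2 by rewrite eq_le h (cP i).1.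
  by rewrite subrr.
under eq_bigr do rewrite uvE.
apply: H.
- by move=> i; rewrite /u /v; case: ifP => // /ltW.
- move=> i j ij.
  have mu_ l : m <= u l by rewrite /u; case: ifP.
  rewrite {1}/v; case: ifPn => [ci|_]; last by left.
  rewrite {1}/v; case: ifPn => [cj|_]; last by right.
  rewrite /u ci cj.
  have [|h1] := leP (c i).2 (c j).1; first by left.
  have [|h2] := leP (c j).2 (c i).1; first by right.
  exfalso.
  have : (I i `&` I j) ((Num.max (c i).1 (c j).1 + Num.min (c i).2 (c j).2) / 2).
    rewrite (cP i).2 (cP j).2 /= !in_itv/= !minEle !maxEle.
    by split; apply/andP; split; case: ifPn; case: ifPn; rewrite -?ltNge; lra.
  by move/trivIsetP : trI => /(_ i j Logic.I Logic.I); rewrite (inj_eq val_inj) => /(_ ij) ->.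
- by apply: le_lt_trans (musum n); rewrite le_eqVlt; apply/orP; left; apply/eqP;
    apply: eq_bigr => i _; rewrite (uvE id).
Qed.

(** By outer regularity a null set lies in an open set of measure below [d], and [nu_open] bounds
    the mass of the latter. *)
Let nu_dom : nu `<< mu.
Proof.
apply/null_content_dominatesP => A mA A0.
apply/eqP; rewrite eq_le measure_ge0 andbT.
apply/lee_addgt0Pr => e e0; rewrite add0e.
have [d d0 H] := G_ac e0.
have [U [oU AU UA]] := lebesgue_regularity_outer mA (eq_ind_r (fun x => x < +oo)%E (ltry 0) A0) d0.
apply: (@le_trans _ _ (nu U)).
  by apply: le_measure; rewrite ?inE//; exact: open_measurable.
apply: (nu_open H oU).
have -> : U = A `|` (U `\` A) by rewrite setDUK.
rewrite measureU//; last 2 first.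
  by apply: measurableD => //; exact: open_measurable.
  by rewrite setDIK.
by rewrite [X in (X + _ < _)%E]A0 add0e.
Qed.

Lemma monotone_abs_cont_density : exists2 g : R -> R,
  mu.-integrable setT (EFin \o g) &
  forall x, a <= x -> x <= b -> F x = F a + \int[mu]_(t in `]a, x]) g t.
Proof.
have [f [f0 ff fi fE]] := @radon_nikodym_sigma_finite _ _ _ mu nu nu_dom.
exists (fine \o f).
  apply: eq_integrable fi => // x _ /=; by rewrite fineK.
move=> x ax xb.
have := esym (fE `]a, x]%classic (measurable_itv _)).
rewrite [X in _ = X](nu_oc ax) /G !clamp_id ?(ltW ab)// => E.
rewrite /Rintegral (eq_integral f); last by move=> y _; rewrite /= fineK.
by rewrite E/= addrC subrK.
Qed.

End Density.

Section AbsContDerivative.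
Variable R : realType.
Implicit Types (a b x : R) (h : R -> R).
Local Notation mu := (@lebesgue_measure R).

Lemma derive1_is_derive h x (l : R) : derivable h x 1 -> derive1 h x = l -> is_derive x 1 h l.
Proof. by move=> dh <-; rewrite derive1E; exact: derivableP. Qed.

(* With v the total variation of h, both v and v - h are nondecreasing and
   absolutely continuous. *)
Lemma abs_cont_density a b h : a < b -> abs_cont a b h -> exists2 g : R -> R,
  mu.-integrable setT (EFin \o g) &
  forall x, a <= x -> x <= b -> h x = h a + \int[mu]_(t in `]a, x]) g t.
Proof.
move=> ab ach; have ab' := ltW ab.
pose v x := fine (total_variation a x h).
have acv : abs_cont a b v := abs_cont_total_variation ab' ach.
have BV := abs_cont_bounded_variation ab' ach.
have fT x y : a <= x -> x <= y -> y <= b -> total_variation x y h \is a fin_num.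
  move=> ax xy yb; apply/bounded_variationP => //.
  by apply: (bounded_variationl xy yb); apply: (bounded_variationr ax _ BV); exact: le_trans yb.
have vD x y : a <= x -> x <= y -> y <= b -> v y = v x + fine (total_variation x y h).
  move=> ax xy yb; rewrite /v (total_variationD h ax xy) fineD// fT//.
  exact: le_trans yb.
have vnd : {in `[a, b] &, nondecreasing_fun v}.
  move=> x y; rewrite !in_itv/= => /andP[ax xb] /andP[ay yb] xy.
  by rewrite (vD x y)// lerDl fine_ge0// total_variation_ge0.
have wnd : {in `[a, b] &, nondecreasing_fun (fun x => 1 * v x + -1 * h x)}.
  move=> x y; rewrite !in_itv/= => /andP[ax xb] /andP[ay yb] xy.
  rewrite (vD x y)//.
  have : h y - h x <= fine (total_variation x y h).
    rewrite -lee_fin fineK ?fT//; apply: le_trans (total_variation_ge h xy).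
    by rewrite lee_fin ler_norm.
  lra.
have [g1 ig1 E1] := monotone_abs_cont_density ab vnd acv.
have [g2 ig2 E2] := monotone_abs_cont_density ab wnd (abs_cont_lin 1 (-1) acv ach).
exists (g1 \- g2); first exact: (integrableB measurableT ig1 ig2).
move=> x ax xb; rewrite RintegralB//; last 2 first.
- exact: (integrableS measurableT _ _ ig1).
- exact: (integrableS measurableT _ _ ig2).
by have := E1 x ax xb; have := E2 x ax xb; lra.
Qed.

(** Lebesgue's differentiation theorem applied to the integral of the density. *)
Lemma abs_cont_derivative a b h : a < b -> abs_cont a b h -> exists2 g : R -> R,
  mu.-integrable setT (EFin \o g) /\
  (forall x, a <= x -> x <= b -> h x = h a + \int[mu]_(t in `]a, x]) g t) &
  {ae mu, forall x, x \in `]a, b[ -> is_derive x 1 h (g x)}.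
Proof.
move=> ab ach; have [g ig hE] := abs_cont_density ab ach; exists g => //.
have ig' y : mu.-integrable [set` Interval (BRight a) (BRight y)] (EFin \o g).
  by apply: integrableS ig => //; exact: measurableT.
have := FTC1 ig' (open_integrable_locally openT ig).
apply: ae_filterS => x H; rewrite in_itv/= => /andP[ax xb].
have [dF FE] := H ax.
have E : \near x, h x = h a + \int[mu]_(t in `]a, x]) g t.
  near=> y; apply: hE; apply/ltW; near: y; [exact: lt_nbhsr|exact: lt_nbhsl].
apply: (near_eq_is_derive (f := fun y => h a + \int[mu]_(t in `]a, y]) g t)).
  by apply: filterS E => y ->.
rewrite -[g x]add0r; apply: is_deriveD.
exact: derive1_is_derive.
Unshelve. all: by end_near. Qed.

(** This is the passage from almost everywhere to everywhere: [h] is the integral of its density,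
    the density may be replaced by the continuous [k], and then the fundamental theorem of calculus
    holds at each point. The hypothesis concerns only the value [derive1]; differentiability almost
    everywhere comes from absolute continuity. *)
Lemma abs_cont_is_derive a b h (k : R -> R) : a < b -> abs_cont a b h ->
  {within `[a, b], continuous k} ->
  {ae mu, forall x, x \in `]a, b[ -> derive1 h x = k x} ->
  forall x, x \in `]a, b[ -> is_derive x 1 h (k x).
Proof.
move=> ab ach ck hk.
have [g [ig hE] hg] := abs_cont_derivative ab ach.
have ik : mu.-integrable `[a, b] (EFin \o k).
  by apply: continuous_compact_integrable => //; exact: segment_compact.
have hE' x : a <= x -> x <= b -> h x = h a + \int[mu]_(t in `]a, x]) k t.
  move=> ax xb; rewrite hE//; congr (_ + fine _).
  apply: ae_eq_integral => //.
  - by case/integrableP : ig => /(measurable_funS measurableT (@subsetT _ _)).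
  - case/integrableP : ik => + _; apply: measurable_funS => //.
    by move=> t/=; rewrite !in_itv/= => /andP[/ltW -> /le_trans ->].
  - have nb : {ae mu, forall t, t != b}.
      exists [set b]; split => //; first exact: lebesgue_measure_set1.
      by move=> t/= /negP; rewrite negbK => /eqP.
    apply: ae_filterS3 hk hg nb.
    move=> t h1 h2 tb /=; rewrite in_itv/= => /andP[at_ tx].
    have tab : t \in `]a, b[ by rewrite in_itv/= at_ lt_neqAle tb (le_trans tx).
    have [_ <-] := h2 tab; rewrite -(h1 tab) derive1E//.
move=> x; rewrite in_itv/= => /andP[ax xb].
apply: (near_eq_is_derive (f := fun y => h a + \int[mu]_(t in `]a, y]) k t)).
  near=> y; symmetry; apply: hE'; apply/ltW; near: y; [exact: lt_nbhsr|exact: lt_nbhsl].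
rewrite -[k x]add0r; apply: is_deriveD.
have ik' : mu.-integrable `]a, b] (EFin \o k).
  by apply: integrableS ik => //; exact: subset_itv_oc_cc.
have cx : {for x, continuous k}.
  by have [+ _ _] := (continuous_within_itvP _ ab).1 ck; apply; rewrite in_itv/= ax.
have [d E] := @continuous_FTC1 R k (BRight a) x b xb ik' ax cx.
exact: derive1_is_derive.
Unshelve. all: by end_near. Qed.

End AbsContDerivative.

(** * Primitives of integrable functions *)

Section Primitives.
Variable R : realType.
Implicit Types (a b c x : R) (h k : R -> R).
Local Notation mu := (@lebesgue_measure R).
Local Notation J := (`]-1, 1[%classic : set R).

Lemma normr_Rintegral_le (A : set R) h k : measurable A ->
  mu.-integrable setT (EFin \o h) -> mu.-integrable setT (EFin \o k) ->
  (forall x, `|h x| <= k x) -> `|\int[mu]_(t in A) h t| <= \int[mu]_t k t.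
Proof.
move=> mA ih ik hk.
have ihA : mu.-integrable A (EFin \o h) by apply: integrableS ih => //; exact: measurableT.
have ikA : mu.-integrable A (EFin \o k) by apply: integrableS ik => //; exact: measurableT.
apply: (@le_trans _ _ (\int[mu]_(t in A) `|h t|)); first exact: le_normr_Rintegral.
apply: (@le_trans _ _ (\int[mu]_(t in A) k t)).
  by apply: le_Rintegral => //; exact: integrable_norm.
have k0 t : 0 <= k t by exact: le_trans (hk t).
rewrite /Rintegral fine_le//.
- exact: integrable_fin_num.
- exact: integrable_fin_num.
- apply: ge0_subset_integral => //.
  + by case/integrableP : ik.
  + by move=> x _; rewrite lee_fin.
Qed.

(** The integral of |h| is small over every set of small measure, in particular over the union of
    the intervals. Taken half-open, these are disjoint even if they share endpoints. *)
Lemma abs_cont_integral c a b h : c <= a -> mu.-integrable setT (EFin \o h) ->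
  abs_cont a b (fun x => \int[mu]_(t in `]c, x]) h t).
Proof.
move=> ca ih e e0.
have [d [d0 H]] := integral_normr_continuous ih e0.
exists d => // n u v uv dis sd.
have iA (A : set R) : measurable A -> mu.-integrable A (EFin \o h).
  by move=> mA; apply: integrableS ih => //; exact: measurableT.
have inA (A : set R) : measurable A -> mu.-integrable A (EFin \o (fun x => `|h x|)).
  by by move=> mA; apply: integrable_norm; exact: iA.
pose F i := `]u i, v i]%classic : set R.
pose A := \big[setU/set0]_(i <- index_enum 'I_n) F i.
have mF i : measurable (F i) by exact: measurable_itv.
have mA : measurable A by apply: bigsetU_measurable => i _; exact: mF.
have tF : trivIset [set` index_enum 'I_n] F.
  move=> i j _ _ [x []]; rewrite /F/= !in_itv/= => /andP[ux xv] /andP[ux' xv'].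
  apply/eqP; apply: contraT => ij.
  case: (dis _ _ ij) => h1.
    by move: (le_lt_trans (le_trans xv h1) ux'); rewrite ltxx.
  by move: (le_lt_trans (le_trans xv' h1) ux); rewrite ltxx.
have mF_ i : mu (F i) = (v i - u i)%:E.
  rewrite /F lebesgue_measure_itv/= lte_fin; case: ltP => //.
  have [_ [uvi _]] := uv i => vu.
  by rewrite (_ : v i = u i) ?subrr//; apply/eqP; rewrite eq_le vu.
have muA : (mu A < d%:E)%E.
  have : (\int[mu]_(x in A) cst 1 x = \sum_(i <- index_enum 'I_n) \int[mu]_(x in F i) cst 1 x)%E.
    by apply: ge0_integral_bigsetU => //; exact: index_enum_uniq.
  rewrite integral_cst// mul1e => ->.
  rewrite (eq_bigr (fun i => (v i - u i)%:E)) => [|i _].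
    by rewrite sumEFin lte_fin.
  transitivity (1 * mu (F i))%E; last by rewrite mul1e; exact: mF_.
  exact: (integral_cst mu (mF i) 1%E).
apply: le_lt_trans (H A mA muA).
have EA : (\int[mu]_(x in A) `|h x|%:E = \sum_(i <- index_enum 'I_n) \int[mu]_(x in F i) `|h x|%:E)%E.
  apply: ge0_integral_bigsetU => //.
  - exact: index_enum_uniq.
  - by case/integrableP : (inA A mA).
rewrite /Rintegral EA -sum_fine; last first.
  by move=> i _; exact: (@integrable_fin_num _ _ R mu (F i) (mF i) _ (inA (F i) (mF i))).
apply: ler_sum => i _.
have [aui [uvi vib]] := uv i.
have -> : fine (\int[mu]_(t in `]c, v i]) (h t)%:E) - fine (\int[mu]_(t in `]c, u i]) (h t)%:E)
   = \int[mu]_(t in F i) h t.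
  rewrite -[LHS]/(\int[mu]_(t in `]c, v i]) h t - \int[mu]_(t in `]c, u i]) h t).
  rewrite Rintegral_itvB ?bnd_simp//; last by rewrite (le_trans ca).
  by apply: iA; exact: measurable_itv.
exact: (@le_normr_Rintegral _ _ R mu (F i) h (mF i) (iA _ (mF i))).
Qed.

Definition prim h x := \int[mu]_(t in `]-1, x]) h t.

Lemma prim_abs_cont h : mu.-integrable setT (EFin \o h) -> abs_cont (-1) 1 (prim h).
Proof. exact: abs_cont_integral. Qed.

Lemma prim_is_derive h : mu.-integrable setT (EFin \o h) ->
  {ae mu, forall x, x \in `]-1, 1[ -> is_derive x 1 (prim h) (h x)}.
Proof.
move=> ih.
have ih' y : mu.-integrable [set` Interval (BRight (-1)) (BRight y)] (EFin \o h).
  by apply: integrableS ih => //; exact: measurableT.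
have := FTC1 ih' (open_integrable_locally openT ih).
apply: ae_filterS => x H; rewrite in_itv/= => /andP[ax xb].
have [dF FE] := H ax.
exact: derive1_is_derive.
Qed.

Lemma prim_at_left h : mu.-integrable setT (EFin \o h) ->
  prim h x @[x --> (-1)^'+] --> 0.
Proof.
move=> ih; have lt11 : -1 < 1 :> R by lra.
have /(continuous_within_itvP _ lt11)[_ + _] := abs_cont_within_continuous lt11 (prim_abs_cont ih).
by rewrite {2}/prim set_itvoc0 Rintegral_set0.
Qed.

Lemma prim_at_right h : mu.-integrable setT (EFin \o h) ->
  prim h x @[x --> 1^'-] --> prim h 1.
Proof.
move=> ih; have lt11 : -1 < 1 :> R by lra.
by have /(continuous_within_itvP _ lt11)[] := abs_cont_within_continuous lt11 (prim_abs_cont ih).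
Qed.

Lemma prim_bound h k x : mu.-integrable setT (EFin \o h) -> mu.-integrable setT (EFin \o k) ->
  (forall x, `|h x| <= k x) -> `|prim h x| <= \int[mu]_t k t.
Proof. by move=> ih ik hk; exact: normr_Rintegral_le. Qed.

Lemma prim_tail_bound h k x : x \in `]-1, 1[ -> mu.-integrable setT (EFin \o h) ->
  mu.-integrable setT (EFin \o k) ->
  (forall x, `|h x| <= k x) -> `|prim h 1 - prim h x| <= \int[mu]_t k t.
Proof.
rewrite in_itv/= => /andP[x1 x2] ih ik hk.
rewrite /prim Rintegral_itvB ?bnd_simp ?(ltW x1) ?(ltW x2)//.
  by apply: normr_Rintegral_le => //; exact: measurable_itv.
by apply: integrableS ih => //; exact: measurableT.
Qed.

(* Monotone convergence over an exhaustion of the interval. *)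
Lemma integrable_derivative (F k : R -> R) M :
  (forall x, x \in `]-1, 1[ -> is_derive x 1 F (k x)) ->
  (forall x, x \in `]-1, 1[ -> 0 <= k x) ->
  (forall x, x \in `]-1, 1[ -> {for x, continuous k}) ->
  (forall x, x \in `]-1, 1[ -> `|F x| <= M) ->
  mu.-integrable J (EFin \o k).
Proof.
move=> dF k0 ck FM.
have mk : measurable_fun J k.
  apply: open_continuous_measurable_fun; first exact: interval_open.
  by move=> x; rewrite inE; exact: ck.
(* The bound [r n <= 1/2] makes each [D n] a proper interval. *)
pose r (n : nat) : R := n.+2%:R^-1.
have r0 n : 0 < r n by rewrite /r invr_gt0.
have r1 n : r n <= 2^-1 by rewrite /r lef_pV2 ?posrE// ler_nat.
pose D n := `[-1 + r n, 1 - r n]%classic : set R.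
have DJ n : D n `<=` `]-1, 1[.
  move=> x; rewrite /D/= !in_itv/= => /andP[h1 h2].
  by have := r0 n; move: h1 h2; set q := r n => h1 h2 q0; apply/andP; split; lra.
have UD : \bigcup_n D n = `]-1, 1[%classic.
  rewrite eqEsubset; split; first by move=> x [n _]; exact: DJ.
  move=> x; rewrite /= in_itv/= => /andP[x1 x2].
  have m0 : 0 < Num.min (x + 1) (1 - x) by rewrite lt_min; apply/andP; split; lra.
  have [n] : exists n, r n < Num.min (x + 1) (1 - x).
    exists (Num.bound (Num.min (x + 1) (1 - x))^-1).
    rewrite /r -[ltRHS]invrK ltf_pV2 ?posrE ?invr_gt0//.
    apply: (lt_trans (archi_boundP _)); first by rewrite invr_ge0 ltW.
    by rewrite ltr_nat.
  rewrite lt_min => /andP[n1 n2]; exists n => //.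
  rewrite /D/= in_itv/=; move: n1 n2; set q := r n => n1 n2.
  by apply/andP; split; lra.
have mD n : measurable (D n) by exact: measurable_itv.
have k0' n x : D n x -> (0 <= (k x)%:E)%E by move=> /DJ xJ; rewrite lee_fin k0.
have ndD : nondecreasing_seq D.
  apply/nondecreasing_seqP => n; apply/subsetPset => x; rewrite /D/= !in_itv/= => /andP[h1 h2].
  have : r n.+1 <= r n by rewrite /r lef_pV2 ?posrE// ler_nat.
  by move: h1 h2; set q := r n; set q' := r n.+1 => h1 h2 h3; apply/andP; split; lra.
have mkD n : measurable_fun (D n) (EFin \o k).
  by apply/measurable_EFinP; exact: measurable_funS mk.
have := ge0_nondecreasing_set_cvg_integral (mu := mu) ndD mD mkD k0'.
rewrite UD => cv.
apply/integrableP; split; first exact/measurable_EFinP.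
have -> : (\int[mu]_(x in J) `|(EFin \o k) x| = \int[mu]_(x in J) (EFin \o k) x)%E.
  apply: eq_integral; by move=> x; rewrite inE => xJ /=; rewrite ger0_norm// k0.
apply: (@le_lt_trans _ _ (M + M)%:E); last exact: ltry.
rewrite -(cvg_lim _ cv)//; apply: lime_le; first by apply/cvg_ex; eexists; exact: cv.
near=> n.
have ab : -1 + r n < 1 - r n.
  by have := r1 n; set q := r n => h; lra.
have aJ : -1 + r n \in `]-1, 1[.
  by apply: (DJ n); rewrite /D/= in_itv/= lexx (ltW ab).
have bJ : 1 - r n \in `]-1, 1[.
  by apply: (DJ n); rewrite /D/= in_itv/= lexx (ltW ab).
have cF x : x \in `]-1, 1[ -> {for x, continuous F}.
  by move=> /dF[/derivable1_diffP h _]; exact: differentiable_continuous.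
rewrite (@continuous_FTC2 _ _ F)//.
- rewrite -EFinB lee_fin; have := FM _ aJ; have := FM _ bJ.
  by rewrite !ler_norml => /andP[_ h1] /andP[h2 _]; lra.
- apply: continuous_in_subspaceT => x; rewrite inE => /DJ; exact: ck.
- split.
  + by move=> x xab; have [] := dF x (DJ n x (subset_itv_oo_cc xab)).
  + by apply: cvg_at_right_filter; exact: cF.
  + by apply: cvg_at_left_filter; exact: cF.
- by move=> x xab; rewrite derive1E; have [] := dF x (DJ n x (subset_itv_oo_cc xab)).
Unshelve. all: by end_near. Qed.

(** The discriminant argument behind the Cauchy-Schwarz inequality: the minimum of s^2 X - 2 s I + Y
    is attained at s = I / X. If X = 0, a large s forces I = 0. *)
Lemma sqr_le_mulP (I X Y : R) : 0 <= X -> 0 <= I ->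
  (forall s, 0 <= s -> 2 * s * I <= s ^+ 2 * X + Y) -> I ^+ 2 <= X * Y.
Proof.
move=> X0 I0 h.
have [X00|X0'] := eqVneq X 0.
  have Y0 : 0 <= Y by have := h 0; rewrite lexx expr0n/= !(mul0r,mulr0) add0r; apply.
  have [->|In0] := eqVneq I 0; first by rewrite X00 expr0n mul0r.
  have Ip : 0 < I by rewrite lt_neqAle eq_sym In0.
  (* For this value of s the hypothesis reads 2 (Y + 1) <= Y, which is absurd since Y >= 0. *)
  have := h ((Y + 1) / I); rewrite X00 mulr0 add0r => /(_ (divr_ge0 (addr_ge0 Y0 ler01) I0)).
  by rewrite -mulrA mulfVK//; lra.
have Xp : 0 < X by rewrite lt_neqAle eq_sym X0'.
have := h (I / X) (divr_ge0 I0 X0).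
have -> : 2 * (I / X) * I = 2 * (I ^+ 2 / X) by field.
have -> : (I / X) ^+ 2 * X = I ^+ 2 / X by field.
move=> h'; have h2 : I ^+ 2 / X <= Y by lra.
by move: h2; rewrite ler_pdivrMr// mulrC.
Qed.

End Primitives.

Section NegligibleModification.
Import HBNNSimple.
Context d (T : measurableType d) (R : realType) (mu : {measure set T -> \bar R}).

(* The functions need not be measurable: the integral of a nonnegative function
   is a supremum over the simple functions below it, and these can be cut off
   on a null set. *)
Lemma ge0_ae_le_integral_patch (D : set T) (F G : T -> \bar R) :
  (forall x, D x -> (0 <= F x)%E) -> (forall x, D x -> (0 <= G x)%E) ->
  {ae mu, forall x, D x -> F x = G x} ->
  (\int[mu]_(x in D) F x <= \int[mu]_(x in D) G x)%E.
Proof.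
move=> F0 G0 [N [mN N0 sN]].
rewrite !ge0_integralE//; apply: ge_ereal_sup => _ /= [h hF <-].
have mNC : measurable (~` N) by exact: measurableC.
pose h' := proj_nnsfun h mNC.
have -> : sintegral mu h = sintegral mu h'.
  rewrite -!integralT_nnsfun; apply: ge0_ae_eq_integral => //.
  - by apply/measurable_EFinP.
  - by apply/measurable_EFinP.
  - by move=> x _; rewrite lee_fin.
  - by move=> x _; rewrite lee_fin.
  - exists N; split => // x /=; apply: contra_notP => Nx _.
    by rewrite mindicE mem_set// mulr1.
apply: ereal_sup_ubound; exists h' => //= x.
rewrite mindicE; have [xN|xN] := boolP (x \in ~` N); rewrite ?mulr0 ?mulr1.
  have := hF x; rewrite !patchE; case: ifPn => // xD; rewrite inE in xN.
  have -> // : F x = G x.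
  by move: xN; apply: contra_notP => FG; apply: sN => /=; apply/not_implyP; rewrite inE in xD.
by apply: erestrict_ge0.
Qed.

Lemma ge0_ae_eq_integral_patch (D : set T) (F G : T -> \bar R) :
  (forall x, D x -> (0 <= F x)%E) -> (forall x, D x -> (0 <= G x)%E) ->
  {ae mu, forall x, D x -> F x = G x} ->
  (\int[mu]_(x in D) F x = \int[mu]_(x in D) G x)%E.
Proof.
move=> F0 G0 FG; apply/eqP; rewrite eq_le !ge0_ae_le_integral_patch//.
by apply: filterS FG => x h /h.
Qed.

End NegligibleModification.

Section AbsContAlgebra.
Variable R : realType.
Implicit Types (a b c x : R) (h k : R -> R).

(** By the mean value theorem [h] is Lipschitz, with a bound of the continuous derivative as
    constant. *)
Lemma abs_cont_derive a b h k : a < b -> {within `[a, b], continuous k} ->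
  (forall x, x \in `[a, b] -> is_derive x 1 h (k x)) -> abs_cont a b h.
Proof.
move=> ab ck dh.
have [M0 kM] : exists M : R, forall x, x \in `[a, b] -> `|k x| <= M.
  have := continuous_compact ck (@segment_compact _ a b).
  move=> /compact_bounded[M [_ hM]]; exists (M + 1) => x xab.
  by apply: (hM (M + 1)); [rewrite ltrDl|exists x].
pose M := `|M0| + 1.
have Mp : 0 < M by rewrite /M ltr_wpDl.
move=> e e0; exists (e / M); first by rewrite divr_gt0.
move=> n u v uv dis sd.
apply: (@le_lt_trans _ _ (\sum_(i < n) M * (v i - u i))); last first.
  by rewrite -mulr_sumr mulrC -ltr_pdivlMr.
apply: ler_sum => i _; have [aui [uvi vib]] := uv i.
have sub x : x \in `[u i, v i] -> x \in `[a, b].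
  by rewrite !in_itv/= => /andP[h1 h2]; rewrite (le_trans aui h1) (le_trans h2 vib).
have [c cuv ->] : exists2 c, c \in `[u i, v i] & h (v i) - h (u i) = k c * (v i - u i).
  have hd x : x \in `]u i, v i[ -> is_derive x 1 h (k x).
    by move=> xuv; apply: dh; apply: sub; exact: subset_itv_oo_cc.
  have hc : {within `[u i, v i], continuous h}.
    apply: continuous_in_subspaceT => x; rewrite inE => xuv.
    by apply: differentiable_continuous; apply/derivable1_diffP; case: (dh x (sub x xuv)).
  have [c cuv E] := MVT_segment uvi hd hc.
  by exists c.
rewrite normrM (ger0_norm (_ : 0 <= v i - u i)) ?subr_ge0// ler_wpM2r ?subr_ge0//.
by rewrite (le_trans (kM c (sub c cuv)))// /M (le_trans (ler_norm _))// lerDl.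
Qed.

Lemma abs_contM a b h k : a < b -> abs_cont a b h -> abs_cont a b k ->
  abs_cont a b (fun x => h x * k x).
Proof.
move=> ab ach ack.
have bnd l : abs_cont a b l -> exists2 M : R, 0 < M & forall x, x \in `[a, b] -> `|l x| <= M.
  move=> acl.
  have := continuous_compact (abs_cont_within_continuous ab acl) (@segment_compact _ a b).
  move=> /compact_bounded[M [_ hM]]; exists (`|M| + 1); first by rewrite ltr_wpDl.
  move=> x xab; apply: (hM (`|M| + 1)); last by exists x.
  by rewrite ltr_pwDr// ler_norm.
have [M M0 hM] := bnd _ ach; have [M' M'0 kM] := bnd _ ack.
move=> e e0.
have e1 : 0 < e / 2 / M' by rewrite !divr_gt0.
have e2 : 0 < e / 2 / M by rewrite !divr_gt0.
have [d d0 Hd] := ach _ e1; have [d' d'0 Hd'] := ack _ e2.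
exists (Num.min d d'); first by rewrite lt_min d0.
move=> n u v uv dis; rewrite lt_min => /andP[sd sd'].
have {Hd} H1 := Hd n u v uv dis sd; have {Hd'} H2 := Hd' n u v uv dis sd'.
apply: (@le_lt_trans _ _ (M' * (\sum_(i < n) `|h (v i) - h (u i)|)
    + M * \sum_(i < n) `|k (v i) - k (u i)|)); last first.
  by rewrite [ltRHS]splitr ltrD// mulrC -ltr_pdivlMr.
rewrite !mulr_sumr -big_split/=; apply: ler_sum => i _; have [aui [uvi vib]] := uv i.
rewrite (_ : _ - _ = (h (v i) - h (u i)) * k (v i) + h (u i) * (k (v i) - k (u i))); last by ring.
rewrite (le_trans (ler_normD _ _))// !normrM lerD//.
  by rewrite mulrC ler_wpM2r// kM// in_itv/= vib (le_trans aui).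
by rewrite ler_wpM2r// hM// in_itv/= aui (le_trans uvi).
Qed.

End AbsContAlgebra.

(** * The Gamma function *)

Local Notation Re := complex.Re.
Local Notation Im := complex.Im.

(** * Real and imaginary parts *)

Section ComplexParts.
Variable R : realType.
Implicit Types (z w : R[i]) (x : R).

Lemma ReD z w : Re (z + w) = Re z + Re w. Proof. by case: z; case: w. Qed.
Lemma ImD z w : Im (z + w) = Im z + Im w. Proof. by case: z; case: w. Qed.
Lemma ReN z : Re (- z) = - Re z. Proof. by case: z. Qed.
Lemma ImN z : Im (- z) = - Im z. Proof. by case: z. Qed.
Lemma ReM z w : Re (z * w) = Re z * Re w - Im z * Im w.
Proof. by case: z; case: w. Qed.
Lemma ImM z w : Im (z * w) = Re z * Im w + Im z * Re w.
Proof. by case: z => a b; case: w => c d. Qed.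
Lemma ReZ x w : Re (x%:C%C * w) = x * Re w.
Proof. by rewrite ReM /= mul0r subr0. Qed.
Lemma ImZ x w : Im (x%:C%C * w) = x * Im w.
Proof. by rewrite ImM /= mul0r addr0. Qed.
Lemma complexP z w : Re z = Re w -> Im z = Im w -> z = w.
Proof. by case: z => a b; case: w => c d /= -> ->. Qed.
Lemma Re_sum (I : Type) (r : seq I) (P : pred I) (F : I -> R[i]) :
  Re (\sum_(i <- r | P i) F i) = \sum_(i <- r | P i) Re (F i).
Proof. by elim/big_rec2: _ => // i x y _ <-; rewrite ReD. Qed.
Lemma Im_sum (I : Type) (r : seq I) (P : pred I) (F : I -> R[i]) :
  Im (\sum_(i <- r | P i) F i) = \sum_(i <- r | P i) Im (F i).
Proof. by elim/big_rec2: _ => // i x y _ <-; rewrite ImD. Qed.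

Lemma rcD (x y : R) : (x + y)%:C%C = x%:C%C + y%:C%C.
Proof. by rewrite rmorphD. Qed.
Lemma rcM (x y : R) : (x * y)%:C%C = x%:C%C * y%:C%C.
Proof. by rewrite rmorphM. Qed.
Lemma rcN (x : R) : (- x)%:C%C = - x%:C%C :> R[i].
Proof. by rewrite rmorphN. Qed.
Lemma rcV (x : R) : (x^-1)%:C%C = (x%:C%C)^-1 :> R[i].
Proof. by rewrite fmorphV. Qed.
Lemma rc_nat (n : nat) : (n%:R)%:C%C = n%:R :> R[i].
Proof. by rewrite rmorph_nat. Qed.
Lemma rc_eq0 (x : R) : ((x%:C)%C == 0) = (x == 0).
Proof. by rewrite eq_complex/= eqxx andbT. Qed.

Lemma normc_ge0 z : 0 <= normc z.
Proof. by case: z => a b; exact: sqrtr_ge0. Qed.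
Lemma normc_rc x : normc x%:C%C = `|x|.
Proof. by rewrite /normc /= expr0n/= addr0 sqrtr_sqr. Qed.
Lemma normc_sqr z : normc z ^+ 2 = Re z ^+ 2 + Im z ^+ 2.
Proof. by case: z => a b /=; rewrite sqr_sqrtr// addr_ge0 ?sqr_ge0. Qed.
Lemma ler_normc_Re z : `|Re z| <= normc z.
Proof.
rewrite -(@ler_pXn2r _ 2)// ?nnegrE ?normc_ge0//.
by rewrite normc_sqr -normrX ger0_norm ?sqr_ge0// lerDl sqr_ge0.
Qed.
Lemma ler_normc_Im z : `|Im z| <= normc z.
Proof.
rewrite -(@ler_pXn2r _ 2)// ?nnegrE ?normc_ge0//.
by rewrite normc_sqr -normrX ger0_norm ?sqr_ge0// lerDr sqr_ge0.
Qed.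
Lemma ler_normc_parts z : normc z <= `|Re z| + `|Im z|.
Proof.
rewrite -(@ler_pXn2r _ 2)// ?nnegrE ?normc_ge0 ?addr_ge0//.
rewrite normc_sqr sqrrD -!normrX !(ger0_norm (sqr_ge0 _)).
have := mulr_ge0 (normr_ge0 (Re z)) (normr_ge0 (Im z)); rewrite mulr2n; lra.
Qed.
Lemma normcB z w : normc (z - w) <= normc z + normc w.
Proof. by rewrite (le_trans (le_normcD _ _))// normcN. Qed.
Lemma normc_sum (I : Type) (r : seq I) (P : pred I) (F : I -> R[i]) :
  normc (\sum_(i <- r | P i) F i) <= \sum_(i <- r | P i) normc (F i).
Proof.
elim/big_ind2 : _ => [|x y z w h1 h2|//]; first by rewrite normc0.
by rewrite (le_trans (le_normcD _ _))// lerD.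
Qed.
Lemma normc_eq0 z : (normc z == 0) = (z == 0).
Proof. by apply/eqP/eqP => [/eq0_normc|->]; rewrite ?normc0. Qed.
Lemma normc_gt0 z : (0 < normc z) = (z != 0).
Proof. by rewrite lt_def normc_eq0 normc_ge0 andbT. Qed.
Lemma normc_nat (n : nat) : normc (n%:R : R[i]) = n%:R.
Proof. by rewrite -rc_nat normc_rc ger0_norm. Qed.
Lemma normc_distC z w : normc (z - w) = normc (w - z).
Proof. by rewrite -normcN opprB. Qed.
Lemma lerB_normcD z w : normc z - normc w <= normc (z + w).
Proof.
by rewrite lerBlDr -{1}(addrK w z) (le_trans (normcB _ _)).
Qed.

End ComplexParts.

(** * Limits of complex-valued functions *)

Section ComplexLimits.
Variable R : realType.
Implicit Types (z w : R[i]).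

(** Componentwise, to match [climit]; unlike the value of [climit], it asserts that the limit
    exists. *)
Definition ccvg {T : Type} (F : set_system T) (u : T -> R[i]) (l : R[i]) : Prop :=
  (Re (u t) @[t --> F] --> Re l) /\ (Im (u t) @[t --> F] --> Im l).

Section Filter.
Variables (T : Type) (F : set_system T).
Hypothesis FF : Filter F.
Implicit Types (u v : T -> R[i]).

Lemma ccvg_norm u l : ccvg F u l <-> (normc (u t - l) @[t --> F] --> (0 : R)).
Proof.
split => [[h1 h2]|h].
  have h : `|Re (u t) - Re l| + `|Im (u t) - Im l| @[t --> F] --> (0 : R).
    rewrite -[0 : R]addr0; apply: cvgD; rewrite -(@normr0 _ R); apply: cvg_norm.
      by rewrite -(subrr (Re l)); apply: cvgB => //; exact: cvg_cst.
    by rewrite -(subrr (Im l)); apply: cvgB => //; exact: cvg_cst.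
  apply: (squeeze_cvgr _ _ h); last exact: cvg_cst.
  apply: nearW => t; rewrite normc_ge0/=.
  by rewrite (le_trans (ler_normc_parts _))// ReD ReN ImD ImN.
split; apply/cvgrPdist_lt => e e0; have /cvgrPdist_lt/(_ _ e0) := h;
  apply: filterS => t; rewrite sub0r normrN (ger0_norm (normc_ge0 _)) distrC => H.
- by rewrite (le_lt_trans _ H)// -ReN -ReD ler_normc_Re.
- by rewrite (le_lt_trans _ H)// -ImN -ImD ler_normc_Im.
Qed.

Lemma ccvg_squeeze u l (g : T -> R) :
  (\forall t \near F, normc (u t - l) <= g t) -> g @ F --> (0 : R) -> ccvg F u l.
Proof.
move=> h g0; apply/ccvg_norm; apply: (squeeze_cvgr _ (cvg_cst _) g0).
by apply: filterS h => t ->; rewrite normc_ge0.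
Qed.

Lemma ccvg_cst l : ccvg F (fun=> l) l. Proof. by split; exact: cvg_cst. Qed.

Lemma ccvgD u v l m : ccvg F u l -> ccvg F v m -> ccvg F (fun t => u t + v t) (l + m).
Proof.
move=> [a b] [c d]; split; rewrite ?ReD ?ImD.
  by under eq_fun do rewrite ReD; exact: cvgD.
by under eq_fun do rewrite ImD; exact: cvgD.
Qed.

Lemma ccvgN u l : ccvg F u l -> ccvg F (fun t => - u t) (- l).
Proof.
move=> [a b]; split; rewrite ?ReN ?ImN.
  by under eq_fun do rewrite ReN; exact: cvgN.
by under eq_fun do rewrite ImN; exact: cvgN.
Qed.

Lemma ccvgB u v l m : ccvg F u l -> ccvg F v m -> ccvg F (fun t => u t - v t) (l - m).
Proof. by move=> ul vm; apply: ccvgD => //; exact: ccvgN. Qed.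

Lemma ccvgM u v l m : ccvg F u l -> ccvg F v m -> ccvg F (fun t => u t * v t) (l * m).
Proof.
move=> [a b] [c d]; split; rewrite ?ReM ?ImM.
  by under eq_fun do rewrite ReM; apply: cvgB; exact: cvgM.
by under eq_fun do rewrite ImM; apply: cvgD; exact: cvgM.
Qed.

Lemma ccvg_rc (g : T -> R) (x : R) : g @ F --> x -> ccvg F (fun t => (g t)%:C%C) x%:C%C.
Proof. by move=> gx; split => //=; exact: cvg_cst. Qed.

Lemma ccvg_near_eq u v l : (\forall t \near F, u t = v t) -> ccvg F u l -> ccvg F v l.
Proof.
move=> uv [a b]; split.
  by apply: cvg_trans a; apply: near_eq_cvg; apply: filterS uv => t ->.
by apply: cvg_trans b; apply: near_eq_cvg; apply: filterS uv => t ->.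
Qed.

Lemma ccvg_normc u l : ccvg F u l -> normc (u t) @[t --> F] --> normc l.
Proof.
move=> /ccvg_norm h; apply/cvgrPdist_lt => e e0.
have /cvgrPdist_lt/(_ _ e0) := h; apply: filterS => t.
rewrite sub0r normrN (ger0_norm (normc_ge0 _)) => H; apply: le_lt_trans H.
rewrite ler_norml; apply/andP; split.
  by have := lerB_normcD (u t) (- l); rewrite normcN; lra.
by have := lerB_normcD l (- u t); rewrite normcN normc_distC; lra.
Qed.

Lemma ccvgV u l : l != 0 -> ccvg F u l -> ccvg F (fun t => (u t)^-1) l^-1.
Proof.
move=> l0 ul.
have h1 := ccvg_normc ul.
have nl : 0 < normc l by rewrite normc_gt0.
have nz : \forall t \near F, normc l / 2 < normc (u t).
  by apply: (cvgr_gt _ h1); rewrite ltr_pdivrMr// ltr_pMr// ltr1n.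
apply: (@ccvg_squeeze _ _ (fun t => normc (u t - l) * (2 / (normc l ^+ 2)))).
  apply: filterS nz => t ut.
  have ut0 : 0 < normc (u t) by apply: le_lt_trans ut; rewrite divr_ge0// normc_ge0.
  have -> : (u t)^-1 - l^-1 = - (u t - l) * ((u t)^-1 * l^-1).
    by field; rewrite l0 -normc_gt0 ut0.
  rewrite normcM normcN ler_wpM2l ?normc_ge0// normcM !normcV.
  rewrite -invfM -[leRHS]invrK lef_pV2 ?posrE ?invr_gt0 ?divr_gt0 ?exprn_gt0 ?mulr_gt0//.
  by rewrite invf_div expr2 -mulrAC ler_pM2r// ltW.
rewrite -(mul0r (2 / normc l ^+ 2)); apply: cvgM; last exact: cvg_cst.
exact/ccvg_norm.
Qed.

End Filter.

Section ProperFilter.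
Variables (T : Type) (F : set_system T).
Hypothesis FF : ProperFilter F.
Implicit Types (u v : T -> R[i]).

Lemma ccvg_climit u l : ccvg F u l -> climit F u = l.
Proof.
move=> [a b]; rewrite /climit; apply: complexP => /=; apply/cvg_lim => //.
Qed.

Lemma ccvg_unique u l m : ccvg F u l -> ccvg F u m -> l = m.
Proof. by move=> /ccvg_climit <- /ccvg_climit <-. Qed.

End ProperFilter.

Lemma ccvg_comp {T U : Type} (F : set_system T) (G : set_system U) (f : T -> U) u l :
  Filter F -> Filter G -> f @ F `=>` G -> ccvg G u l -> ccvg F (u \o f) l.
Proof. by move=> FF FG fFG [a b]; split; [exact: (cvg_comp _ _ fFG a) | exact: (cvg_comp _ _ fFG b)]. Qed.

End ComplexLimits.

Local Open Scope complex_scope.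

(** * Estimates for the complex exponential near zero *)

Section ComplexExponential.
Variable R : realType.
Implicit Types (z w : R[i]) (x y : R).

Lemma cexpD z w : cexp (z + w) = cexp z * cexp w.
Proof.
rewrite /cexp ReD ImD expRD cosD sinD; apply: complexP; rewrite ?ReM ?ImM ?ReM ?ImM /=; ring.
Qed.

Lemma cexp0 : cexp (0 : R[i]) = 1.
Proof. by rewrite /cexp/= expR0 cos0 sin0 mul1r. Qed.

Lemma cexp_neq0 z : cexp z != 0.
Proof.
apply/eqP => h; have := cexpD z (- z); rewrite subrr cexp0 h mul0r => /eqP.
by rewrite oner_eq0.
Qed.

Lemma cexpN z : cexp (- z) = (cexp z)^-1.
Proof.
apply: (mulfI (cexp_neq0 z)); rewrite mulfV ?cexp_neq0//.
by rewrite -cexpD subrr cexp0.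
Qed.

Lemma cexp_real x : cexp x%:C = (expR x)%:C.
Proof. by rewrite /cexp/= cos0 sin0 mulr1. Qed.

Lemma norm_sin_le x : `|sin x| <= `|x|.
Proof.
wlog x0 : x / 0 <= x.
  move=> H; have [|/ltW x0] := leP 0 x; first exact: H.
  by rewrite -normrN -sinN -(normrN x) H// oppr_ge0.
have [|c _] := @MVT_segment _ sin cos 0 x x0 (fun y _ => is_derive_sin y).
  by apply: continuous_subspaceT => y; exact: continuous_sin.
rewrite sin0 !subr0 => ->; rewrite normrM ler_piMl//; exact: cos_max.
Qed.

Lemma cos_ge1B x : 1 - x ^+ 2 <= cos x.
Proof.
have h : cos x = 1 - 2 * sin (x / 2) ^+ 2.
  have {1}-> : x = (x / 2) *+ 2 by rewrite mulr2n -splitr.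
  by rewrite cos_mulr2n cos2sin2; ring.
have : sin (x / 2) ^+ 2 <= (x / 2) ^+ 2.
  rewrite -(ger0_norm (sqr_ge0 (sin _))) -(ger0_norm (sqr_ge0 (x / 2))) !normrX.
  by rewrite lerXn2r ?nnegrE ?normr_ge0// norm_sin_le.
rewrite h expr_div_n; have := sqr_ge0 x; nra.
Qed.

Lemma norm_sinB_le x : `|x| <= 1 -> `|sin x - x| <= x ^+ 2.
Proof.
wlog x0 : x / 0 <= x.
  move=> H; have [|/ltW x0] := leP 0 x; first exact: H.
  move=> x1; have := H (- x); rewrite normrN sinN -opprD normrN sqrrN; apply => //.
  by rewrite oppr_ge0.
rewrite ger0_norm// => x1.
have [|c] := @MVT_segment _ sin cos 0 x x0 (fun y _ => is_derive_sin y).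
  by apply: continuous_subspaceT => y; exact: continuous_sin.
rewrite in_itv/= sin0 !subr0 => /andP[c0 cx] ->.
have := cos_ge1B c; have := cos_le1 c => h1 h2.
by rewrite ler_norml; apply/andP; split; nra.
Qed.

Lemma expR_le x : x <= 2^-1 -> expR x <= 1 + x + 2 * x ^+ 2.
Proof.
move=> x2; have x1 : 0 < 1 - x by lra.
have := expR_ge1Dx (- x); rewrite expRN => h.
have h1 : expR x <= (1 - x)^-1.
  by rewrite -[leLHS]invrK lef_pV2 ?posrE ?invr_gt0 ?expR_gt0.
apply: (le_trans h1); rewrite -[leLHS]div1r ler_pdivrMr//.
have := sqr_ge0 x; rewrite !expr2; nra.
Qed.

(** With z = x + i y, the real part of the remainder is at most 2 x^2 + 2 y^2 and the imaginary part
    at most 2 |x| |y| + y^2; the constant 7 is generous. *)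
Lemma cexp_remainder z : normc z <= 2^-1 -> normc (cexp z - 1 - z) <= 7 * normc z ^+ 2.
Proof.
move=> z2; have := ler_normc_Re z; have := ler_normc_Im z.
have n2 := normc_sqr z; have n0 := normc_ge0 z.
move=> hI hR; apply: (le_trans (ler_normc_parts _)); move: hI hR.
rewrite /cexp !ReD !ImD !ReN !ImN ReZ ImZ /=.
move: z2 n2 n0; set r := normc z; set x := Re z; set y := Im z => r2 rE r0.
rewrite !ler_norml => /andP[y1 y2] /andP[x1 x2].
have e1 : expR x <= 1 + x + 2 * x ^+ 2 by apply: expR_le; lra.
have e2 := expR_ge1Dx x.
have c1 := cos_ge1B y; have c2 := cos_le1 y.
have s1 : `|sin y - y| <= y ^+ 2.
  by apply: norm_sinB_le; rewrite ler_norml; apply/andP; split; lra.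
have s2 := norm_sin_le y.
have x20 := sqr_ge0 x; have y20 := sqr_ge0 y.
have A : `|expR x * cos y - 1 - x| <= 2 * x ^+ 2 + 2 * y ^+ 2.
  have x22 : x ^+ 2 <= 4^-1 by rewrite expr2; nra.
  have -> : expR x * cos y - 1 - x = (expR x - 1 - x) - expR x * (1 - cos y) by ring.
  have : 0 <= expR x * (1 - cos y) <= 2 * y ^+ 2.
    apply/andP; split; first by apply: mulr_ge0; [exact: expR_ge0 | lra].
    by apply: ler_pM; [exact: expR_ge0 | lra | lra | lra].
  move=> /andP[h1 h2]; rewrite ler_norml; apply/andP; split; lra.
have B : `|expR x * sin y - 0 - y| <= 2 * `|x| * `|y| + y ^+ 2.
  have -> : expR x * sin y - 0 - y = (expR x - 1) * sin y + (sin y - y) by ring.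
  rewrite (le_trans (ler_normD _ _))// lerD// normrM.
  apply: ler_pM => //.
  have nx : x ^+ 2 = `|x| * `|x| by rewrite -normrM -expr2 ger0_norm ?sqr_ge0.
  have nx0 : 0 <= `|x| by [].
  have xh : `|x| <= 2^-1 by rewrite ler_norml; apply/andP; split; lra.
  have : 2 * x ^+ 2 <= `|x| by rewrite nx; nra.
  have := ler_norm x; have := ler_norm (- x); rewrite normrN => h3 h4 h5.
  rewrite ler_norml; apply/andP; split; lra.
have nx : x ^+ 2 = `|x| ^+ 2 by rewrite -normrX ger0_norm ?sqr_ge0.
have ny : y ^+ 2 = `|y| ^+ 2 by rewrite -normrX ger0_norm ?sqr_ge0.
have : 2 * `|x| * `|y| <= x ^+ 2 + y ^+ 2.
  by rewrite nx ny; have := sqr_ge0 (`|x| - `|y|); rewrite sqrrB; lra.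
lra.
Qed.

End ComplexExponential.

(** * Convergence of infinite products *)

Section ProductConvergence.
Variable R : realType.
Implicit Types (C : R).

Let gap (n : nat) : R := n%:R^-1 - n.+1%:R^-1.

Let gapE n : (0 < n)%N -> gap n = (n%:R * n.+1%:R)^-1 :> R.
Proof.
move=> n0; rewrite /gap -natr1.
have n0' : (0 : R) < n%:R by rewrite ltr0n.
by field; apply/andP; split; lra.
Qed.

Let gap_ge0 n : (0 < n)%N -> 0 <= gap n.
Proof. by move=> n0; rewrite gapE// invr_ge0 mulr_ge0. Qed.

(** From [N] on, [x n - C / n] is nondecreasing: an increment of x is never below minus the decrease
    of C / n. It is bounded, and C / n tends to 0. *)
Lemma telescoping_bound_cvg (x : nat -> R) C N : (0 < N)%N ->
  (forall n, (N <= n)%N -> `|x n.+1 - x n| <= C * (n%:R^-1 - n.+1%:R^-1)) ->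
  (exists B, forall n, (N <= n)%N -> `|x n| <= B) -> cvgn x.
Proof.
move=> N0 dx [B xB].
have C0 : 0 <= C.
  have := le_trans (normr_ge0 _) (dx N (leqnn _)); rewrite -/(gap N) pmulr_lge0//.
  by rewrite gapE// invr_gt0 mulr_gt0// ltr0n.
pose y n := x (n + N)%N - C / (n + N)%:R.
have nd : nondecreasing_seq y.
  apply/nondecreasing_seqP => n; rewrite /y addSn.
  have := dx (n + N)%N (leq_addl _ _); rewrite ler_norml => /andP[+ _].
  by rewrite mulrBr; set u := _ / _; set v := _ / _; lra.
have cy : cvgn y.
  apply: nondecreasing_is_cvgn => //; exists B => _ [n _ <-].
  rewrite /y; have := xB (n + N)%N (leq_addl _ _); rewrite ler_norml => /andP[_ h].
  have : 0 <= C / (n + N)%:R by rewrite divr_ge0.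
  lra.
have ch : C / (n + N)%:R @[n --> \oo] --> 0.
  rewrite -(mulr0 C); apply: cvgM; first exact: cvg_cst.
  have := @cvg_harmonic R; rewrite -(cvg_shiftn N.-1).
  by under eq_fun do rewrite /harmonic/= -addnS prednK//.
have : cvgn (fun n => x (n + N)%N).
  rewrite (_ : (fun n => _) = (fun n => y n + C / (n + N)%:R)); last first.
    by apply/funext => n; rewrite /y subrK.
  by apply: is_cvgD => //; apply/cvg_ex; exists 0.
by move=> /cvg_ex[l]; rewrite (cvg_shiftn N) => xl; apply/cvg_ex; exists l.
Qed.

(* P is a product with factors 1 + O(n^-2), the error being written in
   telescoping form. *)
Lemma product_cvg (P : nat -> R[i]) C N : (0 < N)%N ->
  (forall n, (N <= n)%N ->
    normc (P n.+1 - P n) <= C * (n%:R^-1 - n.+1%:R^-1) * normc (P n)) ->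
  exists2 l, ccvg \oo P l & ((forall n, P n != 0) -> l != 0).
Proof.
move=> N0; wlog C0 : C / 0 < C.
  move=> H dP; apply: (H (Num.max C 1)); first by rewrite lt_max ltr01 orbT.
  move=> n Nn; rewrite (le_trans (dP n Nn))// ler_wpM2r ?normc_ge0// ler_wpM2r//.
    by rewrite gap_ge0// (leq_trans N0).
  by rewrite le_max lexx.
move=> dP.
(* Since 1 + t <= exp t and the gaps telescope, [normc (P n) * expR (C / n)] does not increase. *)
have bnd n : (N <= n)%N ->
    normc (P n) * expR (C / n%:R) <= normc (P N) * expR (C / N%:R).
  elim: n => [|n ih]; first by rewrite leqn0 => /eqP ->.
  rewrite leq_eqVlt => /predU1P[<-//|]; rewrite ltnS => Nn.
  apply: le_trans (ih Nn).
  have n0 : (0 < n)%N := leq_trans N0 Nn.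
  have -> : C / n%:R = C * gap n + C / n.+1%:R by rewrite /gap; ring.
  rewrite expRD mulrA ler_pM2r ?expR_gt0//.
  apply: (@le_trans _ _ (normc (P n) * (1 + C * gap n))); last first.
    by rewrite ler_wpM2l ?normc_ge0// expR_ge1Dx.
  have := lerB_normcD (P n.+1) (- P n); rewrite normcN; have := dP n Nn.
  rewrite /gap; set q := _^-1 - _; set s := normc (P n); lra.
pose B := normc (P N) * expR (C / N%:R).
have PB n : (N <= n)%N -> normc (P n) <= B.
  move=> Nn; apply: le_trans (bnd n Nn); rewrite ler_peMr ?normc_ge0//.
  by rewrite -[leLHS]expR0 ler_expR divr_ge0// ltW.
have dPB n : (N <= n)%N -> normc (P n.+1 - P n) <= C * B * (n%:R^-1 - n.+1%:R^-1).
  move=> Nn; rewrite (le_trans (dP n Nn))// mulrAC ler_wpM2r//.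
    by rewrite gap_ge0// (leq_trans N0).
  by apply: ler_wpM2l; [exact: ltW | exact: PB].
have cRe : cvgn (fun n => Re (P n)).
  apply: (telescoping_bound_cvg N0 (C := C * B)).
    move=> n Nn; apply: le_trans (dPB n Nn).
    by rewrite -ReN -ReD ler_normc_Re.
  exists B => n Nn; apply: le_trans (PB n Nn); exact: ler_normc_Re.
have cIm : cvgn (fun n => Im (P n)).
  apply: (telescoping_bound_cvg N0 (C := C * B)).
    move=> n Nn; apply: le_trans (dPB n Nn).
    by rewrite -ImN -ImD ler_normc_Im.
  exists B => n Nn; apply: le_trans (PB n Nn); exact: ler_normc_Im.
have cP : ccvg \oo P (limn (fun n => Re (P n)) +i* limn (fun n => Im (P n))).
  by split.
eexists; first exact: cP.
move=> Pn0.
have [M NM CM] : exists2 M : nat, (N <= M)%N & C / M%:R <= 2^-1.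
  exists (N + Num.bound (2 * C))%N; first exact: leq_addr.
  have h : 2 * C < (N + Num.bound (2 * C))%:R.
    rewrite natrD; have := @archi_boundP R (2 * C) (ltac:(apply: mulr_ge0 => //; exact: ltW)).
    by have : (0 : R) <= N%:R by []; lra.
  rewrite ler_pdivrMr; last by apply: le_lt_trans h; rewrite mulr_ge0// ltW.
  lra.
(* The inequality (1 - d_1) ... (1 - d_k) >= 1 - (d_1 + ... + d_k), with telescoping d_i. As C / M
   <= 1/2, the modulus stays above half of its value at [M], and the limit cannot vanish. *)
have low n : (M <= n)%N -> normc (P M) * (1 - C / M%:R + C / n%:R) <= normc (P n).
  elim: n => [|n ih].
    by rewrite leqn0 => /eqP M0; have := leq_trans N0 NM; rewrite M0.
  rewrite leq_eqVlt => /predU1P[<-|]; first by rewrite subrK mulr1.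
  rewrite ltnS => Mn.
  have n0 : (0 < n)%N := leq_trans N0 (leq_trans NM Mn).
  have h := ih Mn; have hd := dP n (leq_trans NM Mn).
  have := lerB_normcD (P n) (P n.+1 - P n); rewrite [P n + _]addrC subrK.
  move: hd; rewrite -/(gap n).
  set d := C * gap n; set a := C / M%:R - C / n%:R.
  have a0 : 0 <= a.
    rewrite /a subr_ge0; apply: ler_wpM2l; first exact: ltW.
    have M0 : (0 < M)%N := leq_trans N0 NM.
    by rewrite lef_pV2 ?ler_nat// posrE ltr0n.
  have d0 : 0 <= d by apply: mulr_ge0; [exact: ltW | exact: gap_ge0].
  have da : a + d = C / M%:R - C / n.+1%:R by rewrite /a /d /gap; ring.
  have ad1 : d <= 1.
    have : 0 <= C / n.+1%:R by apply: divr_ge0 => //; exact: ltW.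
    move: da CM; set u := C / M%:R; set v := C / n.+1%:R; lra.
  have -> : 1 - C / M%:R + C / n.+1%:R = 1 - (a + d) by rewrite da; ring.
  have {}h : normc (P M) * (1 - a) <= normc (P n).
    by apply: le_trans h; rewrite /a opprB addrA addrAC.
  have PM0 := normc_ge0 (P M); have Pn0' := normc_ge0 (P n).
  have : normc (P M) * (1 - (a + d)) <= normc (P M) * (1 - a) * (1 - d).
    by rewrite -mulrA ler_wpM2l//; nra.
  have : normc (P M) * (1 - a) * (1 - d) <= normc (P n) * (1 - d).
    by rewrite ler_wpM2r// subr_ge0.
  lra.
have PM : 0 < normc (P M) by rewrite normc_gt0.
rewrite -normc_gt0; apply: lt_le_trans (_ : normc (P M) / 2 <= _).
  by rewrite divr_gt0.
have := ccvg_normc _ cP; move=> /(_ _) cN.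
rewrite -(cvg_lim _ cN)//; apply: limr_ge; first by apply/cvg_ex; eexists; exact: cN.
near=> n; apply: (@le_trans _ _ (normc (P M) * (1 - C / M%:R + C / n%:R))).
  rewrite ler_pM2l//; have : 0 <= C / n%:R by apply: divr_ge0 => //; exact: ltW.
  lra.
by apply: low; near: n; exact: nbhs_infty_ge.
Unshelve. all: by end_near. Qed.

End ProductConvergence.

(** * Gauss's product for the reciprocal Gamma function *)

Section GaussProduct.
Variable R : realType.
Implicit Types (z w : R[i]).

Definition poch z n : R[i] := \prod_(k < n) (z + k%:R).

Lemma pochS z n : poch z n.+1 = poch z n * (z + n%:R).
Proof. by rewrite /poch big_ord_recr. Qed.

Lemma poch0 z : poch z 0 = 1. Proof. by rewrite /poch big_ord0. Qed.

Lemma pochSl z n : poch z n.+1 = z * poch (z + 1) n.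
Proof.
rewrite /poch big_ord_recl/= addr0; congr (_ * _); apply: eq_bigr => i _.
by rewrite /bump/= natrD addrA.
Qed.

Lemma poch_neq0 z n : (forall k, z + k%:R != 0) -> poch z n != 0.
Proof. by move=> h; apply/prodf_neq0 => i _. Qed.

Lemma rc_addn_neq0 (c : R) n : 0 < c -> c%:C + n%:R != 0 :> R[i].
Proof. by move=> c0; rewrite -rc_nat -rcD rc_eq0 gt_eqF// (lt_le_trans c0)// lerDl. Qed.

Definition gauss_prod z (n : nat) : R[i] :=
  poch z n.+1 / (n`!%:R * cexp (z * (ln (n%:R : R))%:C)).

Let lnr (n : nat) : R := ln n.+1%:R - ln n%:R.

Let ln_lower n : (0 < n)%N -> n.+1%:R^-1 <= lnr n.
Proof.
move=> n0; have n0' : (0 : R) < n%:R by rewrite ltr0n.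
have n1 : (0 : R) < n.+1%:R by rewrite ltr0n.
rewrite /lnr -lerN2 opprB -ln_div ?posrE//.
have -> : n%:R / n.+1%:R = 1 + - n.+1%:R^-1 :> R.
  by rewrite -[n.+1%:R]natr1; field; rewrite natr1 pnatr_eq0.
apply: le_ln1Dx; rewrite ltrN2 invf_lt1// ltr1n ltnS//.
Qed.

Let ln_upper n : (0 < n)%N -> lnr n <= n%:R^-1.
Proof.
move=> n0; have n0' : (0 : R) < n%:R by rewrite ltr0n.
have n1 : (0 : R) < n.+1%:R by rewrite ltr0n.
rewrite /lnr -ln_div ?posrE//.
have -> : n.+1%:R / n%:R = 1 + n%:R^-1 :> R.
  by rewrite -[n.+1%:R]natr1 mulrDl mul1r mulfV// pnatr_eq0 -lt0n.
by apply: le_ln1Dx; rewrite (lt_trans _ (_ : 0 < n%:R^-1))// invr_gt0.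
Qed.

Let gauss_ratio z n : (0 < n)%N -> gauss_prod z n.+1 =
  gauss_prod z n * ((1 + z * (n.+1%:R^-1)%:C) * cexp (- (z * (lnr n)%:C))).
Proof.
move=> n0; rewrite /gauss_prod pochS factS natrM cexpN /lnr.
have -> : z * (ln n.+1%:R - ln n%:R)%:C =
    z * (ln n.+1%:R)%:C - z * (ln n%:R)%:C by rewrite rcD rcN mulrBr.
rewrite cexpD cexpN rcV rc_nat.
have f0 : (n`!%:R : R[i]) != 0 by rewrite pnatr_eq0 -lt0n fact_gt0.
have n10 : (n.+1%:R : R[i]) != 0 by rewrite pnatr_eq0.
set E := cexp (_ * (ln n.+1%:R)%:C); set F := cexp (_ * (ln n%:R)%:C).
have E0 : E != 0 := cexp_neq0 _.
have F0 : F != 0 := cexp_neq0 _.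
move: n10; rewrite -[n.+1%:R]natr1; move: n%:R n`!%:R f0 => m f f0 m0.
by field; rewrite E0 F0 f0 m0.
Qed.

(** The ratio of consecutive terms is (1 + z / (n + 1)) exp (- z L) with L = ln ((n + 1) / n)
    between 1 / (n + 1) and 1 / n. Its terms of first order in 1 / n cancel. *)
Let gauss_ratio_bound z : exists C, exists2 N, (0 < N)%N & forall n, (N <= n)%N ->
  normc (gauss_prod z n.+1 - gauss_prod z n) <=
  C * (n%:R^-1 - n.+1%:R^-1) * normc (gauss_prod z n).
Proof.
pose m := normc z.
have m0 : 0 <= m := normc_ge0 z.
exists (m + 2 * m ^+ 2 + (1 + m) * (28 * m ^+ 2)).
(* From here on |z| L <= |z| / n <= 1/2, as [cexp_remainder] requires. *)
exists (Num.bound (2 * m)).+1 => // n Nn.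
have n0 : (0 < n)%N by exact: leq_trans Nn.
have n0' : (0 : R) < n%:R by rewrite ltr0n.
have n1 : (0 : R) < n.+1%:R by rewrite ltr0n.
rewrite gauss_ratio// -{2}[gauss_prod z n]mulr1 -mulrBr normcM mulrC.
rewrite ler_wpM2r ?normc_ge0//.
have h1 := ln_lower n0; have h2 := ln_upper n0.
move: h1 h2; set L := lnr n => h1 h2.
have nm : 2 * m <= n%:R.
  apply: (@le_trans _ _ (Num.bound (2 * m))%:R).
    by apply/ltW/archi_boundP; rewrite mulr_ge0.
  by rewrite ler_nat ltnW.
pose h : R := n.+1%:R^-1.
pose g : R := n%:R^-1 - n.+1%:R^-1.
have gE : g = n%:R^-1 * h.
  rewrite /g /h -[n.+1%:R]natr1; move: n0'; move: (n%:R : R) => q q0.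
  by field; apply/andP; split; lra.
have h0 : 0 < h by rewrite invr_gt0.
have hn : h <= n%:R^-1 by rewrite lef_pV2 ?posrE// ler_nat.
have nh : n%:R^-1 <= 2 * h.
  rewrite /h ler_pdivlMr// mulrC ler_pdivrMr// -natr1.
  have : (1 : R) <= n%:R by rewrite ler1n.
  lra.
have hg : h ^+ 2 <= g by rewrite gE expr2 ler_wpM2r// ltW.
have ng : n%:R^-1 ^+ 2 <= 2 * g by rewrite gE expr2 mulrCA ler_wpM2l// invr_ge0 ltW.
have L0 : 0 < L by apply: lt_le_trans h1.
have w2 : normc (- (z * L%:C)) <= 2^-1.
  rewrite normcN normcM normc_rc gtr0_norm//.
  apply: (@le_trans _ _ (m / n%:R)); first by rewrite ler_wpM2l.
  rewrite ler_pdivrMr//; lra.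
have := cexp_remainder w2; set r := cexp _ - 1 - _ => rb.
(* Expansion of exp (- z L) as 1 - z L + r. The three terms are bounded by [t1], [t2] and [t3],
   whose constants add up to the one announced. *)
have -> : (1 + z * h%:C) * cexp (- (z * L%:C)) - 1 =
   - (z * (L - h)%:C) + (- (z ^+ 2 * (h * L)%:C)) + (1 + z * h%:C) * r.
  rewrite /r rcD rcN rcM; ring.
have Ln2 : L ^+ 2 <= 2 * g.
  by apply: le_trans ng; rewrite lerXn2r ?nnegrE// ?invr_ge0 ltW.
have r28 : normc r <= 28 * m ^+ 2 * g.
  apply: (le_trans rb); rewrite normcN normcM normc_rc gtr0_norm// exprMn.
  have -> : 7 * (normc z ^+ 2 * L ^+ 2) = 7 * m ^+ 2 * L ^+ 2 by rewrite mulrA.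
  apply: (@le_trans _ _ (7 * m ^+ 2 * (2 * g))).
    by rewrite ler_wpM2l// mulr_ge0// sqr_ge0.
  have := mulr_ge0 (sqr_ge0 m) (le_trans (sqr_ge0 h) hg); lra.
have t1 : normc (- (z * (L - h)%:C)) <= m * g.
  by rewrite normcN normcM normc_rc ger0_norm ?subr_ge0// ler_wpM2l// /g lerB.
have t2 : normc (- (z ^+ 2 * (h * L)%:C)) <= 2 * m ^+ 2 * g.
  rewrite normcN normcM normc_rc gtr0_norm ?mulr_gt0// expr2 normcM -expr2 -/m.
  have -> : 2 * m ^+ 2 * g = m ^+ 2 * (2 * g) by ring.
  rewrite ler_wpM2l ?sqr_ge0//; apply: le_trans ng.
  by rewrite expr2; apply: ler_pM => //; exact: ltW.
have t3 : normc ((1 + z * h%:C) * r) <= (1 + m) * (28 * m ^+ 2) * g.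
  rewrite normcM -mulrA; apply: ler_pM; rewrite ?normc_ge0//.
  rewrite (le_trans (le_normcD _ _))// normc1 lerD2l normcM normc_rc gtr0_norm//.
  by rewrite ler_piMr// /h invf_le1// ler1n.
rewrite [leRHS]mulrDl [X in _ <= X + _]mulrDl.
apply: (le_trans (le_normcD _ _)); apply: lerD => //.
by apply: (le_trans (le_normcD _ _)); apply: lerD.
Qed.

Lemma rGamma_cvg z : ccvg \oo (gauss_prod z) (rGamma z).
Proof.
have [C [N N0 H]] := gauss_ratio_bound z.
have [l cl _] := product_cvg N0 H.
have : climit \oo (gauss_prod z) = rGamma z by [].
by rewrite (ccvg_climit _ cl) => <-.
Qed.

Lemma rGamma_neq0 z : (forall k, z + k%:R != 0) -> rGamma z != 0.
Proof.
move=> zk; have [C [N N0 H]] := gauss_ratio_bound z.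
have [l cl] := product_cvg N0 H.
rewrite (ccvg_unique _ (rGamma_cvg z) cl); apply.
move=> n; rewrite /gauss_prod mulf_neq0 ?poch_neq0// invr_eq0.
by rewrite mulf_neq0 ?cexp_neq0// pnatr_eq0 -lt0n fact_gt0.
Qed.

Lemma rGamma_real_neq0 (x : R) : 0 < x -> rGamma x%:C != 0.
Proof. by move=> x0; apply: rGamma_neq0 => k; exact: rc_addn_neq0. Qed.

(** The Gauss products satisfy this equation up to the factor 1 + (z + 1) / n, which tends to 1. *)
Lemma rGammaS z : rGamma z = z * rGamma (z + 1).
Proof.
have ninv : (n%:R^-1 : R) @[n --> \oo] --> 0.
  by rewrite -(cvg_shiftn 1); under eq_fun do rewrite addn1; exact: cvg_harmonic.
have h1 : ccvg \oo (fun n => gauss_prod z n * (1 + (z + 1) * (n%:R^-1)%:C))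
    (rGamma z * (1 + (z + 1) * 0)).
  apply: ccvgM; first exact: rGamma_cvg.
  apply: ccvgD; first exact: ccvg_cst.
  by apply: ccvgM; [exact: ccvg_cst | exact: ccvg_rc].
rewrite mulr0 addr0 mulr1 in h1.
apply: (ccvg_unique _ h1).
apply: (@ccvg_near_eq _ _ _ _ (fun n => z * gauss_prod (z + 1) n)); last first.
  by apply: ccvgM; [exact: ccvg_cst | exact: rGamma_cvg].
near=> n.
have n0 : (0 < n)%N by near: n; exact: nbhs_infty_gt.
rewrite /gauss_prod mulrA -pochSl pochS mulrDl mul1r cexpD cexp_real.
rewrite lnK ?posrE ?ltr0n// rc_nat rcV rc_nat.
have f0 : (n`!%:R : R[i]) != 0 by rewrite pnatr_eq0 -lt0n fact_gt0.
have n10 : (n%:R : R[i]) != 0 by rewrite pnatr_eq0 -lt0n.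
have E0 := cexp_neq0 (z * (ln n%:R)%:C).
move: E0 f0 n10; move: (cexp _) (n`!%:R) => E f E0 f0 n10.
by rewrite -[n.+1%:R]natr1; field; rewrite E0 f0 n10.
Unshelve. all: by end_near. Qed.

End GaussProduct.

(** * The hypergeometric function *)

Section ComplexSeries.
Variable R : realType.
Implicit Types (A B : nat -> R[i]) (t r : R).

Definition psum A t (N : nat) : R[i] := \sum_(n < N) A n * (t ^+ n)%:C.

Definition csum A t : R[i] :=
  limn (pseries (fun n => Re (A n)) t) +i* limn (pseries (fun n => Im (A n)) t).

Definition cdiffs A (n : nat) : R[i] := n.+1%:R * A n.+1.

(** Equivalent to a radius of convergence of at least 1. *)
Definition subexp A : Prop :=
  forall r, 0 < r -> r < 1 -> exists K, forall n, normc (A n) * r ^+ n <= K.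

Definition summable_norm A : Prop := cvgn (series (fun n => normc (A n))).

Lemma Re_psum A t N : Re (psum A t N) = pseries (fun n => Re (A n)) t N.
Proof.
rewrite /psum Re_sum /pseries seriesEord/=; apply: eq_bigr => i _.
by rewrite mulrC ReZ mulrC.
Qed.

Lemma Im_psum A t N : Im (psum A t N) = pseries (fun n => Im (A n)) t N.
Proof.
rewrite /psum Im_sum /pseries seriesEord/=; apply: eq_bigr => i _.
by rewrite mulrC ImZ mulrC.
Qed.

Lemma psum_cvg A t : cvgn (pseries (fun n => Re (A n)) t) ->
  cvgn (pseries (fun n => Im (A n)) t) -> ccvg \oo (psum A t) (csum A t).
Proof.
by move=> h1 h2; split; [under eq_fun do rewrite Re_psum | under eq_fun do rewrite Im_psum].
Qed.

Let subexp_summable (f : nat -> R) A r : (forall n, `|f n| <= normc (A n)) ->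
  subexp A -> 0 < r -> r < 1 -> cvgn (pseries f r).
Proof.
move=> fA sA r0 r1.
pose q := (1 + r) / 2.
have q0 : 0 < q by rewrite /q; lra.
have q1 : q < 1 by rewrite /q; lra.
have rq : r < q by rewrite /q; lra.
have [K AK] := sA q q0 q1.
apply: normed_cvg; rewrite /normed_series_of/=.
apply: (@series_le_cvg _ _ (geometric K (r / q))).
- by move=> n /=.
- move=> n; rewrite /= mulr_ge0//; last by rewrite exprn_ge0// divr_ge0// ltW.
  by apply: le_trans (AK n); rewrite mulr_ge0 ?normc_ge0// exprn_ge0// ltW.
- move=> n /=; rewrite normrM normrX (gtr0_norm r0).
  rewrite expr_div_n mulrA ler_pdivlMr ?exprn_gt0// mulrAC.
  rewrite ler_wpM2r ?exprn_ge0 ?(ltW r0)// (le_trans _ (AK n))//.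
  by rewrite ler_wpM2r ?exprn_ge0 ?(ltW q0).
- apply: is_cvg_geometric_series.
  have rq0 : 0 < r / q by rewrite divr_gt0.
  by rewrite (gtr0_norm rq0) ltr_pdivrMr// mul1r.
Qed.

Lemma subexp_cvg A t : subexp A -> `|t| < 1 ->
  cvgn (pseries (fun n => Re (A n)) t) /\ cvgn (pseries (fun n => Im (A n)) t).
Proof.
move=> sA t1.
pose r := (1 + `|t|) / 2.
have nt := normr_ge0 t.
have r0 : 0 < r by rewrite /r; lra.
have r1 : r < 1 by rewrite /r; lra.
have tr : `|t| < `|r| by rewrite (gtr0_norm r0) /r; lra.
by split; apply: (is_cvg_pseries_inside _ tr);
  apply: (subexp_summable (A := A)) => // n; [exact: ler_normc_Re|exact: ler_normc_Im].
Qed.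

Lemma subexp_psum_cvg A t : subexp A -> `|t| < 1 -> ccvg \oo (psum A t) (csum A t).
Proof. by move=> sA /(subexp_cvg sA)[]; exact: psum_cvg. Qed.

Definition is_cder (f : R -> R[i]) t (l : R[i]) : Prop :=
  is_derive t 1 (fun x => Re (f x)) (Re l) /\ is_derive t 1 (fun x => Im (f x)) (Im l).

(** Termwise differentiation of the real and imaginary parts asks for convergence of the series and
    of its first two formal derivatives at a point beyond |t|; the midpoint of |t| and 1 is
    taken. *)
Lemma csum_is_cder A t : subexp A -> subexp (cdiffs A) -> subexp (cdiffs (cdiffs A)) ->
  `|t| < 1 -> is_cder (csum A) t (csum (cdiffs A) t).
Proof.
move=> s0 s1 s2 t1.
pose r := (1 + `|t|) / 2.
have nt := normr_ge0 t.
have r0 : 0 < r by rewrite /r; lra.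
have r1 : `|r| < 1 by rewrite (gtr0_norm r0) /r; lra.
have tr : `|t| < `|r| by rewrite (gtr0_norm r0) /r; lra.
have reE B : (fun n => Re (cdiffs B n)) = pseries_diffs (fun n => Re (B n)).
  by apply/funext => n; rewrite /cdiffs /pseries_diffs -rc_nat ReZ.
have imE B : (fun n => Im (cdiffs B n)) = pseries_diffs (fun n => Im (B n)).
  by apply/funext => n; rewrite /cdiffs /pseries_diffs -rc_nat ImZ.
split; rewrite /csum/= ?reE ?imE; apply: (pseries_snd_diffs (K := r)) => //.
- by case: (subexp_cvg s0 r1).
- by rewrite -reE; case: (subexp_cvg s1 r1).
- by rewrite -!reE; case: (subexp_cvg s2 r1).
- by case: (subexp_cvg s0 r1).
- by rewrite -imE; case: (subexp_cvg s1 r1).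
- by rewrite -!imE; case: (subexp_cvg s2 r1).
Qed.

(** Abel's theorem in the absolutely summable case: for all t in [0, 1] the tail is at most that of
    the series of |f n|, so the continuity of the partial sums carries over to the limit. *)
Let abel_real (f : nat -> R) : cvgn (series (fun n => `|f n|)) ->
  limn (pseries f t) @[t --> (1 : R)^'-] --> limn (pseries f 1).
Proof.
move=> cf; pose S := limn (series (fun n => `|f n|)).
have nds : nondecreasing_seq (series (fun n => `|f n|)).
  by apply/nondecreasing_seqP => n; rewrite seriesSr lerDl.
have cvt t : 0 <= t -> t <= 1 -> cvgn (pseries f t).
  move=> t0 t1; apply: normed_cvg; apply: series_le_cvg cf => n //=.
  by rewrite normrM ler_piMr// normrX ger0_norm// exprn_ile1.
have tail t N : 0 <= t -> t <= 1 ->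
    `|limn (pseries f t) - pseries f t N| <= S - series (fun n => `|f n|) N.
  move=> t0 t1.
  have c1 : `|pseries f t M - pseries f t N| @[M --> \oo] -->
      `|limn (pseries f t) - pseries f t N|.
    by apply: cvg_norm; apply: cvgB; [exact: cvt | exact: cvg_cst].
  rewrite -(cvg_lim _ c1)//; apply: limr_le.
    by apply/cvg_ex; eexists; exact: c1.
  near=> M.
  have NM : (N <= M)%N by near: M; exact: nbhs_infty_ge.
  rewrite /pseries sub_series_geq//.
  apply: (@le_trans _ _ (series (fun n => `|f n|) M - series (fun n => `|f n|) N)).
    rewrite sub_series_geq// (le_trans (ler_norm_sum _ _ _))//.
    by apply: ler_sum => n _; rewrite normrM ler_piMr// normrX ger0_norm// exprn_ile1.
  by rewrite lerD2r; exact: nondecreasing_cvgn_le.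
apply/cvgrPdist_lt => e e0.
have e3 : 0 < e / 3 by rewrite divr_gt0.
have [N _ HN] : \forall N \near \oo, S - series (fun n => `|f n|) N < e / 3.
  have /cvgrPdist_lt/(_ _ e3) := cf; apply: filterS => N; rewrite -/S.
  by apply: le_lt_trans; exact: ler_norm.
have {}HN := HN N (leqnn N).
have cP : continuous (fun t => pseries f t N).
  have -> : (fun t => pseries f t N) = (fun t => \sum_(i < N) f i * t ^+ i).
    by apply/funext => t; rewrite /pseries seriesEord.
  move=> x; elim: N {HN} => [|N ih].
    rewrite (_ : (fun t => _) = cst 0); first exact: cvg_cst.
    by apply/funext => t; rewrite big_ord0.
  rewrite (_ : (fun t => _) = (fun t => \sum_(i < N) f i * t ^+ i + f N * t ^+ N)); last first.
    by apply/funext => t; rewrite big_ord_recr.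
  by apply: cvgD => //; apply: cvgM; [exact: cvg_cst | exact: exprn_continuous].
have P1 : pseries f t N @[t --> (1:R)^'-] --> pseries f 1 N.
  exact: cvg_at_left_filter (cP 1).
near=> t.
have t0 : 0 <= t by apply/ltW; near: t; apply: nbhs_left_gt; exact: ltr01.
have t1 : t <= 1 by apply/ltW; near: t; exact: nbhs_left_lt.
have h1 := tail 1 N ler01 (lexx 1); have h2 := tail t N t0 t1.
have h3 : `|pseries f 1 N - pseries f t N| < e / 3 by near: t; move/cvgrPdist_lt: P1 => /(_ _ e3).
have -> : limn (pseries f 1) - limn (pseries f t) =
  (limn (pseries f 1) - pseries f 1 N) + (pseries f 1 N - pseries f t N)
  - (limn (pseries f t) - pseries f t N) by ring.
apply: (le_lt_trans (ler_normB _ _)).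
have := ler_normD (limn (pseries f 1) - pseries f 1 N) (pseries f 1 N - pseries f t N).
lra.
Unshelve. all: by end_near. Qed.

Let summable_parts A (f : nat -> R) : (forall n, `|f n| <= normc (A n)) ->
  summable_norm A -> cvgn (series (fun n => `|f n|)).
Proof.
by move=> fA; apply: series_le_cvg => // n; exact: normc_ge0.
Qed.

Lemma csum_abel A : summable_norm A -> ccvg (1 : R)^'- (csum A) (csum A 1).
Proof.
move=> sA; split; apply: abel_real; apply: summable_parts sA => n.
  exact: ler_normc_Re.
exact: ler_normc_Im.
Qed.

Lemma summable_psum_cvg A : summable_norm A -> ccvg \oo (psum A 1) (csum A 1).
Proof.
move=> sA; apply: psum_cvg; apply: normed_cvg; rewrite /normed_series_of/=.
  under [fun n => `|_|]eq_fun do rewrite expr1n mulr1.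
  by apply: summable_parts sA => n; exact: ler_normc_Re.
under [fun n => `|_|]eq_fun do rewrite expr1n mulr1.
by apply: summable_parts sA => n; exact: ler_normc_Im.
Qed.

Lemma csum_bounded A : summable_norm A -> exists K, forall t, 0 <= t -> t < 1 ->
  normc (csum A t) <= K.
Proof.
move=> sA; exists (limn (series (fun n => normc (A n)))) => t t0 t1.
have sub : subexp A.
  have [K [_ HK]] := cvg_series_bounded sA.
  move=> r r0 r1; exists (K + 1) => n.
  have := HK (K + 1) (ltac:(by rewrite ltrDl)) n I.
  rewrite /= ger0_norm ?normc_ge0// => h; apply: le_trans h.
  by rewrite ler_piMr ?normc_ge0// exprn_ile1// ltW.
have tn : `|t| < 1 by rewrite ger0_norm.
have := ccvg_normc _ (subexp_psum_cvg sub tn); move=> /(_ _) cv.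
rewrite -(cvg_lim _ cv)//; apply: limr_le.
  by apply/cvg_ex; eexists; exact: cv.
near=> N.
apply: (le_trans (normc_sum _ _ _)).
apply: (@le_trans _ _ (series (fun n => normc (A n)) N)).
  rewrite seriesEord/=; apply: ler_sum => i _.
  by rewrite normcM normc_rc normrX ler_piMr ?normc_ge0// exprn_ile1// ltW.
apply: nondecreasing_cvgn_le => //; apply/nondecreasing_seqP => n.
by rewrite seriesSr lerDl normc_ge0.
Unshelve. all: by end_near. Qed.

(** The operator t d/dt on partial sums, in the form in which the contiguous relations use it. *)
Lemma psum_index A t N :
  psum (fun n => n%:R * A n) t N.+1 = t%:C * psum (cdiffs A) t N.
Proof.
rewrite /psum big_ord_recl/= !mul0r add0r mulr_sumr; apply: eq_bigr => i _.
by rewrite /bump/= /cdiffs exprS rcM; ring.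
Qed.

End ComplexSeries.

(** * Growth of the hypergeometric coefficients *)

Section HypergeometricCoefficients.
Variables (R : realType) (a b : R[i]) (s : R).
Hypotheses (abs : a + b = s%:C) (s0 : 0 <= s).
Implicit Types (c t : R).

Definition hcoef c (n : nat) : R[i] :=
  poch a n * poch b n / (poch c%:C n * n`!%:R).

Lemma hcoef0 c : hcoef c 0 = 1.
Proof. by rewrite /hcoef !poch0 fact0 !mul1r invr1. Qed.

Lemma hcoefS c n : 0 < c ->
  hcoef c n.+1 = hcoef c n * ((a + n%:R) * (b + n%:R) / ((c%:C + n%:R) * n.+1%:R)).
Proof.
move=> c0; rewrite /hcoef !pochS factS natrM.
have h1 := rc_addn_neq0 n c0.
have h2 : poch (c%:C : R[i]) n != 0 by apply: poch_neq0 => k; exact: rc_addn_neq0.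
have h3 : (n`!%:R : R[i]) != 0 by rewrite pnatr_eq0 -lt0n fact_gt0.
have h4 : (n.+1%:R : R[i]) != 0 by rewrite pnatr_eq0.
move: h1 h2 h3 h4; move: (c%:C + _) (poch _ n) (n`!%:R) (n.+1%:R) => u v w x.
by move=> u0 v0 w0 x0; field; rewrite u0 v0 w0 x0.
Qed.

Lemma hcoef_shift c n : 0 < c ->
  hcoef (c + 1) n = hcoef c n * (c%:C / (c%:C + n%:R)).
Proof.
move=> c0; have c00 : (c%:C : R[i]) != 0 by rewrite rc_eq0 gt_eqF.
have h1 := rc_addn_neq0 n c0.
have h2 : poch (c%:C : R[i]) n != 0 by apply: poch_neq0 => k; exact: rc_addn_neq0.
have h5 : poch ((c + 1)%:C : R[i]) n != 0.
  by apply: poch_neq0 => k; apply: rc_addn_neq0; rewrite addr_gt0.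
have E : poch (c + 1)%:C n = poch c%:C n * (c%:C + n%:R) / c%:C.
  by apply: (mulfI c00); rewrite rcD -pochSl -pochS; field.
rewrite /hcoef E.
have h3 : (n`!%:R : R[i]) != 0 by rewrite pnatr_eq0 -lt0n fact_gt0.
by field; rewrite h1 h2 h3 c00.
Qed.

Let m : R := normc (a * b).

(** As a + b = s is real and nonnegative, (a + n) (b + n) = n^2 + s n + a b has modulus at most n^2
    + s n + |a b|. *)
Lemma normc_hcoefS c n : 0 < c ->
  normc (hcoef c n.+1) <=
  normc (hcoef c n) * ((n%:R ^+ 2 + s * n%:R + m) / ((c + n%:R) * n.+1%:R)).
Proof.
move=> c0; rewrite hcoefS// normcM ler_wpM2l ?normc_ge0// normcM normcV.
have cn : 0 < c + n%:R by rewrite (lt_le_trans c0)// lerDl.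
have -> : (c%:C + n%:R) * n.+1%:R = ((c + n%:R) * n.+1%:R)%:C :> R[i].
  by rewrite rcM rcD !rc_nat.
have cn1 : 0 < (c + n%:R) * n.+1%:R by rewrite mulr_gt0 ?ltr0n.
rewrite normc_rc (gtr0_norm cn1) ler_pM2r ?invr_gt0//.
have -> : (a + n%:R) * (b + n%:R) = (n%:R ^+ 2 + s * n%:R)%:C + a * b.
  by rewrite rcD [in (_ ^+ 2)%:C]rmorphXn/= rcM rc_nat -abs; ring.
rewrite (le_trans (le_normcD _ _))// lerD2r normc_rc ger0_norm//.
by rewrite addr_ge0 ?sqr_ge0// mulr_ge0.
Qed.

Let T c (n : nat) := n%:R * normc (hcoef c n).

(** The step of Raabe's test: the decrease of n |A_n| dominates a multiple of |A_n|, which for s < c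
    is eventually positive and bounded away from 0, so that sums of |A_n| telescope. *)
Let T_decr c n : 0 < c ->
  normc (hcoef c n) * ((n%:R * (c - s) - m) / (n%:R + c)) <= T c n - T c n.+1.
Proof.
move=> c0; rewrite /T lerBrDl -lerBrDr.
have cn : 0 < c + n%:R by rewrite (lt_le_trans c0)// lerDl.
have n1 : (0 : R) < n.+1%:R by rewrite ltr0n.
apply: (@le_trans _ _ (n.+1%:R * (normc (hcoef c n) *
    ((n%:R ^+ 2 + s * n%:R + m) / ((c + n%:R) * n.+1%:R))))).
  by rewrite ler_wpM2l// normc_hcoefS.
rewrite le_eqVlt; apply/orP; left; apply/eqP.
by field; rewrite addrC !gt_eqF// addrC.
Qed.

Lemma sum_decr c N e M : 0 < c -> 0 <= e ->
  (forall n, (N <= n)%N -> e * (n%:R + c) <= n%:R * (c - s) - m) -> (N <= M)%N ->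
  e * \sum_(N <= n < M) normc (hcoef c n) <= T c N - T c M.
Proof.
move=> c0 e0 H NM.
rewrite -[leRHS]opprB -telescope_sumr// mulr_sumr -sumrN.
rewrite !big_nat; apply: ler_sum => n /andP[Nn _].
rewrite opprB; apply: le_trans (T_decr n c0).
have cn : 0 < n%:R + c by rewrite (lt_le_trans c0)// lerDr.
by rewrite mulrC ler_wpM2l ?normc_ge0// ler_pdivlMr// H.
Qed.

Lemma hcoef_summable c : 0 < c -> s < c -> summable_norm (hcoef c).
Proof.
move=> c0 sc; rewrite /summable_norm.
pose d := c - s.
have d0 : 0 < d by rewrite subr_gt0.
have m0 : 0 <= m := normc_ge0 _.
(* The solution for n of d / 2 (n + c) <= n d - m. *)
pose N := Num.bound ((2 * m + c * d) / d).
have HN n : (N <= n)%N -> d / 2 * (n%:R + c) <= n%:R * (c - s) - m.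
  move=> Nn; rewrite -/d.
  have h0 : 0 <= (2 * m + c * d) / d by rewrite divr_ge0 ?(ltW d0)// addr_ge0// mulr_ge0// ltW.
  have : (2 * m + c * d) / d <= n%:R.
    apply/ltW/(lt_le_trans (archi_boundP h0)); by rewrite ler_nat.
  rewrite ler_pdivrMr//; lra.
apply: nondecreasing_is_cvgn.
  by apply/nondecreasing_seqP => n; rewrite seriesSr lerDl normc_ge0.
exists (series (fun n => normc (hcoef c n)) N + 2 / d * T c N) => _ [M _ <-].
have [NM|MN] := leqP N M.
  rewrite -lerBlDl sub_series_geq//.
  have h := sum_decr c0 (ltW (divr_gt0 d0 (ltr0n _ 2))) HN NM.
  have TM : 0 <= T c M by rewrite mulr_ge0// normc_ge0.
  have -> : 2 / d * T c N = T c N / (d / 2) by field; rewrite gt_eqF.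
  rewrite ler_pdivlMr ?divr_gt0// mulrC (le_trans h)//; lra.
apply: (@le_trans _ _ (series (fun n => normc (hcoef c n)) N)).
  have : nondecreasing_seq (series (fun n => normc (hcoef c n))).
    by apply/nondecreasing_seqP => n; rewrite seriesSr lerDl normc_ge0.
  by apply; exact: ltnW.
by rewrite lerDl mulr_ge0 ?divr_ge0 ?(ltW d0)// mulr_ge0// normc_ge0.
Qed.

(* n |A_n| is eventually nonincreasing, so a positive limit would make A_n
   dominate the harmonic series. *)
Lemma hcoef_index_cvg0 c : 0 < c -> s < c ->
  n%:R * normc (hcoef c n) @[n --> \oo] --> (0 : R).
Proof.
move=> c0 sc; have sm := hcoef_summable c0 sc.
pose d := c - s.
have d0 : 0 < d by rewrite subr_gt0.
have m0 : 0 <= m := normc_ge0 _.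
pose N := Num.bound (m / d).
have HN n : (N <= n)%N -> T c n.+1 <= T c n.
  move=> Nn; rewrite -subr_ge0; apply: le_trans (T_decr n c0).
  apply: mulr_ge0; first exact: normc_ge0.
  apply: divr_ge0; last by rewrite addr_ge0 ?(ltW c0).
  rewrite subr_ge0 -/d.
  have : m / d <= n%:R.
    apply/ltW/(lt_le_trans (archi_boundP (divr_ge0 m0 (ltW d0)))); by rewrite ler_nat.
  by rewrite ler_pdivrMr.
have T0 n : 0 <= T c n by rewrite mulr_ge0// normc_ge0.
have cT : cvgn (fun n => T c (n + N)%N).
  apply: nonincreasing_is_cvgn.
    by apply/nonincreasing_seqP => n; rewrite addSn; apply: HN; exact: leq_addl.
  by exists 0 => _ [n _ <-].
pose L := limn (fun n => T c (n + N)%N).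
have L0 : 0 <= L by apply: limr_ge => //; exact: nearW.
have LT n : L <= T c (n + N)%N.
  apply: (@nonincreasing_cvgn_ge _ (fun n => T c (n + N)%N)) => //.
  by apply/nonincreasing_seqP => k; rewrite addSn; apply: HN; exact: leq_addl.
have cL : (fun n => T c (n + N)%N) @ \oo --> L by exact: cT.
suff L00 : L = 0 by rewrite L00 in cL; rewrite -(cvg_shiftn N).
apply/eqP; rewrite eq_le L0 andbT leNgt; apply/negP => Lp.
apply: (@dvg_harmonic R).
have c1 : cvgn (series (fun n => normc (hcoef c (n + N).+1))).
  have /cvg_ex[l hl] := sm; apply/cvg_ex; exists (l - series (fun n => normc (hcoef c n)) N.+1).
  have : series (fun n => normc (hcoef c n)) (n + N.+1)%N
      - series (fun n => normc (hcoef c n)) N.+1 @[n --> \oo] -->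
      l - series (fun n => normc (hcoef c n)) N.+1.
    by apply: cvgB; [rewrite (cvg_shiftn N.+1) | exact: cvg_cst].
  apply: cvg_trans; apply: near_eq_cvg; apply: nearW => n.
  rewrite sub_series_geq ?leq_addl// -{1}[N.+1]add0n big_addn addnK seriesEnat/=.
  by apply: eq_bigr => i _; rewrite addnS.
have c2 : cvgn (series (fun n => N.+1%:R / L * normc (hcoef c (n + N).+1))).
  exact: (is_cvg_seriesZ (k := N.+1%:R / L) c1).
apply: series_le_cvg c2 => n; first exact: harmonic_ge0.
  by rewrite mulr_ge0 ?normc_ge0// divr_ge0.
rewrite /harmonic/=.
(* L <= (n + N + 1) |A_(n+N+1)| together with n + N + 1 <= (N + 1) (n + 1) bounds 1 / (n + 1) by (N
   + 1) / L |A_(n+N+1)|. *)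
have := LT n.+1; rewrite /T addSn => h.
have n1 : (0 : R) < n.+1%:R by rewrite ltr0n.
have N1 : (0 : R) < (n + N).+1%:R by rewrite ltr0n.
rewrite mulrAC ler_pdivlMr// mulrC ler_pdivrMr//.
apply: (le_trans h); rewrite [leRHS]mulrAC ler_wpM2r ?normc_ge0//.
by rewrite -natrM ler_nat mulSn mulnS; clearbody N; clear - n N; lia.
Qed.

End HypergeometricCoefficients.

(** * Contiguous relations and Gauss's summation *)

Section Hypergeometric.
Variable R : realType.
Implicit Types (a b k : R[i]) (s c t : R) (A B : nat -> R[i]).

Lemma psumZ k A t N : psum (fun n => k * A n) t N = k * psum A t N.
Proof. by rewrite /psum mulr_sumr; apply: eq_bigr => i _; rewrite mulrA. Qed.

Lemma psumD A B t N : psum (fun n => A n + B n) t N = psum A t N + psum B t N.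
Proof. by rewrite /psum -big_split/=; apply: eq_bigr => i _; rewrite mulrDl. Qed.

Lemma psumB A B t N : psum (fun n => A n - B n) t N = psum A t N - psum B t N.
Proof. by rewrite /psum -sumrB; apply: eq_bigr => i _; rewrite mulrBl. Qed.

Lemma subexpZ k A : subexp A -> subexp (fun n => k * A n).
Proof.
move=> sA r r0 r1; have [K HK] := sA r r0 r1; exists (normc k * K) => n.
by rewrite normcM -mulrA ler_wpM2l ?normc_ge0.
Qed.

Lemma cdiffsZ k A : cdiffs (fun n => k * A n) = (fun n => k * cdiffs A n).
Proof. by apply/funext => n; rewrite /cdiffs mulrCA. Qed.

Lemma ccvg_shift (u : nat -> R[i]) l : ccvg \oo u l -> ccvg \oo (fun n => u n.+1) l.
Proof.
move=> [h1 h2]; split.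
  by have := h1; rewrite -(cvg_shiftS (fun n => Re (u n))).
by have := h2; rewrite -(cvg_shiftS (fun n => Im (u n))).
Qed.

(** The bound for the ratio of consecutive coefficients tends to 1, so |A_n| r^n decreases as soon
    as n (1 - r) >= s + m; this fixes [N]. *)
Lemma hcoef_subexp a b s c : a + b = s%:C -> 0 <= s -> 0 < c -> subexp (hcoef a b c).
Proof.
move=> abs s0 c0 r r0 r1.
pose m : R := normc (a * b).
have m0 : 0 <= m := normc_ge0 _.
have r1' : 0 < 1 - r by rewrite subr_gt0.
pose N := (Num.bound ((s + m) / (1 - r))).+1.
pose u n := normc (hcoef a b c n) * r ^+ n.
have u0 n : 0 <= u n by rewrite mulr_ge0 ?normc_ge0// exprn_ge0// ltW.
have dec n : (N <= n)%N -> u n.+1 <= u n.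
  move=> Nn; rewrite /u exprS.
  have n1 : (1 : R) <= n%:R by rewrite ler1n (leq_trans _ Nn).
  have h0 : 0 <= (s + m) / (1 - r) by rewrite divr_ge0 ?(ltW r1')// addr_ge0.
  have : (s + m) / (1 - r) <= n%:R.
    apply/ltW/(lt_le_trans (archi_boundP h0)); rewrite ler_nat.
    exact: leq_trans Nn.
  rewrite ler_pdivrMr// => h.
  have cn : 0 < (c + n%:R) * n.+1%:R by rewrite mulr_gt0 ?ltr0n//; lra.
  apply: (@le_trans _ _ (normc (hcoef a b c n) *
      ((n%:R ^+ 2 + s * n%:R + m) / ((c + n%:R) * n.+1%:R)) * (r * r ^+ n))).
    rewrite ler_wpM2r ?mulr_ge0 ?exprn_ge0 ?(ltW r0)//.
    exact: (normc_hcoefS abs s0).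
  rewrite -mulrA ler_wpM2l ?normc_ge0// mulrA ler_piMl ?exprn_ge0 ?(ltW r0)//.
  rewrite mulrAC ler_pdivrMr// mul1r -natr1.
  have sn : 0 <= s * n%:R by rewrite mulr_ge0.
  have mn : m <= m * n%:R by rewrite ler_peMr.
  have hn := ler_wpM2r (ler0n R n) h.
  have rs : r * (s * n%:R) <= s * n%:R by rewrite ler_piMl// ltW.
  have rm : r * m <= m by rewrite ler_piMl// ltW.
  have cn0 : 0 <= c * n%:R by rewrite mulr_ge0// ltW.
  move: hn sn mn rs rm cn0 n1; rewrite expr2; move: (n%:R : R) => q; lra.
exists (\sum_(i < N.+1) u i) => n; rewrite -/(u n).
have small n' : (n' <= N)%N -> u n' <= \sum_(i < N.+1) u i.
  rewrite -ltnS => nN; rewrite (bigD1 (Ordinal nN))//= lerDl.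
  by apply: sumr_ge0 => i _.
have [nN|Nn] := leqP n N; first exact: small.
apply: le_trans (small N (leqnn N)).
elim: n Nn => // n ih; rewrite ltnS leq_eqVlt => /predU1P[<-|Nn]; first exact: dec.
by apply: le_trans (ih Nn); apply: dec; exact: ltnW.
Qed.

(** The derivative of F(a, b; c; .) is again hypergeometric, with parameters raised by 1; thus
    growth bounds for derivatives are instances of [hcoef_subexp] with s + 2. *)
Lemma cdiffs_hcoef a b c : 0 < c ->
  cdiffs (hcoef a b c) = (fun n => a * b / c%:C * hcoef (a + 1) (b + 1) (c + 1) n).
Proof.
move=> c0; apply/funext => n; rewrite /cdiffs /hcoef !pochSl rcD (_ : 1%:C = 1)// factS natrM.
have h1 : (c%:C : R[i]) != 0 by rewrite rc_eq0 gt_eqF.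
have h2 : poch (c%:C + 1 : R[i]) n != 0.
  apply: poch_neq0 => i; rewrite -rc_nat -rcD -rcD rc_eq0 gt_eqF//.
  by have := ler0n R i; lra.
have h3 : (n`!%:R : R[i]) != 0 by rewrite pnatr_eq0 -lt0n fact_gt0.
have h4 : (n.+1%:R : R[i]) != 0 by rewrite pnatr_eq0.
move: (n.+1%:R : R[i]) h4 => q h4.
by field; rewrite h1 h2 h3 h4.
Qed.

Lemma hcoef_subexp1 a b s c : a + b = s%:C -> 0 <= s -> 0 < c ->
  subexp (cdiffs (hcoef a b c)).
Proof.
move=> abs s0 c0; rewrite cdiffs_hcoef//; apply: subexpZ.
apply: (@hcoef_subexp _ _ (s + 2)); [|lra|lra].
by rewrite addrACA abs rcD rc_nat; ring.
Qed.

Lemma hcoef_subexp2 a b s c : a + b = s%:C -> 0 <= s -> 0 < c ->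
  subexp (cdiffs (cdiffs (hcoef a b c))).
Proof.
move=> abs s0 c0; rewrite cdiffs_hcoef// cdiffsZ; apply: subexpZ.
apply: (@hcoef_subexp1 _ _ (s + 2)); [|lra|lra].
by rewrite addrACA abs rcD rc_nat; ring.
Qed.

Definition hyp a b c t : R[i] := csum (hcoef a b c) t.
Definition hyp' a b c t : R[i] := csum (cdiffs (hcoef a b c)) t.

Section Fixed.
Variables (a b : R[i]) (s c : R).
Hypotheses (abs : a + b = s%:C) (s0 : 0 <= s) (c0 : 0 < c).

Lemma hyp_is_cder t : `|t| < 1 -> is_cder (hyp a b c) t (hyp' a b c t).
Proof.
apply: csum_is_cder; [exact: (hcoef_subexp abs)|exact: (hcoef_subexp1 abs)|].
exact: (hcoef_subexp2 abs).
Qed.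

Lemma hyp_at0 : hyp a b c 0 = 1.
Proof.
apply: (@ccvg_unique _ _ \oo _ (psum (hcoef a b c) 0)).
  by apply: subexp_psum_cvg; [exact: (hcoef_subexp abs)|rewrite normr0].
apply: (@ccvg_near_eq _ _ _ _ (fun=> 1)); last exact: ccvg_cst.
near=> N.
have N0 : (0 < N)%N by near: N; exact: nbhs_infty_gt.
rewrite /psum -(prednK N0) big_ord_recl/= hcoef0 expr0 mul1r big1 ?addr0// => i _.
by rewrite expr0n/= mulr0.
Unshelve. all: by end_near. Qed.

Let c1 : 0 < c + 1. Proof. by rewrite addr_gt0. Qed.

Let kappa : R[i] := (c%:C - a) * (c%:C - b) / c%:C.

Let raise_coef (n : nat) :
  (c - s)%:C * hcoef a b c n + cdiffs (hcoef a b c) n - n%:R * hcoef a b c n =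
  kappa * hcoef a b (c + 1) n.
Proof.
rewrite hcoef_shift// /cdiffs hcoefS// rcD rcN -abs /kappa.
have h1 : (c%:C : R[i]) != 0 by rewrite rc_eq0 gt_eqF.
have h2 := rc_addn_neq0 n c0.
have h4 : (n.+1%:R : R[i]) != 0 by rewrite pnatr_eq0.
move: (n.+1%:R : R[i]) h4 => q h4.
by field; rewrite h1 h2 h4.
Qed.

(** A contiguous relation, read off coefficient by coefficient. Its right side converges at t = 1
    already for s < c + 1, where F itself may be unbounded. *)
Lemma hyp_raise t : `|t| < 1 ->
  (c - s)%:C * hyp a b c t + (1 - t%:C) * hyp' a b c t = kappa * hyp a b (c + 1) t.
Proof.
move=> t1.
have hA := subexp_psum_cvg (hcoef_subexp abs s0 c0) t1.
have hD := subexp_psum_cvg (hcoef_subexp1 abs s0 c0) t1.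
have hB := subexp_psum_cvg (hcoef_subexp abs s0 c1) t1.
apply: (@ccvg_unique _ _ \oo _ (fun N => kappa * psum (hcoef a b (c + 1)) t N.+1)); last first.
  by apply: ccvgM; [exact: ccvg_cst|exact: ccvg_shift].
have -> : (fun N => kappa * psum (hcoef a b (c + 1)) t N.+1) = (fun N =>
   (c - s)%:C * psum (hcoef a b c) t N.+1 + (psum (cdiffs (hcoef a b c)) t N.+1
   - t%:C * psum (cdiffs (hcoef a b c)) t N)).
  apply/funext => N; rewrite -psum_index -!psumZ -psumB -psumD.
  by apply: eq_bigr => n _; rewrite -raise_coef addrA.
apply: ccvgD; first by apply: ccvgM; [exact: ccvg_cst|exact: ccvg_shift].
rewrite mulrBl mul1r; apply: ccvgB; first exact: ccvg_shift.
by apply: ccvgM => //; exact: ccvg_cst.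
Qed.

(** Together with [hyp_raise] a first-order system for F(c) and F(c + 1), which replaces the
    hypergeometric equation of second order. *)
Lemma hyp_lower t : `|t| < 1 ->
  t%:C * hyp' a b (c + 1) t = c%:C * (hyp a b c t - hyp a b (c + 1) t).
Proof.
move=> t1.
have hA := subexp_psum_cvg (hcoef_subexp abs s0 c0) t1.
have hD := subexp_psum_cvg (hcoef_subexp1 abs s0 c1) t1.
have hB := subexp_psum_cvg (hcoef_subexp abs s0 c1) t1.
apply: (@ccvg_unique _ _ \oo _ (fun N => t%:C * psum (cdiffs (hcoef a b (c + 1))) t N)).
  by apply: ccvgM => //; exact: ccvg_cst.
have -> : (fun N => t%:C * psum (cdiffs (hcoef a b (c + 1))) t N) =
   (fun N => c%:C * (psum (hcoef a b c) t N.+1 - psum (hcoef a b (c + 1)) t N.+1)).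
  apply/funext => N; rewrite -psum_index -psumB -psumZ.
  apply: eq_bigr => n _; rewrite hcoef_shift//; congr (_ * _).
  by field; exact: rc_addn_neq0.
apply: ccvgM; first exact: ccvg_cst.
by apply: ccvgB; exact: ccvg_shift.
Qed.

Section Summable.
Hypothesis sc : s < c.

Lemma hyp_abel : ccvg (1 : R)^'- (hyp a b c) (hyp a b c 1).
Proof. by apply: csum_abel; exact: (hcoef_summable abs). Qed.

Lemma hyp_bounded : exists K, forall t, 0 <= t -> t < 1 -> normc (hyp a b c t) <= K.
Proof. by apply: csum_bounded; exact: (hcoef_summable abs). Qed.

(** At t = 1 summation of the coefficient identity leaves the boundary term N A_N, which tends to 0
    by [hcoef_index_cvg0]. *)
Lemma hyp_raise1 : (c - s)%:C * hyp a b c 1 = kappa * hyp a b (c + 1) 1.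
Proof.
have sc1 : s < c + 1 by apply: (lt_trans sc); rewrite ltrDl.
have hA := summable_psum_cvg (hcoef_summable abs s0 c0 sc).
have hB := summable_psum_cvg (hcoef_summable abs s0 c1 sc1).
apply: (@ccvg_unique _ _ \oo _ (fun N => kappa * psum (hcoef a b (c + 1)) 1 N)); last first.
  by apply: ccvgM => //; exact: ccvg_cst.
have -> : (fun N => kappa * psum (hcoef a b (c + 1)) 1 N) = (fun N =>
   (c - s)%:C * psum (hcoef a b c) 1 N + N%:R * hcoef a b c N).
  apply/funext => N; elim: N => [|N ih]; first by rewrite /psum !big_ord0 mul0r !mulr0 addr0.
  rewrite /psum !big_ord_recr/= -!/(psum _ _ _) mulrDr ih expr1n !mulr1 -raise_coef /cdiffs; ring.
rewrite -[X in ccvg _ _ X]addr0; apply: ccvgD.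
  by apply: ccvgM => //; exact: ccvg_cst.
apply/ccvg_norm; under eq_fun do rewrite subr0 normcM normc_nat.
exact: (hcoef_index_cvg0 abs).
Qed.

End Summable.
End Fixed.

(** Raabe's estimate with factor 1/4, telescoped from index 1, bounds the sum of |A_n| over n >= 1
    by 4 |A_1| = 4 |a b| / c. *)
Lemma hyp_large_c a b s : a + b = s%:C -> 0 <= s -> exists c1, forall c, c1 <= c ->
  normc (hyp a b c 1 - 1) <= 4 * normc (a * b) / c.
Proof.
move=> abs s0; pose m : R := normc (a * b).
have m0 : 0 <= m := normc_ge0 _.
exists (4 * s + 4 * m + 1) => c cb.
have c0 : 0 < c by apply: lt_le_trans cb; rewrite ltr_wpDl// addr_ge0// mulr_ge0.
have sc : s < c by lra.
have hA := summable_psum_cvg (hcoef_summable abs s0 c0 sc).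
have := ccvg_normc _ (ccvgB _ hA (ccvg_cst _ 1)); move=> /(_ _ _ _) cv.
rewrite -(cvg_lim _ cv)//; apply: limr_le; first by apply/cvg_ex; eexists; exact: cv.
near=> N.
have N0 : (0 < N)%N by near: N; exact: nbhs_infty_gt.
rewrite /psum -(prednK N0) big_ord_recl/= hcoef0 mul1r expr0 addrAC subrr add0r.
rewrite (le_trans (normc_sum _ _ _))//.
apply: (@le_trans _ _ (\sum_(1 <= n < N) normc (hcoef a b c n))).
  rewrite -(prednK N0) big_add1/= big_mkord le_eqVlt; apply/orP; left; apply/eqP.
  by apply: eq_bigr => i _; rewrite expr1n mulr1.
have H n : (1 <= n)%N -> 4^-1 * (n%:R + c) <= n%:R * (c - s) - normc (a * b).
  move=> n1; rewrite -/m.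
  have n1' : (1 : R) <= n%:R by rewrite ler1n.
  nra.
have := sum_decr abs s0 c0 (ltac:(lra) : 0 <= 4^-1 :> R) H N0.
have -> : 1%:R * normc (hcoef a b c 1) = m / c.
  rewrite mul1r hcoefS// hcoef0 mul1r !addr0 mulr1 normcM normcV normc_rc gtr0_norm//.
have : 0 <= N%:R * normc (hcoef a b c N) by rewrite mulr_ge0// normc_ge0.
rewrite -mulrA; set X := \sum_(_ <= _ < _) _; set Y := m / c; lra.
Unshelve. all: by end_near. Qed.

(* Iterate the contiguous relation from c to c + n at t = 1 and let n tend to
   infinity: F(a, b; c + n; 1) tends to 1. *)
Theorem gauss_summation a b s c : a + b = s%:C -> 0 <= s -> 0 < c -> s < c ->
  hyp a b c 1 = rGamma (c%:C - a) * rGamma (c%:C - b) / (rGamma c%:C * rGamma (c - s)%:C).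
Proof.
move=> abs s0 c0 sc.
have cs0 : 0 < c - s by rewrite subr_gt0.
have iter n : hyp a b c 1 =
    poch (c%:C - a) n * poch (c%:C - b) n / (poch c%:C n * poch (c - s)%:C n) *
    hyp a b (c + n%:R) 1.
  elim: n => [|n ih]; first by rewrite !poch0 addr0 !mulr1 invr1 !mul1r.
  have cn : 0 < c + n%:R by rewrite (lt_le_trans c0)// lerDl.
  have scn : s < c + n%:R by rewrite (lt_le_trans sc)// lerDl.
  rewrite ih !pochS -[n.+1%:R]natr1 addrA.
  have := hyp_raise1 abs s0 cn scn.
  have h1 : (c%:C + n%:R : R[i]) != 0 := rc_addn_neq0 n c0.
  have h2 : ((c - s)%:C + n%:R : R[i]) != 0 := rc_addn_neq0 n cs0.
  have -> : (c + n%:R - s)%:C = (c - s)%:C + n%:R :> R[i].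
    by rewrite -[n%:R in RHS]rc_nat -rcD; congr (_%:C); ring.
  have -> : (c + n%:R)%:C = c%:C + n%:R :> R[i] by rewrite rcD rc_nat.
  move=> E.
  have -> : hyp a b (c + n%:R) 1 = (c%:C + n%:R - a) * (c%:C + n%:R - b) /
      (c%:C + n%:R) * hyp a b (c + n%:R + 1) 1 / ((c - s)%:C + n%:R).
    by rewrite -E mulrC mulKf.
  have p1 : poch (c%:C : R[i]) n != 0 by apply: poch_neq0 => i; exact: rc_addn_neq0.
  have p2 : poch ((c - s)%:C : R[i]) n != 0 by apply: poch_neq0 => i; exact: rc_addn_neq0.
  rewrite ![c%:C - _ + n%:R]addrAC; clear E; move: h1 h2 p1 p2.
  move: (c%:C + n%:R : R[i]) ((c - s)%:C + n%:R : R[i]) => w x.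
  move: (poch c%:C n) (poch (c - s)%:C n) => y v w0 x0 y0 v0.
  by field; rewrite w0 x0 y0 v0.
have lim1 : ccvg \oo (fun n => hyp a b (c + n%:R) 1) 1.
  have [K HK] := hyp_large_c abs s0.
  apply: (@ccvg_squeeze _ _ _ _ _ _ (fun n => 4 * normc (a * b) / (c + n%:R))).
    exists (Num.bound `|K - c|) => // n /= Kn; apply: HK.
    rewrite -lerBlDl; apply: (le_trans (ler_norm _)); apply/ltW.
    by apply: (lt_le_trans (archi_boundP (normr_ge0 _))); rewrite ler_nat.
  rewrite -[X in _ --> X](mulr0 (4 * normc (a * b))); apply: cvgM; first exact: cvg_cst.
  have n0 : (n%:R^-1 : R) @[n --> \oo] --> (0 : R).
    by rewrite -(cvg_shiftn 1); under eq_fun do rewrite addn1; exact: cvg_harmonic.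
  apply: (@squeeze_cvgr _ _ _ _ (fun=> 0) (fun n => n%:R^-1)) => //; last exact: cvg_cst.
  near=> n; have n1 : (0 < n)%N by near: n; exact: nbhs_infty_gt.
  have cn : 0 < c + n%:R by rewrite ltr_pwDl.
  by rewrite invr_ge0 (ltW cn) lef_pV2 ?posrE ?ltr0n// lerDr ltW.
have lim2 : ccvg \oo (fun n => gauss_prod (c%:C - a) n * gauss_prod (c%:C - b) n /
    (gauss_prod c%:C n * gauss_prod (c - s)%:C n))
    (rGamma (c%:C - a) * rGamma (c%:C - b) / (rGamma c%:C * rGamma (c - s)%:C)).
  apply: ccvgM; first by apply: ccvgM; exact: rGamma_cvg.
  apply: ccvgV; first by rewrite mulf_neq0// rGamma_real_neq0.
  by apply: ccvgM; exact: rGamma_cvg.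
apply: (@ccvg_unique _ _ \oo _ (fun=> hyp a b c 1)); first exact: ccvg_cst.
(* [gauss_prod] at index n contains n + 1 factors, so the iterated relation is used at n + 1. *)
have := ccvg_shift lim1.
move=> /(ccvgM _ lim2); rewrite mulr1; apply: ccvg_near_eq; apply: nearW => n.
rewrite (iter n.+1); congr (_ * _); rewrite /gauss_prod.
have f0 : (n`!%:R : R[i]) != 0 by rewrite pnatr_eq0 -lt0n fact_gt0.
(* The exponents on both sides add up to 2 c - s, so the powers of n cancel in the quotient of Gauss
   products and only Pochhammer symbols remain. *)
have E : cexp ((c%:C - a) * (ln n%:R)%:C) * cexp ((c%:C - b) * (ln n%:R)%:C) =
   cexp (c%:C * (ln n%:R)%:C) * cexp ((c - s)%:C * (ln n%:R)%:C).
  by rewrite -!cexpD rcD rcN -abs; congr cexp; ring.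
have p1 : poch (c%:C : R[i]) n.+1 != 0 by apply: poch_neq0 => i; exact: rc_addn_neq0.
have p2 : poch ((c - s)%:C : R[i]) n.+1 != 0 by apply: poch_neq0 => i; exact: rc_addn_neq0.
move: E (cexp_neq0 ((c%:C - a) * (ln n%:R)%:C)) (cexp_neq0 ((c%:C - b) * (ln n%:R)%:C))
  (cexp_neq0 (c%:C * (ln n%:R)%:C)) (cexp_neq0 ((c - s)%:C * (ln n%:R)%:C)).
move: (cexp ((c%:C - a) * _)) (cexp ((c%:C - b) * _)) (cexp (c%:C * _)) (cexp ((c - s)%:C * _)).
move=> e1 e2 e3 e4 E h1 h2 h3 h4.
have -> : forall p q v w : R[i], p / (n`!%:R * e1) * (q / (n`!%:R * e2)) /
    (v / (n`!%:R * e3) * (w / (n`!%:R * e4))) = p * q / (v * w) * (e3 * e4 / (e1 * e2)).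
  move=> p q v w; rewrite !invfM !invrK; move: (n`!%:R) f0 => f f0.
  move: v^-1 w^-1 => v' w'; by field; rewrite f0 h1 h2.
by rewrite E divff ?mulr1// mulf_neq0.
Unshelve. all: by end_near. Qed.

End Hypergeometric.

(** * Solutions of the Jacobi equation *)

Section ComplexDerivative.
Variable R : realType.
Implicit Types (f g : R -> R[i]) (x t : R) (l m k : R[i]).

Lemma is_cder_cst k x : is_cder (fun=> k) x 0.
Proof. by split => /=; exact: is_derive_cst. Qed.

Lemma is_cderD f g x l m : is_cder f x l -> is_cder g x m ->
  is_cder (fun t => f t + g t) x (l + m).
Proof.
move=> [a b] [c d]; split; rewrite ?ReD ?ImD.
  by under eq_fun do rewrite ReD; exact: is_deriveD.
by under eq_fun do rewrite ImD; exact: is_deriveD.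
Qed.

Lemma is_cderN f x l : is_cder f x l -> is_cder (fun t => - f t) x (- l).
Proof.
move=> [a b]; split; rewrite ?ReN ?ImN.
  by under eq_fun do rewrite ReN; exact: is_deriveN.
by under eq_fun do rewrite ImN; exact: is_deriveN.
Qed.

Lemma is_cderB f g x l m : is_cder f x l -> is_cder g x m ->
  is_cder (fun t => f t - g t) x (l - m).
Proof. by move=> fl gm; apply: is_cderD => //; exact: is_cderN. Qed.

Lemma is_cderM f g x l m : is_cder f x l -> is_cder g x m ->
  is_cder (fun t => f t * g t) x (f x * m + l * g x).
Proof.
move=> [a b] [c d]; split.
  under eq_fun do rewrite ReM; rewrite ReD !ReM.
  have h1 := is_deriveM a c; have h2 := is_deriveM b d.
  apply: (is_derive_eq (is_deriveB h1 h2)).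
  by rewrite /GRing.scale/=; ring.
under eq_fun do rewrite ImM; rewrite ImD !ImM.
have h1 := is_deriveM a d; have h2 := is_deriveM b c.
apply: (is_derive_eq (is_deriveD h1 h2)).
by rewrite /GRing.scale/=; ring.
Qed.

Lemma is_cderZ k f x l : is_cder f x l -> is_cder (fun t => k * f t) x (k * l).
Proof.
move=> fl; have := is_cderM (is_cder_cst k x) fl.
by rewrite mul0r addr0.
Qed.

Lemma is_cder_rc (h : R -> R) x (d : R) : is_derive x 1 h d ->
  is_cder (fun t => (h t)%:C) x d%:C.
Proof. by move=> hd; split => //=; exact: is_derive_cst. Qed.

Lemma is_cder_comp f (h : R -> R) x l (d : R) : is_cder f (h x) l ->
  is_derive x 1 h d -> is_cder (fun t => f (h t)) x (d%:C * l).
Proof.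
move=> [a b] hd; split; rewrite ?ReZ ?ImZ mulrC.
  exact: (@is_derive1_comp _ (fun y => Re (f y)) h).
exact: (@is_derive1_comp _ (fun y => Im (f y)) h).
Qed.

Lemma is_cder_near f g x l : (\forall t \near x, f t = g t) ->
  is_cder f x l -> is_cder g x l.
Proof.
move=> fg [a b]; split.
  by apply: near_eq_is_derive a; apply: filterS fg => t ->.
by apply: near_eq_is_derive b; apply: filterS fg => t ->.
Qed.

Lemma is_cder_eq f x l m : is_cder f x l -> l = m -> is_cder f x m.
Proof. by move=> h <-. Qed.

Lemma is_cder_cderivable f x l : is_cder f x l -> cderivable f x /\ cderive f x = l.
Proof.
move=> [a b]; split.
  by split; [case: a|case: b].
apply: complexP => /=; rewrite derive1E; [by case: a|by case: b].
Qed.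

Lemma cderivable_is_cder f x : cderivable f x -> is_cder f x (cderive f x).
Proof.
by move=> [a b]; split; exact: derive1_is_derive.
Qed.

Lemma is_cder_ccvg f x l : is_cder f x l -> ccvg (nbhs x) f (f x).
Proof.
by move=> [a b]; split; apply: differentiable_continuous; apply/derivable1_diffP;
  [case: a|case: b].
Qed.

Lemma is_derive0_itv (h : R -> R) (a b : R) :
  (forall x, x \in `]a, b[ -> is_derive x 1 h 0) ->
  forall x y, x \in `]a, b[ -> y \in `]a, b[ -> h x = h y.
Proof.
move=> hd x y; wlog xy : x y / x <= y.
  move=> H xab yab; have [xy|/ltW yx] := leP x y; first exact: H.
  by symmetry; exact: H.
rewrite !in_itv/= => /andP[ax xb] /andP[ay yb].
have hin z : x <= z -> z <= y -> z \in `]a, b[.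
  by move=> xz zy; rewrite in_itv/= (lt_le_trans ax)// (le_lt_trans zy).
have hd' z : z \in `]x, y[ -> is_derive z 1 h ((fun=> 0) z).
  by rewrite in_itv/= => /andP[xz zy]; apply: hd; apply: hin; exact: ltW.
have hc : {within `[x, y], continuous h}.
  apply: continuous_in_subspaceT => z; rewrite inE/= in_itv/= => /andP[xz zy].
  by apply: differentiable_continuous; apply/derivable1_diffP; case: (hd z (hin z xz zy)).
have [c _] := MVT_segment xy hd' hc.
by rewrite mul0r => /eqP; rewrite subr_eq0 => /eqP ->.
Qed.

Lemma is_cder0_itv f (a b : R) : (forall x, x \in `]a, b[ -> is_cder f x 0) ->
  forall x y, x \in `]a, b[ -> y \in `]a, b[ -> f x = f y.
Proof.
move=> hd x y xab yab; apply: complexP.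
  by apply: (is_derive0_itv (h := fun t => Re (f t)) _ xab yab) => z /hd[].
by apply: (is_derive0_itv (h := fun t => Im (f t)) _ xab yab) => z /hd[].
Qed.

Lemma near_J (x : R) : x \in `]-1, 1[ -> \forall y \near x, y \in `]-1, 1[.
Proof.
rewrite in_itv/= => /andP[x1 x2]; near=> y; rewrite in_itv/=; apply/andP; split.
  by near: y; exact: lt_nbhsr.
by near: y; exact: lt_nbhsl.
Unshelve. all: by end_near. Qed.

End ComplexDerivative.

(** * Classical solutions and their Wronskian *)

Section Solutions.
Variable R : realType.
Implicit Types (al be x : R) (la : R[i]) (f g : R -> R[i]).

Let powRS (x e : R) : 0 < x -> x `^ (e + 1) = x `^ e * x.
Proof. by move=> x0; rewrite powRD ?powRr1 ?ltW// (gt_eqF x0) implybT. Qed.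

(** The equation as a system for f and p f1, where f1 is an explicit derivative; the exponents are
    arguments, because reflection and conjugation change them. *)
Definition sol al be la f (f1 : R -> R[i]) : Prop := forall x, x \in `]-1, 1[ ->
  is_cder f x (f1 x) /\
  is_cder (fun y => (p al be y)%:C * f1 y) x (- (la * (weight al be x)%:C * f x)).

Lemma p_gt0 al be x : x \in `]-1, 1[ -> 0 < p al be x.
Proof.
by rewrite in_itv/= => /andP[h1 h2]; rewrite /p mulr_gt0 ?powR_gt0 ?subr_gt0// -ltrBlDl sub0r.
Qed.

Lemma weight_gt0 al be x : x \in `]-1, 1[ -> 0 < weight al be x.
Proof.
by rewrite in_itv/= => /andP[h1 h2]; rewrite /weight mulr_gt0 ?powR_gt0 ?subr_gt0// -ltrBlDl sub0r.
Qed.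

Lemma is_derive_powR1B e x : x < 1 ->
  is_derive x 1 (fun y => (1 - y) `^ e) (- (e * (1 - x) `^ (e - 1))).
Proof.
move=> x1; have h0 : 0 < 1 - x by rewrite subr_gt0.
have h1 : is_derive x 1 (fun y : R => 1 - y) (- 1).
  by have := is_deriveB (is_derive_cst (1 : R) x 1) (is_derive_id x (1 : R)); rewrite sub0r.
have h2 := is_derive1_powR e h0.
by have := @is_derive1_comp R (@powR R ^~ e) (fun y => 1 - y) x _ _ h2 h1; rewrite mulrN1.
Qed.

Lemma is_derive_powR1D e x : -1 < x ->
  is_derive x 1 (fun y => (1 + y) `^ e) (e * (1 + x) `^ (e - 1)).
Proof.
move=> x1; have h0 : 0 < 1 + x by rewrite -ltrBlDl sub0r.
have h1 : is_derive x 1 (fun y : R => 1 + y) 1.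
  by have := is_deriveD (is_derive_cst (1 : R) x 1) (is_derive_id x (1 : R)); rewrite add0r.
have h2 := is_derive1_powR e h0.
by have := @is_derive1_comp R (@powR R ^~ e) (fun y => 1 + y) x _ _ h2 h1; rewrite mulr1.
Qed.

Lemma sol_lin al be la f f1 g g1 (k m : R[i]) :
  sol al be la f f1 -> sol al be la g g1 ->
  sol al be la (fun x => k * f x + m * g x) (fun x => k * f1 x + m * g1 x).
Proof.
move=> sf sg x xJ; have [a b] := sf x xJ; have [c d] := sg x xJ; split.
  by apply: is_cderD; exact: is_cderZ.
have -> : (fun y => (p al be y)%:C * (k * f1 y + m * g1 y)) =
    (fun y => k * ((p al be y)%:C * f1 y) + m * ((p al be y)%:C * g1 y)).
  by apply/funext => y; ring.
apply: (is_cder_eq (is_cderD (is_cderZ k b) (is_cderZ m d))); ring.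
Qed.

Definition wronsk al be f (f1 : R -> R[i]) g (g1 : R -> R[i]) x : R[i] := (p al be x)%:C * (f x * g1 x - g x * f1 x).

Lemma wronsk_const al be la f f1 g g1 : sol al be la f f1 -> sol al be la g g1 ->
  exists w, forall x, x \in `]-1, 1[ -> wronsk al be f f1 g g1 x = w.
Proof.
move=> sf sg; exists (wronsk al be f f1 g g1 0) => x xJ.
have zJ : (0 : R) \in `]-1, 1[ by rewrite in_itv/= ltrN10 ltr01.
apply: (is_cder0_itv _ xJ zJ) => {xJ}x xJ.
have [a b] := sf x xJ; have [c d] := sg x xJ.
have -> : wronsk al be f f1 g g1 =
    (fun y => f y * ((p al be y)%:C * g1 y) - g y * ((p al be y)%:C * f1 y)).
  by apply/funext => y; rewrite /wronsk; ring.
apply: (is_cder_eq (is_cderB (is_cderM a d) (is_cderM c b))); ring.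
Qed.

(** Cramer's rule: W(u, v) f = W(f, v) u - W(f, u) v, and the three Wronskians are constant. No
    uniqueness theorem for initial values is involved. *)
Lemma wronsk_span al be la f f1 u u1 v v1 :
  sol al be la f f1 -> sol al be la u u1 -> sol al be la v v1 ->
  (exists2 x, x \in `]-1, 1[ & wronsk al be u u1 v v1 x != 0) ->
  exists k m, forall x, x \in `]-1, 1[ ->
    f x = k * u x + m * v x /\ f1 x = k * u1 x + m * v1 x.
Proof.
move=> sf su sv [x0 x0J].
have [w hw] := wronsk_const su sv; have [A hA] := wronsk_const sf su.
have [B hB] := wronsk_const sf sv; rewrite hw// => w0.
exists (B / w), (- A / w) => x xJ.
have Ew := hw x xJ; have EA := hA x xJ; have EB := hB x xJ.
have e1 : f x * w = B * u x - A * v x by rewrite -Ew -EA -EB /wronsk; ring.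
have e2 : f1 x * w = B * u1 x - A * v1 x by rewrite -Ew -EA -EB /wronsk; ring.
by split; apply: (mulIf w0); rewrite ?e1 ?e2; field.
Qed.

(** Reduces every statement at -1 to one at 1 with the exponents exchanged. *)
Lemma sol_reflect al be la f f1 : sol al be la f f1 ->
  sol be al la (fun x => f (- x)) (fun x => - f1 (- x)).
Proof.
move=> sf x xJ.
have nxJ : - x \in `]-1, 1[ by move: xJ; rewrite !in_itv/= ltrN2 ltrNl andbC.
have [a b] := sf _ nxJ.
have nd : is_derive x 1 (-%R : R -> R) (-1) by exact: is_deriveNid.
split.
  by apply: (is_cder_eq (is_cder_comp a nd)); rewrite rcN mulN1r.
have -> : (fun y => (p be al y)%:C * - f1 (- y)) =
    (fun y => - ((p al be (- y))%:C * f1 (- y))).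
  by apply/funext => y; rewrite /p opprK mulrN [in RHS]mulrC [in LHS]mulrC; congr (- (_ * _%:C)); rewrite mulrC.
apply: (is_cder_eq (is_cderN (is_cder_comp b nd))).
rewrite rcN /weight opprK [(1 + x) `^ al * _]mulrC; ring.
Qed.

(** The factor (1 - x)^(-al) exchanges the exponents 0 and -al at 1. It produces the singular
    solution there and, after reflection, the factor in Euler's transformation. *)
Lemma sol_mul_powR al be la g g1 : sol (- al) be la g g1 ->
  sol al be (la - (al * (be + 1))%:C)
    (fun x => ((1 - x) `^ (- al))%:C * g x)
    (fun x => (al * (1 - x) `^ (- al - 1))%:C * g x + ((1 - x) `^ (- al))%:C * g1 x).
Proof.
move=> sg x xJ; have [a b] := sg x xJ.
move: (xJ); rewrite in_itv/= => /andP[x1 x2].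
have X0 : 0 < 1 - x by rewrite subr_gt0.
have Y0 : 0 < 1 + x by rewrite -ltrBlDl sub0r.
have dX e := is_cder_rc (is_derive_powR1B e x2).
have dY e := is_cder_rc (is_derive_powR1D e x1).
split.
  apply: (is_cder_eq (is_cderM (dX (- al)) a)).
  by rewrite mulNr opprK; ring.
(* Written this way, p times the derivative contains g and its quasi-derivative for the exponent
   -al, so the equation for g applies. *)
have E y : y \in `]-1, 1[ -> al%:C * (((1 + y) `^ (be + 1))%:C * g y)
     + ((1 - y) `^ al)%:C * ((p (- al) be y)%:C * g1 y) =
   (p al be y)%:C * ((al * (1 - y) `^ (- al - 1))%:C * g y + ((1 - y) `^ (- al))%:C * g1 y).
  rewrite in_itv/= => /andP[y1 y2].
  have Z0 : 0 < 1 - y by rewrite subr_gt0.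
  have -> : - al - 1 = - (al + 1) by ring.
  rewrite /p !powRN !(@powRS _ _ Z0) !powRN.
  have := powR_gt0 al Z0; move: ((1 - y) `^ al) => r r0.
  rewrite !rcM !rcV rcM.
  have h1 : (r%:C : R[i]) != 0 by rewrite rc_eq0 gt_eqF.
  have h2 : ((1 - y)%:C : R[i]) != 0 by rewrite rc_eq0 gt_eqF.
  move: (r%:C) ((1 - y)%:C) h1 h2 => r' z' h1 h2.
  by field; rewrite h1 h2.
apply: (@is_cder_near _ (fun y => al%:C * (((1 + y) `^ (be + 1))%:C * g y)
     + ((1 - y) `^ al)%:C * ((p (- al) be y)%:C * g1 y))).
  by near=> y; apply: E; near: y; exact: near_J.
have d1 := is_cderZ al%:C (is_cderM (dY (be + 1)) a).
have d2 := is_cderM (dX al) b.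
apply: (is_cder_eq (is_cderD d1 d2)).
rewrite /weight /p addrK !powRN !(@powRS _ _ X0) (@powRS _ _ Y0) !powRN.
have -> : (1 - x) `^ (al - 1) = (1 - x) `^ al / (1 - x).
  by apply: (mulIf (lt0r_neq0 X0)); rewrite -powRS// subrK mulfVK// gt_eqF.
have := powR_gt0 al X0; move: ((1 - x) `^ al) ((1 + x) `^ be) => r s r0.
rewrite !(rcM, rcN, rcD, rcV).
have h1 : (r%:C : R[i]) != 0 by rewrite rc_eq0 gt_eqF.
have h2 : (1%:C - x%:C : R[i]) != 0 by rewrite -rcN -rcD rc_eq0 gt_eqF.
by field; rewrite h1 h2.
Unshelve. all: by end_near. Qed.

End Solutions.

(** * Locally absolutely continuous complex functions *)

Section ComplexAbsCont.
Variable R : realType.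
Implicit Types (f g k : R -> R[i]) (s t x : R).
Local Notation mu := (@lebesgue_measure R).

Definition cabs_cont s t f :=
  abs_cont s t (fun x => Re (f x)) /\ abs_cont s t (fun x => Im (f x)).

Lemma abs_cont_ext s t (h k : R -> R) : (forall x, x \in `[s, t] -> h x = k x) ->
  abs_cont s t h -> abs_cont s t k.
Proof.
move=> hk ach e e0; have [d d0 H] := ach _ e0; exists d => // n u v uv dis sd.
rewrite (eq_bigr (fun i => `|h (v i) - h (u i)|)); first exact: H.
move=> i _; have [aui [uvi vib]] := uv i; rewrite !hk// in_itv/=.
  by rewrite aui (le_trans uvi).
by rewrite vib (le_trans aui).
Qed.

Lemma cabs_cont_ext s t f g : (forall x, x \in `[s, t] -> f x = g x) ->
  cabs_cont s t f -> cabs_cont s t g.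
Proof.
by move=> fg [h1 h2]; split; [apply: abs_cont_ext h1|apply: abs_cont_ext h2] => x /fg ->.
Qed.

Lemma cabs_contD s t f g : cabs_cont s t f -> cabs_cont s t g ->
  cabs_cont s t (fun x => f x + g x).
Proof.
move=> [f1 f2] [g1 g2]; split.
  by apply: abs_cont_ext (abs_cont_lin 1 1 f1 g1) => x _; rewrite ReD !mul1r.
by apply: abs_cont_ext (abs_cont_lin 1 1 f2 g2) => x _; rewrite ImD !mul1r.
Qed.

Lemma cabs_contM s t f g : s < t -> cabs_cont s t f -> cabs_cont s t g ->
  cabs_cont s t (fun x => f x * g x).
Proof.
move=> st [f1 f2] [g1 g2]; split.
  apply: abs_cont_ext (abs_cont_lin 1 (-1) (abs_contM st f1 g1) (abs_contM st f2 g2)) => x _.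
  by rewrite ReM mul1r mulN1r.
apply: abs_cont_ext (abs_cont_lin 1 1 (abs_contM st f1 g2) (abs_contM st f2 g1)) => x _.
by rewrite ImM !mul1r.
Qed.

Lemma cabs_cont_cder s t f k : s < t -> (forall x, x \in `[s, t] -> is_cder f x (k x)) ->
  (forall x, x \in `[s, t] -> ccvg (nbhs x) k (k x)) -> cabs_cont s t f.
Proof.
move=> st df ck; split.
  apply: (@abs_cont_derive _ _ _ _ (fun x => Re (k x)) st).
    by apply: continuous_in_subspaceT => x; rewrite inE => /ck[].
  by move=> x /df[].
apply: (@abs_cont_derive _ _ _ _ (fun x => Im (k x)) st).
  by apply: continuous_in_subspaceT => x; rewrite inE => /ck[].
by move=> x /df[].
Qed.

Lemma cabs_cont_cst s t (c : R[i]) : s < t -> cabs_cont s t (fun=> c).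
Proof.
move=> st; apply: (@cabs_cont_cder _ _ _ (fun=> 0) st) => x _; first exact: is_cder_cst.
exact: ccvg_cst.
Qed.

Lemma cabs_cont_is_cder s t f k : s < t -> cabs_cont s t f ->
  (forall x, x \in `[s, t] -> ccvg (nbhs x) k (k x)) ->
  {ae mu, forall x, x \in `]s, t[ -> is_cder f x (k x)} ->
  forall x, x \in `]s, t[ -> is_cder f x (k x).
Proof.
move=> st [f1 f2] ck dk x xst; split.
  apply: (abs_cont_is_derive st f1 (k := fun x => Re (k x))) => //.
    by apply: continuous_in_subspaceT => y; rewrite inE => /ck[].
  apply: ae_filterS dk.
  by move=> y h /h[[_ <-] _]; rewrite derive1E.
apply: (abs_cont_is_derive st f2 (k := fun x => Im (k x))) => //.
  by apply: continuous_in_subspaceT => y; rewrite inE => /ck[].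
apply: ae_filterS dk.
by move=> y h /h[_ [_ <-]]; rewrite derive1E.
Qed.

Lemma itv_segment_exists x : x \in `]-1, 1[ -> exists s t, [/\ -1 < s, s < t, t < 1 & x \in `]s, t[].
Proof.
rewrite in_itv/= => /andP[x1 x2]; exists ((x - 1) / 2), ((x + 1) / 2).
by rewrite in_itv/=; split; try (apply/andP; split); lra.
Qed.

Lemma segment_itv s t x : -1 < s -> t < 1 -> x \in `[s, t] -> x \in `]-1, 1[.
Proof.
by move=> s1 t1; rewrite !in_itv/= => /andP[h1 h2]; rewrite (lt_le_trans s1)// (le_lt_trans h2).
Qed.

Lemma AC_loc_ccvg f x : AC_loc f -> x \in `]-1, 1[ -> ccvg (nbhs x) f (f x).
Proof.
move=> acf /itv_segment_exists[s [t [s1 st t1 xst]]]; have [h1 h2] := acf s t s1 st t1.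
have /(continuous_within_itvP _ st)[c1 _ _] := abs_cont_within_continuous st h1.
have /(continuous_within_itvP _ st)[c2 _ _] := abs_cont_within_continuous st h2.
by split; [exact: c1|exact: c2].
Qed.

Lemma AC_loc_is_cder f k : AC_loc f ->
  (forall x, x \in `]-1, 1[ -> ccvg (nbhs x) k (k x)) ->
  {ae mu, forall x, x \in `]-1, 1[ -> is_cder f x (k x)} ->
  forall x, x \in `]-1, 1[ -> is_cder f x (k x).
Proof.
move=> acf ck dk x /itv_segment_exists[s [t [s1 st t1 xst]]].
apply: (cabs_cont_is_cder st (acf s t s1 st t1)) => //.
  by move=> y /(segment_itv s1 t1); exact: ck.
apply: ae_filterS dk.
by move=> y h yst; apply: h; apply: (segment_itv s1 t1); exact: subset_itv_oo_cc.
Qed.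

(** A countable exhaustion by compact intervals keeps the exceptional set null; radii 1 / (n + 2) <=
    1/2 keep these intervals proper. *)
Lemma AC_loc_cderivable f : AC_loc f ->
  {ae mu, forall x, x \in `]-1, 1[ -> cderivable f x}.
Proof.
move=> acf.
pose s (n : nat) : R := -1 + n.+2%:R^-1; pose t (n : nat) : R := 1 - n.+2%:R^-1.
have r0 n : 0 < n.+2%:R^-1 :> R by rewrite invr_gt0.
have r1 n : n.+2%:R^-1 <= 2^-1 :> R by rewrite lef_pV2 ?posrE// ler_nat.
have H n : {ae mu, forall x, x \in `]s n, t n[ -> cderivable f x}.
  have s1 : -1 < s n by rewrite /s ltrDl.
  have t1 : t n < 1 by rewrite /t ltrBlDr ltrDl.
  have st : s n < t n by rewrite /s /t; have := r1 n; move: (_^-1) => q; lra.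
  have [acR acI] := acf _ _ s1 st t1.
  have [gR _ dR] := abs_cont_derivative st acR.
  have [gI _ dI] := abs_cont_derivative st acI.
  apply: ae_filterS2 dR dI.
  by move=> x h1 h2 xst; split; [case: (h1 xst)|case: (h2 xst)].
apply: filterS (ae_foralln H) => x h; rewrite in_itv/= => /andP[x1 x2].
have m0 : 0 < Num.min (x + 1) (1 - x) by rewrite lt_min; apply/andP; split; lra.
have [n] : exists n, n.+2%:R^-1 < Num.min (x + 1) (1 - x).
  exists (Num.bound (Num.min (x + 1) (1 - x))^-1).
  rewrite -[ltRHS]invrK ltf_pV2 ?posrE ?invr_gt0//.
  apply: (lt_trans (archi_boundP _)); first by rewrite invr_ge0 ltW.
  by rewrite ltr_nat.
rewrite lt_min => /andP[n1 n2]; apply: (h n); rewrite in_itv/= /s /t.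
by move: n1 n2; move: (n.+2%:R^-1) => q n1 n2; apply/andP; split; lra.
Qed.

End ComplexAbsCont.

Section EndpointLimits.
Variable R : realType.
Implicit Types (x e : R) (f : R -> R[i]) (l : R[i]).

Lemma near_left1_J : \forall x \near (1 : R)^'-, x \in `]-1, 1[.
Proof.
near=> x; rewrite in_itv/=; apply/andP; split.
  by near: x; apply: nbhs_left_gt; lra.
by near: x; exact: nbhs_left_lt.
Unshelve. all: by end_near. Qed.

Lemma cvg_half_1B : (1 - x) / 2 @[x --> (1 : R)^'-] --> (0 : R).
Proof.
have -> : (0 : R) = (1 - 1) / 2 by rewrite subrr mul0r.
apply: cvg_at_left_filter; apply: cvgM; last exact: cvg_cst.
by apply: cvgB; [exact: cvg_cst|exact: cvg_id].
Qed.

Lemma cvg_half_1D : (1 + x) / 2 @[x --> (1 : R)^'-] --> (1 : R)^'-.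
Proof.
move=> P /nbhs_ballP[d /= d0 HP]; apply/nbhs_ballP; exists d => //= y yd y1.
apply: HP; last by lra.
have h0 : 0 < 1 - y by lra.
have h1 : 0 < 1 - (1 + y) / 2 by lra.
by move: yd; rewrite /ball/= !gtr0_norm//; lra.
Qed.

Lemma cvg_1B_right0 : 1 - x @[x --> (1 : R)^'-] --> (0 : R)^'+.
Proof.
move=> P /nbhs_ballP[d /= d0 HP]; apply/nbhs_ballP; exists d => //= y yd y1.
apply: HP; last by lra.
by move: yd; rewrite /ball/= sub0r normrN.
Qed.

Lemma cvg_powR1B e : 0 < e -> (1 - x) `^ e @[x --> (1 : R)^'-] --> (0 : R).
Proof.
move=> e0; apply: (@cvg_comp _ _ _ (fun x : R => 1 - x) (fun y => y `^ e) _ (0 : R)^'+).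
  exact: cvg_1B_right0.
exact: powR_cvg0.
Qed.

Lemma cvg_powR1D e : (1 + x) `^ e @[x --> (1 : R)^'-] --> 2 `^ e.
Proof.
apply: cvg_at_left_filter.
have -> : 2 = 1 + 1 :> R by ring.
have h : {for 1, continuous (fun x => (1 + x) `^ e)}.
  apply: differentiable_continuous; apply/derivable1_diffP.
  by case: (@is_derive_powR1D R e 1 ltac:(lra)).
exact: h.
Qed.

Lemma cvg_1B : 1 - x @[x --> (1 : R)^'-] --> (0 : R).
Proof.
rewrite -[X in _ --> X](subrr (1 : R)); apply: cvg_at_left_filter.
by apply: cvgB; [exact: cvg_cst|exact: cvg_id].
Qed.

End EndpointLimits.

(** * Boundary values at the endpoint 1 *)

Section Boundary.
Variable R : realType.
Implicit Types (al be x : R) (la : R[i]) (f g : R -> R[i]).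

(** The components of [Gamma0] and [Gamma1] at 1, as existing limits. Those at -1 are the ones of
    the reflected function with [al] and [be] exchanged. *)
Definition bdry al be f (f1 : R -> R[i]) (m0 m1 : R[i]) : Prop :=
  ccvg (1 : R)^'- (fun x => (p al be x)%:C * f1 x) m0 /\
  ccvg (1 : R)^'- (fun x => f x - (1 - x)%:C * f1 x / al%:C) m1.

Lemma bdry_lin al be f f1 g g1 m0 m1 n0 n1 (k l : R[i]) :
  bdry al be f f1 m0 m1 -> bdry al be g g1 n0 n1 ->
  bdry al be (fun x => k * f x + l * g x) (fun x => k * f1 x + l * g1 x)
    (k * m0 + l * n0) (k * m1 + l * n1).
Proof.
move=> [a b] [c d]; split.
  have -> : (fun x => (p al be x)%:C * (k * f1 x + l * g1 x)) =
      (fun x => k * ((p al be x)%:C * f1 x) + l * ((p al be x)%:C * g1 x)).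
    by apply/funext => x; ring.
  by apply: ccvgD; apply: ccvgM => //; exact: ccvg_cst.
have -> : (fun x => k * f x + l * g x - (1 - x)%:C * (k * f1 x + l * g1 x) / al%:C) =
    (fun x => k * (f x - (1 - x)%:C * f1 x / al%:C) + l * (g x - (1 - x)%:C * g1 x / al%:C)).
  by apply/funext => x; ring.
by apply: ccvgD; apply: ccvgM => //; exact: ccvg_cst.
Qed.

Lemma bdry_near al be f f1 g g1 m0 m1 :
  (forall x, x \in `]-1, 1[ -> f x = g x /\ f1 x = g1 x) ->
  bdry al be f f1 m0 m1 -> bdry al be g g1 m0 m1.
Proof.
move=> E [a b]; split; [apply: ccvg_near_eq a | apply: ccvg_near_eq b];
  apply: filterS (near_left1_J R) => x /E[]; by [move=> _ -> | move=> -> ->].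
Qed.

Lemma bdry_unique al be f f1 m0 m1 n0 n1 :
  bdry al be f f1 m0 m1 -> bdry al be f f1 n0 n1 -> m0 = n0 /\ m1 = n1.
Proof. by move=> [a b] [c d]; split; [exact: ccvg_unique a c|exact: ccvg_unique b d]. Qed.

(** The correction terms (1 - x) f1 / al cancel in the antisymmetric expression, so the constant
    Wronskian is the boundary form at 1. *)
Lemma wronsk_bdry al be la f f1 g g1 m0 m1 n0 n1 :
  sol al be la f f1 -> sol al be la g g1 ->
  bdry al be f f1 m0 m1 -> bdry al be g g1 n0 n1 ->
  forall x, x \in `]-1, 1[ -> wronsk al be f f1 g g1 x = m1 * n0 - n1 * m0.
Proof.
move=> sf sg [a b] [c d] x xJ.
have [w hw] := wronsk_const sf sg; rewrite hw//.
apply: (@ccvg_unique _ _ (1 : R)^'- _ (wronsk al be f f1 g g1)).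
  apply: ccvg_near_eq (ccvg_cst _ w).
  by apply: filterS (near_left1_J R) => y /hw.
have -> : wronsk al be f f1 g g1 = (fun x =>
    (f x - (1 - x)%:C * f1 x / al%:C) * ((p al be x)%:C * g1 x)
    - (g x - (1 - x)%:C * g1 x / al%:C) * ((p al be x)%:C * f1 x)).
  by apply/funext => y; rewrite /wronsk; ring.
by apply: ccvgB; exact: ccvgM.
Qed.

End Boundary.

(** * Regular and singular solutions at 1 *)

Section RegularSolution.
Variable R : realType.
Implicit Types (al be x : R) (a b : R[i]).

Definition usol al a b x : R[i] := hyp a b (al + 1) ((1 - x) / 2).
Definition usol' al a b x : R[i] := - (2^-1)%:C * hyp' a b (al + 1) ((1 - x) / 2).

Lemma is_derive_half_1B x : is_derive x 1 (fun y : R => (1 - y) / 2) (- 2^-1).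
Proof.
have h1 := is_deriveB (is_derive_cst (1 : R) x 1) (is_derive_id x (1 : R)).
have h2 := is_deriveM h1 (is_derive_cst (2^-1 : R) x 1).
apply: (is_derive_eq h2); rewrite /GRing.scale/= /cst; ring.
Qed.

Lemma half_1B_lt1 x : x \in `]-1, 1[ -> `|(1 - x) / 2| < 1.
Proof. by rewrite in_itv/= => /andP[h1 h2]; rewrite gtr0_norm; lra. Qed.

Lemma usol_is_cder al be a b x : a + b = (al + be + 1)%:C -> 0 <= al + be + 1 ->
  0 < al + 1 -> x \in `]-1, 1[ -> is_cder (usol al a b) x (usol' al a b x).
Proof.
move=> abE s0 c0 xJ.
have h := hyp_is_cder abE s0 c0 (half_1B_lt1 xJ).
by have := is_cder_comp (h := fun y => (1 - y) / 2) h (is_derive_half_1B x); rewrite rcN.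
Qed.

(** [hyp_raise] expresses u' as -S / (1 + x) with S a combination of u and F(c + 1), and [hyp_lower]
    differentiates F(c + 1); hence p u' is differentiated without a second derivative of the
    series. *)
Lemma usol_sol al be a b : a + b = (al + be + 1)%:C -> 0 <= al + be + 1 -> 0 < al + 1 ->
  sol al be (- (a * b)) (usol al a b) (usol' al a b).
Proof.
move=> abE s0 c0 x xJ; split; first exact: usol_is_cder abE s0 c0 xJ.
pose c := al + 1; have c1 : 0 < c + 1 by rewrite addr_gt0.
pose kap : R[i] := (c%:C - a) * (c%:C - b) / c%:C.
pose Fp (y : R) := hyp a b (c + 1) ((1 - y) / 2).
have cC : (c%:C : R[i]) != 0 by rewrite rc_eq0 gt_eqF.
pose S y := kap * Fp y + be%:C * usol al a b y.
have u1S y : y \in `]-1, 1[ -> usol' al a b y = - S y / (1 + y)%:C.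
  move=> yJ; have := hyp_raise abE s0 c0 (half_1B_lt1 yJ).
  move: (yJ); rewrite in_itv/= => /andP[y1 y2].
  have -> : al + 1 - (al + be + 1) = - be by ring.
  rewrite -/(usol al a b y) -/(Fp y) -/c -/kap => E.
  have Y0 : ((1 + y)%:C : R[i]) != 0 by rewrite rc_eq0 gt_eqF//; lra.
  apply: (mulIf Y0); rewrite mulfVK// /S -E /usol' rcN.
  have -> : (1 : R[i]) - ((1 - y) / 2)%:C = (2^-1)%:C * (1 + y)%:C.
    by rewrite -rcM; apply: complexP => /=; field.
  ring.
move: (xJ); rewrite in_itv/= => /andP[x1 x2].
have X0 : 0 < 1 - x by lra.
have Y0 : 0 < 1 + x by lra.
have dF : is_cder Fp x (- (kap * 0) - c%:C * (usol al a b x - Fp x) / (1 - x)%:C).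
  have h := hyp_is_cder abE s0 c1 (half_1B_lt1 xJ).
  apply: (is_cder_eq (is_cder_comp (h := fun y => (1 - y) / 2) h (is_derive_half_1B x))).
  have := hyp_lower abE s0 c0 (half_1B_lt1 xJ).
  rewrite -/(usol al a b x) -/(Fp x) -/c => E.
  have XC : ((1 - x)%:C : R[i]) != 0 by rewrite rc_eq0 gt_eqF.
  apply: (mulIf XC); rewrite mulr0 oppr0 sub0r mulNr mulfVK// -E !(rcN, rcM).
  ring.
have du := usol_is_cder abE s0 c0 xJ.
have dS := is_cderD (is_cderZ kap dF) (is_cderZ be%:C du).
have dX := is_cder_rc (is_derive_powR1B (al + 1) x2).
have dY := is_cder_rc (is_derive_powR1D be x1).
have pu y : y \in `]-1, 1[ -> - (((1 - y) `^ (al + 1))%:C * ((1 + y) `^ be)%:C * S y) =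
    (p al be y)%:C * usol' al a b y.
  move=> yJ; rewrite u1S//; move: (yJ); rewrite in_itv/= => /andP[y1 y2].
  have Z0 : 0 < 1 + y by lra.
  have -> : p al be y = (1 - y) `^ (al + 1) * ((1 + y) `^ be * (1 + y)).
    by rewrite /p [(1 + y) `^ (_ + _)]powRD ?(gt_eqF Z0) ?implybT// powRr1// ltW.
  rewrite !rcM.
  have h : ((1 + y)%:C : R[i]) != 0 by rewrite rc_eq0 gt_eqF.
  by move: ((1 + y)%:C) h => w w0; field.
have E := is_cderN (is_cderM (is_cderM dX dY) dS).
apply: (is_cder_eq (is_cder_near _ E)).
  by near=> y; apply: pu; near: y; exact: near_J.
rewrite (u1S x xJ) /weight addrK.
have -> : (1 - x) `^ (al + 1) = (1 - x) `^ al * (1 - x).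
  by rewrite powRD ?(gt_eqF X0) ?implybT// powRr1// ltW.
have -> : (1 + x) `^ (be - 1) = (1 + x) `^ be / (1 + x).
  by rewrite powRB ?(gt_eqF Y0) ?implybT// powRr1// ltW.
have bE : b = (al + be + 1)%:C - a by rewrite -abE addrC addKr.
rewrite /S /kap; move: (usol al a b x) (Fp x) => u v.
rewrite bE /c !(rcM, rcN, rcV, rcD) (_ : 1%:C = 1)//.
have XC : (1 - x%:C : R[i]) != 0 by rewrite -[1]/(1%:C) -rcN -rcD rc_eq0 gt_eqF.
have YC : (1 + x%:C : R[i]) != 0 by rewrite -[1]/(1%:C) -rcD rc_eq0 gt_eqF.
have cC' : (al%:C + 1 : R[i]) != 0 by rewrite -[1]/(1%:C) -rcD rc_eq0 gt_eqF.
by field; rewrite XC YC cC'.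
Unshelve. all: by end_near. Qed.

End RegularSolution.

Section BoundaryData.
Variable R : realType.
Implicit Types (al be x : R) (a b : R[i]) (f g : R -> R[i]).

Lemma usol_cvg1 al be a b : a + b = (al + be + 1)%:C -> 0 <= al + be + 1 -> 0 < al + 1 ->
  ccvg (1 : R)^'- (usol al a b) 1 /\ exists l, ccvg (1 : R)^'- (usol' al a b) l.
Proof.
move=> abE s0 c0.
have n0 : `|0 : R| < 1 by rewrite normr0.
split.
  have h := is_cder_ccvg (hyp_is_cder abE s0 c0 n0).
  rewrite (hyp_at0 abE s0 c0) in h.
  exact: (ccvg_comp (f := fun x => (1 - x) / 2) _ _ (@cvg_half_1B R) h).
have h : ccvg (nbhs (0 : R)) (hyp' a b (al + 1)) (hyp' a b (al + 1) 0).
  apply: is_cder_ccvg; apply: csum_is_cder n0.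
  - exact: hcoef_subexp1 abE s0 c0.
  - exact: hcoef_subexp2 abE s0 c0.
  rewrite cdiffs_hcoef// !cdiffsZ; apply: subexpZ.
  apply: (@hcoef_subexp2 _ _ _ (al + be + 1 + 2)); [|lra|lra].
  by rewrite addrACA abE [RHS]rcD rc_nat; ring.
exists (- (2^-1)%:C * hyp' a b (al + 1) 0).
apply: ccvgM; first exact: ccvg_cst.
exact: (ccvg_comp (f := fun x => (1 - x) / 2) _ _ (@cvg_half_1B R) h).
Qed.

Lemma cvg_p1 al be : 0 < al + 1 -> p al be x @[x --> (1 : R)^'-] --> (0 : R).
Proof.
move=> c0; rewrite -(mul0r (2 `^ (be + 1))) /p.
by apply: cvgM; [exact: cvg_powR1B | exact: cvg_powR1D].
Qed.

Lemma bdry_regular al be f f1 (m l : R[i]) : 0 < al + 1 ->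
  ccvg (1 : R)^'- f m -> ccvg (1 : R)^'- f1 l -> bdry al be f f1 0 m.
Proof.
move=> c0 fm fl; split.
  by rewrite -(mul0r l); apply: ccvgM => //; apply: ccvg_rc; exact: cvg_p1.
rewrite -[X in ccvg _ _ X]subr0 -(mul0r (al%:C)^-1) -(mul0r l); apply: ccvgB => //.
apply: ccvgM; last exact: ccvg_cst.
by apply: ccvgM => //; apply: ccvg_rc; exact: cvg_1B.
Qed.

Lemma usol_bdry al be a b : a + b = (al + be + 1)%:C -> 0 <= al + be + 1 -> 0 < al + 1 ->
  bdry al be (usol al a b) (usol' al a b) 0 1.
Proof.
move=> abE s0 c0; have [h [l hl]] := usol_cvg1 abE s0 c0.
exact: bdry_regular c0 h hl.
Qed.

(** The Frobenius solution with exponent -al at 1. It is auxiliary and differs from the solution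
    regular at -1, which is [wsol]. *)
Definition vsol al a b x : R[i] :=
  ((1 - x) `^ (- al))%:C * usol (- al) (a - al%:C) (b - al%:C) x.

Definition vsol' al a b x : R[i] :=
  (al * (1 - x) `^ (- al - 1))%:C * usol (- al) (a - al%:C) (b - al%:C) x
  + ((1 - x) `^ (- al))%:C * usol' (- al) (a - al%:C) (b - al%:C) x.

Lemma jacobi_params al be : 0 < al -> al < 1 -> 0 < be -> be < 1 ->
  [/\ 0 <= al + be + 1, 0 < al + 1, 0 <= - al + be + 1, 0 < - al + 1 & 0 <= al + (- be) + 1].
Proof. by move=> h1 h2 h3 h4; split; lra. Qed.

Lemma jacobi_params_lt al be : 0 < al -> al < 1 -> 0 < be -> be < 1 ->
  [/\ al + be + 1 < al + 1 + 1, 0 < al + 1 + 1, al + (- be) + 1 < al + 1 & 0 < 1 - be].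
Proof. by move=> h1 h2 h3 h4; split; lra. Qed.

Section Fixed.
Variables (al be : R) (a b : R[i]).
Hypotheses (al0 : 0 < al) (al1 : al < 1) (be0 : 0 < be) (be1 : be < 1).

Let s0' : 0 <= - al + be + 1. Proof. by case: (jacobi_params al0 al1 be0 be1). Qed.
Let c0' : 0 < - al + 1. Proof. by case: (jacobi_params al0 al1 be0 be1). Qed.
Let s1 : 0 <= al + (- be) + 1. Proof. by case: (jacobi_params al0 al1 be0 be1). Qed.
Let s0 : 0 <= al + be + 1. Proof. by case: (jacobi_params al0 al1 be0 be1). Qed.
Let c0 : 0 < al + 1. Proof. by case: (jacobi_params al0 al1 be0 be1). Qed.

Hypothesis abE : a + b = (al + be + 1)%:C.

Let abE' : a - al%:C + (b - al%:C) = (- al + be + 1)%:C.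
Proof. by rewrite addrACA abE !rcD rcN (_ : 1%:C = 1)//; ring. Qed.

Lemma vsol_sol : sol al be (- (a * b)) (vsol al a b) (vsol' al a b).
Proof.
have h := usol_sol abE' s0' c0'.
have := sol_mul_powR h.
have -> // : - ((a - al%:C) * (b - al%:C)) - (al * (be + 1))%:C = - (a * b).
have -> : (al * (be + 1))%:C = al%:C * (a + b - al%:C).
  by rewrite abE -rcN -rcD -rcM; congr (_%:C); ring.
ring.
Qed.

(** In p f' the powers of 1 - x cancel. In the second limit the leading terms (1 - x)^(-al) cancel
    exactly and leave a multiple of (1 - x)^(1 - al), which vanishes at 1 as al < 1. *)
Lemma vsol_bdry : bdry al be (vsol al a b) (vsol' al a b) (al * 2 `^ (be + 1))%:C 0.
Proof.
have [h [l hl]] := usol_cvg1 abE' s0' c0'.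
set g := usol _ _ _ in h; set g1 := usol' _ _ _ in hl.
have pw y : y \in `]-1, 1[ -> [/\ (1 - y)%:C != 0 :> R[i], ((1 - y) `^ al)%:C != 0 :> R[i],
    ((1 - y) `^ (- al))%:C = ((1 - y) `^ al)%:C^-1 :> R[i],
    ((1 - y) `^ (- al - 1))%:C = (((1 - y) `^ al)%:C * (1 - y)%:C)^-1 :> R[i] &
    ((1 - y) `^ (al + 1))%:C = ((1 - y) `^ al)%:C * (1 - y)%:C :> R[i]].
  rewrite in_itv/= => /andP[y1 y2]; have Z0 : 0 < 1 - y by lra.
  have E : (1 - y) `^ (al + 1) = (1 - y) `^ al * (1 - y).
    by rewrite powRD ?(gt_eqF Z0) ?implybT// powRr1// ltW.
  split.
  - by rewrite rc_eq0 gt_eqF.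
  - by rewrite rc_eq0 gt_eqF// powR_gt0.
  - by rewrite powRN rcV.
  - by rewrite -opprD powRN E rcV rcM.
  - by rewrite E rcM.
split.
  apply: (@ccvg_near_eq _ _ _ _ (fun x => al%:C * ((1 + x) `^ (be + 1))%:C * g x
      + (1 - x)%:C * ((1 + x) `^ (be + 1))%:C * g1 x)).
    apply: filterS (near_left1_J R) => x /pw[h1 h2 E1 E2 E3].
    rewrite /vsol' -/g -/g1 /p !rcM E1 E2 E3.
    move: ((1 - x)%:C) (((1 - x) `^ al)%:C) h1 h2 => X r h1 h2.
    by field; rewrite h1 h2.
  have -> : (al * 2 `^ (be + 1))%:C =
      al%:C * (2 `^ (be + 1))%:C * 1 + 0 * (2 `^ (be + 1))%:C * l :> R[i].
    by rewrite rcM mulr1 !mul0r addr0.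
  have hY : ccvg (1 : R)^'- (fun x => ((1 + x) `^ (be + 1))%:C) (2 `^ (be + 1))%:C.
    by apply: ccvg_rc; exact: cvg_powR1D.
  apply: ccvgD.
    by apply: ccvgM => //; apply: ccvgM => //; exact: ccvg_cst.
  apply: ccvgM => //; apply: ccvgM => //.
  by apply: ccvg_rc; exact: cvg_1B.
apply: (@ccvg_near_eq _ _ _ _ (fun x => - (((1 - x) `^ (1 - al))%:C * g1 x / al%:C))).
  have alC : (al%:C : R[i]) != 0 by rewrite rc_eq0 gt_eqF.
  apply: filterS (near_left1_J R) => x xJ; have [h1 h2 E1 E2 E3] := pw x xJ.
  have -> : ((1 - x) `^ (1 - al))%:C = (1 - x)%:C / ((1 - x) `^ al)%:C :> R[i].
    move: xJ; rewrite in_itv/= => /andP[y1 y2]; have Z0 : 0 < 1 - x by lra.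
    by rewrite -rcV -rcM powRB ?(gt_eqF Z0) ?implybT// powRr1// ltW.
  rewrite /vsol /vsol' -/g -/g1 !rcM E1 E2.
  move: ((1 - x)%:C) (((1 - x) `^ al)%:C) (al%:C) alC h1 h2 => X r A h3 h1 h2.
  by field; rewrite h1 h2 h3.
rewrite -oppr0 -(mul0r (al%:C)^-1) -(mul0r l); apply: ccvgN.
apply: ccvgM; last exact: ccvg_cst.
by apply: ccvgM => //; apply: ccvg_rc; apply: cvg_powR1B; rewrite subr_gt0.
Qed.

Let k_neq0 : (al * 2 `^ (be + 1))%:C != 0 :> R[i].
Proof. by rewrite rc_eq0 gt_eqF// mulr_gt0// powR_gt0. Qed.

(** Since [usol] and [vsol] have independent boundary data, every solution has boundary values at 1,
    and these are its coordinates. *)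
Lemma sol_span f f1 : sol al be (- (a * b)) f f1 -> exists m n,
  (forall x, x \in `]-1, 1[ -> f x = m * usol al a b x + n * vsol al a b x /\
    f1 x = m * usol' al a b x + n * vsol' al a b x) /\
  bdry al be f f1 (n * (al * 2 `^ (be + 1))%:C) m.
Proof.
move=> sf.
have su := usol_sol abE s0 c0; have sv := vsol_sol.
have bu := usol_bdry abE s0 c0; have bv := vsol_bdry.
have [|m [n E]] := wronsk_span sf su sv.
  have zJ : (0 : R) \in `]-1, 1[ by rewrite in_itv/= ltrN10 ltr01.
  by exists 0 => //; rewrite (wronsk_bdry su sv bu bv)// mul1r mulr0 subr0.
exists m, n; split=> //.
have := bdry_lin m n bu bv; rewrite !mulr0 add0r mulr1 addr0.
by apply: bdry_near => x /E[-> ->].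
Qed.

Lemma sol_bdry_inj f f1 : sol al be (- (a * b)) f f1 -> bdry al be f f1 0 0 ->
  forall x, x \in `]-1, 1[ -> f x = 0.
Proof.
move=> sf b0; have [m [n [E b1]]] := sol_span sf.
have [/eqP + m0] := bdry_unique b1 b0; rewrite mulf_eq0 (negbTE k_neq0) orbF => /eqP n0 x xJ.
by rewrite (E x xJ).1 m0 n0 !mul0r addr0.
Qed.

(* Euler's transformation: both sides solve the equation and are regular at 1
   with value 1. *)
Lemma usol_euler x : x \in `]-1, 1[ ->
  usol al a b x = (((1 + x) / 2) `^ (- be))%:C * usol al (al%:C + 1 - a) (al%:C + 1 - b) x.
Proof.
pose a' := al%:C + 1 - a; pose b' := al%:C + 1 - b.
have ab' : a' + b' = (al + (- be) + 1)%:C.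
  rewrite /a' /b' addrACA -opprD abE !rcD rcN (_ : 1%:C = 1)//; ring.
(* The right side of Euler's identity up to a constant: reflect, multiply by (1 - x)^(-be), reflect
   back. By [laE] the spectral parameter comes out the same. *)
have h1 := sol_reflect (usol_sol ab' s1 c0).
have h2 := sol_reflect (sol_mul_powR h1).
set g := (fun x => _) in h2; set g1 := (fun x : R => - _) in h2.
have laE : - (a' * b') - (be * (al + 1))%:C = - (a * b).
  have -> : b = (al + be + 1)%:C - a by rewrite -abE addrC addKr.
  rewrite /a' /b'; have -> : b = (al + be + 1)%:C - a by rewrite -abE addrC addKr.
  by rewrite !(rcD, rcM) (_ : 1%:C = 1)//; ring.
rewrite laE in h2.
have [cu [l cl]] := usol_cvg1 ab' s1 c0.
have gE y : g y = ((1 + y) `^ (- be))%:C * usol al a' b' y by rewrite /g !opprK.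
have g1E y : g1 y = - ((be * (1 + y) `^ (- be - 1))%:C * usol al a' b' y
     - ((1 + y) `^ (- be))%:C * usol' al a' b' y).
  by rewrite /g1 !opprK mulrN.
have cY e : ccvg (1 : R)^'- (fun x => ((1 + x) `^ e)%:C) (2 `^ e)%:C.
  by apply: ccvg_rc; exact: cvg_powR1D.
have gc : ccvg (1 : R)^'- g (2 `^ (- be))%:C.
  rewrite (funext gE) -[X in ccvg _ _ X]mulr1; exact: ccvgM.
have g1c : ccvg (1 : R)^'- g1 (- ((be%:C * (2 `^ (- be - 1))%:C) * 1 - (2 `^ (- be))%:C * l)).
  rewrite (funext g1E); apply: ccvgN; apply: ccvgB; apply: ccvgM => //.
  under eq_fun do rewrite rcM; apply: ccvgM => //; exact: ccvg_cst.
have bg : bdry al be g g1 0 (2 `^ (- be))%:C := bdry_regular be c0 gc g1c.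
have [m [n [E b1]]] := sol_span h2.
have [/eqP + mE] := bdry_unique b1 bg; rewrite mulf_eq0 (negbTE k_neq0) orbF => /eqP n0 xJ.
have [+ _] := E x xJ; rewrite n0 mul0r addr0 mE gE.
have t0 : (0 : R) < 2 by [].
move: (xJ); rewrite in_itv/= => /andP[x1 x2].
have Y0 : 0 <= 1 + x by lra.
rewrite powRM// ?invr_ge0// -powR_inv1// -powRrM mulN1r opprK => E1.
have p2 : (2 `^ be * 2 `^ (- be))%:C = 1 :> R[i].
  by rewrite powRN mulfV// gt_eqF// powR_gt0.
rewrite rcM mulrAC E1 mulrAC -rcM [2 `^ (- be) * _]mulrC p2 mul1r//.
Qed.

End Fixed.

(** * Connection between the endpoints *)

Section AtMinusOne.
Variables (al be : R) (a b : R[i]).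
Hypotheses (al0 : 0 < al) (al1 : al < 1) (be0 : 0 < be) (be1 : be < 1).

Let s0 : 0 <= al + be + 1. Proof. by case: (jacobi_params al0 al1 be0 be1). Qed.
Let c0 : 0 < al + 1. Proof. by case: (jacobi_params al0 al1 be0 be1). Qed.

Let c0s : al + be + 1 < al + 1 + 1. Proof. by case: (jacobi_params_lt al0 al1 be0 be1). Qed.
Let c1s : al + (- be) + 1 < al + 1. Proof. by case: (jacobi_params_lt al0 al1 be0 be1). Qed.
Let c1 : 0 < al + 1 + 1. Proof. by case: (jacobi_params_lt al0 al1 be0 be1). Qed.
Let s1 : 0 <= al + (- be) + 1. Proof. by case: (jacobi_params al0 al1 be0 be1). Qed.
Let nb0 : 0 < 1 - be. Proof. by case: (jacobi_params_lt al0 al1 be0 be1). Qed.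
Hypothesis abE : a + b = (al + be + 1)%:C.

(** The values c_2 and, below, -c_1 in terms of 1 / Gamma, so that poles of Gamma need no separate
    treatment. *)
Definition conn2 : R[i] := (be * 2 `^ (al + be + 1))%:C *
  (rGamma a * rGamma b / (rGamma (al%:C + 1) * rGamma be%:C)).

Definition conn1 : R[i] := rGamma (al%:C + 1 - a) * rGamma (al%:C + 1 - b) /
  (rGamma (al%:C + 1) * rGamma (- be%:C)).

(** The two limits come from different representations of u near -1: the first from Euler's
    transformation, the second from the contiguous relation. Both lead to series that converge at 1
    and are evaluated by Gauss's formula. *)
Lemma usol_bdry_reflect : bdry be al (fun x => usol al a b (- x))
  (fun x => - usol' al a b (- x)) conn2 conn1.
Proof.
pose c := al + 1.
pose kap : R[i] := (c%:C - a) * (c%:C - b) / c%:C.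
have cE : c%:C = al%:C + 1 :> R[i] by rewrite rcD.
have cC : (c%:C : R[i]) != 0 by rewrite rc_eq0 gt_eqF.
have beC : (be%:C : R[i]) != 0 by rewrite rc_eq0 gt_eqF.
pose Fp y : R[i] := hyp a b (c + 1) ((1 + y) / 2).
have u1S y : y \in `]-1, 1[ -> (1 - y)%:C * - usol' al a b (- y) =
    kap * Fp y + be%:C * usol al a b (- y).
  move=> yJ.
  have nyJ : - y \in `]-1, 1[ by move: yJ; rewrite !in_itv/= ltrN2 ltrNl andbC.
  have := hyp_raise abE s0 c0 (half_1B_lt1 nyJ).
  have -> : al + 1 - (al + be + 1) = - be by ring.
  rewrite opprK -/(Fp y) -/c -/kap => E.
  rewrite /usol /usol' opprK -/c -E rcN.
  have -> : (1 : R[i]) - ((1 + y) / 2)%:C = (2^-1)%:C * (1 - y)%:C.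
    by rewrite -rcM; apply: complexP => /=; field.
  ring.
have cF : ccvg (1 : R)^'- Fp (hyp a b (c + 1) 1).
  apply: (ccvg_comp (f := fun y => (1 + y) / 2) _ _ (@cvg_half_1D R)).
  exact: (hyp_abel abE s0 c1 c0s).
have abE2 : al%:C + 1 - a + (al%:C + 1 - b) = (al + (- be) + 1)%:C.
  by rewrite addrACA -opprD abE !rcD rcN (_ : 1%:C = 1)//; ring.
have one : 1%:C = 1 :> R[i] by [].
have ctil : ccvg (1 : R)^'- (fun y => hyp (al%:C + 1 - a) (al%:C + 1 - b) c ((1 + y) / 2))
   (hyp (al%:C + 1 - a) (al%:C + 1 - b) c 1).
  apply: (ccvg_comp (f := fun y => (1 + y) / 2) _ _ (@cvg_half_1D R)).
  exact: (hyp_abel abE2 s1 c0 c1s).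
have g1 : hyp a b (c + 1) 1 = rGamma (c%:C + 1 - a) * rGamma (c%:C + 1 - b)
    / (rGamma (c%:C + 1) * rGamma (1 - be%:C)).
  rewrite (gauss_summation abE s0 c1 c0s) rcD one; congr (_ / (_ * rGamma _)).
  have -> : c + 1 - (al + be + 1) = 1 - be by rewrite /c; ring.
  by rewrite rcD rcN.
have g2 : hyp (al%:C + 1 - a) (al%:C + 1 - b) c 1 = rGamma a * rGamma b
    / (rGamma (al%:C + 1) * rGamma be%:C).
  rewrite (gauss_summation abE2 s1 c0 c1s) -/c cE !opprB ![al%:C + 1 + _]addrC !subrK.
  by congr (_ / (_ * rGamma _)); rewrite /c; congr (_%:C); ring.
split.
  (* The term with F(c + 1) carries the factor (1 - y)^be and disappears; in the other one this
     factor cancels against that of Euler's transformation. *)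
  apply: (@ccvg_near_eq _ _ _ _ (fun y => ((1 + y) `^ (al + 1))%:C * ((1 - y) `^ be)%:C * (kap * Fp y)
      + ((1 + y) `^ (al + 1))%:C * be%:C * ((2 `^ be)%:C *
         hyp (al%:C + 1 - a) (al%:C + 1 - b) c ((1 + y) / 2)))).
    apply: filterS (near_left1_J R) => y yJ.
    have nyJ : - y \in `]-1, 1[ by move: yJ; rewrite !in_itv/= ltrN2 ltrNl andbC.
    move: (yJ); rewrite in_itv/= => /andP[y1 y2].
    have Z0 : 0 < 1 - y by lra.
    have -> : (p be al y)%:C * - usol' al a b (- y) =
        ((1 + y) `^ (al + 1))%:C * ((1 - y) `^ be)%:C * ((1 - y)%:C * - usol' al a b (- y)).
      rewrite /p [(1 - y) `^ (_ + _)]powRD ?(gt_eqF Z0) ?implybT// powRr1 ?(ltW Z0)// !rcM; ring.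
    rewrite u1S// mulrDr; congr (_ + _).
    rewrite (usol_euler al0 al1 be0 be1 abE nyJ) /usol !opprK -/c.
    have -> : ((1 - y) / 2) `^ (- be) = ((1 - y) `^ be)^-1 * 2 `^ be.
      have E2 : 2^-1 `^ (- be) = 2 `^ be :> R by rewrite -powR_inv1// -powRrM mulN1r opprK.
      by rewrite powRM ?invr_ge0 ?(ltW Z0)// E2 powRN.
    have h : ((1 - y) `^ be)%:C != 0 :> R[i] by rewrite rc_eq0 gt_eqF// powR_gt0.
    rewrite rcM rcV; move: (((1 - y) `^ be)%:C) h => r h; by field.
  have hY : ccvg (1 : R)^'- (fun x => ((1 + x) `^ (al + 1))%:C) (2 `^ (al + 1))%:C.
    by apply: ccvg_rc; exact: cvg_powR1D.
  have -> : conn2 = (2 `^ (al + 1))%:C * 0 * (kap * hyp a b (c + 1) 1) +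
      (2 `^ (al + 1))%:C * be%:C * ((2 `^ be)%:C * hyp (al%:C + 1 - a) (al%:C + 1 - b) c 1).
    rewrite mulr0 mul0r add0r /conn2 g2 rcM.
    have -> : al + be + 1 = (al + 1) + be by ring.
    rewrite powRD ?pnatr_eq0 ?implybT// rcM; ring.
  apply: ccvgD; apply: ccvgM => //.
  - by apply: ccvgM => //; apply: ccvg_rc; exact: cvg_powR1B.
  - by apply: ccvgM => //; exact: ccvg_cst.
  - by apply: ccvgM => //; exact: ccvg_cst.
  - by apply: ccvgM => //; exact: ccvg_cst.
(* By [u1S] the unbounded u drops out of the combination, which leaves a multiple of F(c + 1). *)
apply: (@ccvg_near_eq _ _ _ _ (fun y => - (kap / be%:C * Fp y))).
  apply: filterS (near_left1_J R) => y /u1S ->; by field.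
have -> : conn1 = - (kap / be%:C * hyp a b (c + 1) 1).
  rewrite g1 /conn1 -cE /kap.
  have r1 : rGamma (c%:C - a) = (c%:C - a) * rGamma (c%:C + 1 - a) by rewrite rGammaS addrAC.
  have r2 : rGamma (c%:C - b) = (c%:C - b) * rGamma (c%:C + 1 - b) by rewrite rGammaS addrAC.
  have r3 := rGammaS (- be%:C); have r4 := rGammaS c%:C.
  rewrite r1 r2 r3 r4 [- be%:C + 1]addrC.
  have h1 : rGamma (c%:C + 1) != 0.
    by have := rGamma_real_neq0 c1; rewrite rcD.
  have h2 : rGamma (1 - be%:C) != 0.
    by have := rGamma_real_neq0 nb0; rewrite rcD rcN.
  move: (rGamma (c%:C + 1)) (rGamma (1 - be%:C)) h1 h2 => G1 G2 h1 h2.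
  by field; rewrite h1 h2 cC beC.
by apply: ccvgN; apply: ccvgM => //; exact: ccvg_cst.
Qed.

End AtMinusOne.

End BoundaryData.

(** * Boundary data and the Weyl matrix *)

Section ConnectionCoefficients.
Variables (R : realType) (al be : R).
Hypotheses (al0 : 0 < al) (al1 : al < 1) (be0 : 0 < be) (be1 : be < 1).
Implicit Types (z : R[i]).

Let al1' : 0 < 1 - al. Proof. by rewrite subr_gt0. Qed.

(** Division by [Gamma] is multiplication by [rGamma], also at the poles; therefore no condition on
    z appears. *)
Lemma c2E z : c2 al be z = conn2 al be (z + 1) (- z + al%:C + be%:C).
Proof. by rewrite /c2 /conn2 /Gamma !invfM !invrK rcM; ring. Qed.

Lemma c1E z : c1 al be z = - conn1 al be (z + 1) (- z + al%:C + be%:C).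
Proof.
rewrite /c1 /conn1 /Gamma !invfM !invrK.
have -> : al%:C + 1 - (z + 1) = - z + al%:C by ring.
have -> : al%:C + 1 - (- z + al%:C + be%:C) = z - be%:C + 1 by ring.
ring.
Qed.

Lemma c4E z : c4 al be z = - conn1 be al (z + 1) (- z + al%:C + be%:C).
Proof.
rewrite /c4 /conn1 /Gamma.
have -> : be%:C + 1 - (z + 1) = - z + be%:C by ring.
have -> : be%:C + 1 - (- z + al%:C + be%:C) = z - al%:C + 1 by ring.
rewrite (rGammaS (- al%:C)) (rGammaS be%:C) [- al%:C + 1]addrC.
have h1 : rGamma (1 - al%:C) != 0 by have := rGamma_real_neq0 al1'; rewrite rcD rcN.
have h2 : rGamma (be%:C + 1) != 0.
  by have := rGamma_real_neq0 (addr_gt0 be0 (@ltr01 R)); rewrite rcD.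
have h3 : (al%:C : R[i]) != 0 by rewrite rc_eq0 gt_eqF.
have h4 : (be%:C : R[i]) != 0 by rewrite rc_eq0 gt_eqF.
rewrite !invfM !invrK.
move: (rGamma (1 - al%:C)) (rGamma (be%:C + 1)) h1 h2 => g1 g2 h1 h2.
move: (rGamma _) (rGamma _) => g3 g4.
by field; rewrite h1 h2 h3 h4.
Qed.

(** be Gamma(be) Gamma(al + 1) = Gamma(be + 1) Gamma(al + 1) is symmetric in al and be. *)
Lemma conn2_sym (a b : R[i]) : conn2 be al a b = conn2 al be a b.
Proof.
rewrite /conn2 [be + al]addrC !rcM (rGammaS al%:C) (rGammaS be%:C).
have h1 : rGamma (al%:C + 1) != 0.
  by have := rGamma_real_neq0 (addr_gt0 al0 (@ltr01 R)); rewrite rcD.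
have h2 : rGamma (be%:C + 1) != 0.
  by have := rGamma_real_neq0 (addr_gt0 be0 (@ltr01 R)); rewrite rcD.
have h3 : (al%:C : R[i]) != 0 by rewrite rc_eq0 gt_eqF.
have h4 : (be%:C : R[i]) != 0 by rewrite rc_eq0 gt_eqF.
by field; rewrite h1 h2 h3 h4.
Qed.

(** The quadratic formula for z^2 + (1 - s) z - s = la. *)
Lemma spectral_param_surj (la : R[i]) : exists z, la = spectral_param al be z.
Proof.
pose s : R[i] := al%:C + be%:C.
pose d := sqrtc ((1 - s) ^+ 2 + 4 * (s + la)).
exists ((s - 1 + d) / 2).
have dE : d ^+ 2 = (1 - s) ^+ 2 + 4 * (s + la) by exact: sqr_sqrtc.
have -> : la = (d ^+ 2 - (1 - s) ^+ 2) / 4 - s by rewrite dE; field.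
by move: d {dE} => d; rewrite /spectral_param /s; field.
Qed.

End ConnectionCoefficients.

(** * Boundary data at both endpoints and the Weyl matrix *)

Section BoundaryVectors.
Variables (R : realType) (al be : R).
Hypotheses (al0 : 0 < al) (al1 : al < 1) (be0 : 0 < be) (be1 : be < 1).
Implicit Types (f : R -> R[i]) (la : R[i]).

Definition vec2 (x y : R[i]) : 'cV[R[i]]_2 := \col_(i < 2) if i == 0 then x else y.

Definition bdata f f1 (v w : 'cV[R[i]]_2) : Prop :=
  bdry al be f f1 (v 0 0) (w 0 0) /\
  bdry be al (fun x => f (- x)) (fun x => - f1 (- x)) (v 1 0) (w 1 0).

(** The minus sign in the second component of [Gamma0] is the one that reflection gives to the
    derivative. *)
Lemma bdata_Gamma f v w : bdata f (cderive f) v w ->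
  Gamma0 al be f = v /\ Gamma1 al be f = w.
Proof.
move=> [[a b] [c d]].
have l1 : lift 0 0 = 1 :> 'I_2 by exact: val_inj.
have right u l : ccvg (1 : R)^'- (fun x => u (- x)) l -> climit (-1 : R)^'+ u = l.
  by move=> h; apply: ccvg_climit; rewrite at_rightN; exact: h.
split; apply/matrixP => i j; rewrite !mxE ord1; case: (unliftP 0 i) => [k|] ->; rewrite ?ord1/= ?l1.
- apply: right; move: c; congr (ccvg _ _ _); apply/funext => y.
  by rewrite /p opprK mulrN [in LHS]mulrC [in RHS]mulrC [in LHS](mulrC (_ `^ _)).
- exact: ccvg_climit.
- apply: right; move: d; congr (ccvg _ _ _); apply/funext => y.
  by rewrite mulrN mulNr opprK.
- exact: ccvg_climit.
Qed.

Lemma bdata_lin f f1 g g1 v w v' w' (k l : R[i]) : bdata f f1 v w -> bdata g g1 v' w' ->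
  bdata (fun x => k * f x + l * g x) (fun x => k * f1 x + l * g1 x)
    (k *: v + l *: v') (k *: w + l *: w').
Proof.
move=> [a b] [c d]; split; rewrite !mxE; first exact: bdry_lin.
have := bdry_lin k l b d.
by apply: bdry_near => x _; split => //; rewrite !mulrN -opprD.
Qed.

Lemma bdata_near f f1 g g1 v w :
  (forall x, x \in `]-1, 1[ -> f x = g x /\ f1 x = g1 x) ->
  bdata f f1 v w -> bdata g g1 v w.
Proof.
move=> E [a b]; split; first exact: bdry_near a.
apply: bdry_near b => x xJ.
have nxJ : - x \in `]-1, 1[ by move: xJ; rewrite !in_itv/= ltrN2 ltrNl andbC.
by have [-> ->] := E _ nxJ.
Qed.

Lemma cV2P (v w : 'cV[R[i]]_2) : v 0 0 = w 0 0 -> v 1 0 = w 1 0 -> v = w.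
Proof.
move=> h0 h1; apply/matrixP => i j; rewrite ord1.
have l1 : lift 0 0 = 1 :> 'I_2 by exact: val_inj.
by case: (unliftP 0 i) => [k|] -> //; rewrite ord1 l1.
Qed.

Lemma bdata_unique f f1 v w v' w' : bdata f f1 v w -> bdata f f1 v' w' -> v = v' /\ w = w'.
Proof.
move=> [a b] [c d]; have [? ?] := bdry_unique a c; have [? ?] := bdry_unique b d.
by split; exact: cV2P.
Qed.

Variables (a b : R[i]).
Hypothesis abE : a + b = (al + be + 1)%:C.

Let abE' : a + b = (be + al + 1)%:C. Proof. by rewrite abE [al + be]addrC. Qed.

Let s0 : 0 <= al + be + 1. Proof. by case: (jacobi_params al0 al1 be0 be1). Qed.
Let c0 : 0 < al + 1. Proof. by case: (jacobi_params al0 al1 be0 be1). Qed.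
Let s0' : 0 <= be + al + 1. Proof. by case: (jacobi_params be0 be1 al0 al1). Qed.
Let c0' : 0 < be + 1. Proof. by case: (jacobi_params be0 be1 al0 al1). Qed.

Lemma sol_bdata f f1 : sol al be (- (a * b)) f f1 -> exists v w, bdata f f1 v w.
Proof.
move=> sf.
have [m [n [_ b1]]] := sol_span al0 al1 be0 be1 abE sf.
have [m' [n' [_ b2]]] := sol_span be0 be1 al0 al1 abE' (sol_reflect sf).
exists (vec2 (n * (al * 2 `^ (be + 1))%:C) (n' * (be * 2 `^ (al + 1))%:C)), (vec2 m m').
by split; rewrite !mxE.
Qed.

(** The solution regular at -1. *)
Definition wsol x : R[i] := usol be a b (- x).
Definition wsol' x : R[i] := - usol' be a b (- x).

Lemma usol_solution : sol al be (- (a * b)) (usol al a b) (usol' al a b).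
Proof. exact: usol_sol. Qed.

Lemma wsol_solution : sol al be (- (a * b)) wsol wsol'.
Proof. exact: sol_reflect (usol_sol abE' s0' c0'). Qed.

Lemma usol_bdata : bdata (usol al a b) (usol' al a b)
  (vec2 0 (conn2 al be a b)) (vec2 1 (conn1 al be a b)).
Proof.
split; rewrite !mxE/=; first exact: usol_bdry.
exact: usol_bdry_reflect.
Qed.

Lemma wsol_bdata : bdata wsol wsol'
  (vec2 (conn2 al be a b) 0) (vec2 (conn1 be al a b) 1).
Proof.
split; rewrite !mxE/=; first by rewrite -conn2_sym//; exact: usol_bdry_reflect.
have := usol_bdry abE' s0' c0'; apply: bdry_near => x _.
by rewrite /wsol /wsol' !opprK.
Qed.

Lemma bdata_wronsk f f1 g g1 v w v' w' x :
  sol al be (- (a * b)) f f1 -> sol al be (- (a * b)) g g1 ->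
  bdata f f1 v w -> bdata g g1 v' w' -> x \in `]-1, 1[ ->
  wronsk al be f f1 g g1 x = w 0 0 * v' 0 0 - w' 0 0 * v 0 0.
Proof. by move=> sf sg [b1 _] [b2 _] xJ; rewrite (wronsk_bdry sf sg b1 b2). Qed.

Lemma bdata_vec_inj f f1 v w : sol al be (- (a * b)) f f1 -> bdata f f1 v w ->
  v 0 0 = 0 -> w 0 0 = 0 -> forall x, x \in `]-1, 1[ -> f x = 0.
Proof. by move=> sf [b1 _] v0 w0; move: b1; rewrite v0 w0; exact: sol_bdry_inj sf. Qed.

(* Two solutions with nonvanishing Wronskian span all solutions, so a linear
   boundary condition satisfied by both determines the Weyl matrix. *)
Lemma weyl_matrix f f1 g g1 v w v' w' (Theta : 'M[R[i]]_2) :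
  sol al be (- (a * b)) f f1 -> sol al be (- (a * b)) g g1 ->
  bdata f f1 v w -> bdata g g1 v' w' ->
  w 0 0 * v' 0 0 - w' 0 0 * v 0 0 != 0 ->
  w = Theta *m v -> w' = Theta *m v' ->
  [/\ conn2 al be a b != 0, Theta 0 0 = conn1 be al a b / conn2 al be a b,
      Theta 1 0 = 1 / conn2 al be a b & Theta 1 1 = conn1 al be a b / conn2 al be a b].
Proof.
move=> sf sg bf bg W0 wE wE'.
have zJ : (0 : R) \in `]-1, 1[ by rewrite in_itv/= ltrN10 ltr01.
have main u u1 vu wu : sol al be (- (a * b)) u u1 -> bdata u u1 vu wu -> wu = Theta *m vu.
  move=> su bu.
  have [|k [m E]] := wronsk_span su sf sg.
    by exists 0 => //; rewrite (bdata_wronsk sf sg bf bg).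
  have [-> ->] : vu = k *: v + m *: v' /\ wu = k *: w + m *: w'.
    apply: (bdata_unique bu); apply: bdata_near (bdata_lin k m bf bg) => x xJ.
    by have [-> ->] := E x xJ.
  by rewrite wE wE' mulmxDr !scalemxAr.
have Eu := main _ _ _ _ usol_solution usol_bdata.
have Ew := main _ _ _ _ wsol_solution wsol_bdata.
have l1 : lift 0 0 = 1 :> 'I_2 by exact: val_inj.
have entry (M : 'M[R[i]]_2) x y i :
    (M *m vec2 x y) i 0 = M i 0 * x + M i 1 * y.
  by rewrite !mxE !big_ord_recl big_ord0 !mxE/= addr0 l1.
have u0 := congr1 (fun M : 'cV[R[i]]_2 => M 0 0) Eu.
have u1_ := congr1 (fun M : 'cV[R[i]]_2 => M 1 0) Eu.
have w0 := congr1 (fun M : 'cV[R[i]]_2 => M 0 0) Ew.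
have w1 := congr1 (fun M : 'cV[R[i]]_2 => M 1 0) Ew.
rewrite /= entry mulr0 ?add0r ?addr0 !mxE/= in u0.
rewrite /= entry mulr0 ?add0r ?addr0 !mxE/= in u1_.
rewrite /= entry mulr0 ?add0r ?addr0 !mxE/= in w0.
rewrite /= entry mulr0 ?add0r ?addr0 !mxE/= in w1.
(* The second component of the relation for [wsol] is 1 = Theta_10 c_2. *)
have C0 : conn2 al be a b != 0.
  by apply/eqP => C0; move: w1; rewrite C0 mulr0 => /eqP; rewrite oner_eq0.
by split => //; [rewrite w0|rewrite w1|rewrite u1_]; rewrite mulfK.
Qed.

End BoundaryVectors.

(** * Regularity of eigenfunctions *)

Section Eigenfunctions.
Variables (R : realType) (al be : R).
Implicit Types (f g : R -> R[i]) (la : R[i]) (x e : R).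
Local Notation mu := (@lebesgue_measure R).

Definition dp (x : R) : R :=
  - ((al + 1) * (1 - x) `^ al) * (1 + x) `^ (be + 1)
  + (1 - x) `^ (al + 1) * ((be + 1) * (1 + x) `^ be).

Lemma p_is_derive x : x \in `]-1, 1[ -> is_derive x 1 (p al be) (dp x).
Proof.
rewrite in_itv/= => /andP[x1 x2].
have h1 := is_derive_powR1B (al + 1) x2; have h2 := is_derive_powR1D (be + 1) x1.
apply: (is_derive_eq (is_deriveM h1 h2)).
by rewrite /dp !addrK /GRing.scale/=; ring.
Qed.

Lemma continuous_powR1B e x : x \in `]-1, 1[ ->
  {for x, continuous (fun y : R => (1 - y) `^ e)}.
Proof.
rewrite in_itv/= => /andP[x1 x2]; apply: differentiable_continuous.
by apply/derivable1_diffP; case: (is_derive_powR1B e x2).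
Qed.

Lemma continuous_powR1D e x : x \in `]-1, 1[ ->
  {for x, continuous (fun y : R => (1 + y) `^ e)}.
Proof.
rewrite in_itv/= => /andP[x1 x2]; apply: differentiable_continuous.
by apply/derivable1_diffP; case: (is_derive_powR1D e x1).
Qed.

Lemma continuous_weight x : x \in `]-1, 1[ -> {for x, continuous (weight al be)}.
Proof.
by move=> xJ; apply: cvgM; [exact: continuous_powR1B|exact: continuous_powR1D].
Qed.

Lemma continuous_dp x : x \in `]-1, 1[ -> {for x, continuous dp}.
Proof.
move=> xJ; apply: cvgD; apply: cvgM.
- by apply: cvgN; apply: cvgM; [exact: cvg_cst|exact: continuous_powR1B].
- exact: continuous_powR1D.
- exact: continuous_powR1B.
- by apply: cvgM; [exact: cvg_cst|exact: continuous_powR1D].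
Qed.

Lemma continuous_p x : x \in `]-1, 1[ -> {for x, continuous (p al be)}.
Proof.
by move=> xJ; apply: differentiable_continuous; apply/derivable1_diffP;
  case: (p_is_derive xJ).
Qed.

(** The second derivative as the equation (p f1)' = - la w f determines it. *)
Definition snd_der la f f1 x : R[i] :=
  - ((la * (weight al be x)%:C * f x + (dp x)%:C * f1 x) / (p al be x)%:C).

Lemma continuous_snd_der la f f1 x : x \in `]-1, 1[ ->
  ccvg (nbhs x) f (f x) -> ccvg (nbhs x) f1 (f1 x) ->
  ccvg (nbhs x) (snd_der la f f1) (snd_der la f f1 x).
Proof.
move=> xJ cf cf1.
have p0 : (p al be x)%:C != 0 :> R[i] by rewrite rc_eq0 gt_eqF// p_gt0.
apply: ccvgN; apply: ccvgM; last first.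
  by apply: ccvgV => //; apply: ccvg_rc; exact: continuous_p.
apply: ccvgD; apply: ccvgM => //.
  by apply: ccvgM; [exact: ccvg_cst|apply: ccvg_rc; exact: continuous_weight].
by apply: ccvg_rc; exact: continuous_dp.
Qed.

(** Stated without [Dmax], because it also has to apply to the difference of two solutions of the
    inhomogeneous equation. *)
Lemma eigen_sol la f :
  (forall x, x \in `]-1, 1[ -> cderivable f x) -> AC_loc (cderive f) ->
  eqH (fun x => la * f x) (jacobi al be f) ->
  sol al be la f (cderive f).
Proof.
move=> hd hac hj x xJ.
have df y : y \in `]-1, 1[ -> is_cder f y (cderive f y) by move=> /hd/cderivable_is_cder.
split; first exact: df.
have d1 : is_cder (cderive f) x (snd_der la f (cderive f) x).
  apply: AC_loc_is_cder xJ => //.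
    move=> y yJ; apply: continuous_snd_der => //; first exact: is_cder_ccvg (df y yJ).
    exact: AC_loc_ccvg.
  apply: ae_filterS2 hj (AC_loc_cderivable hac).
  move=> y hjy hcy yJ; have d1 := cderivable_is_cder (hcy yJ); apply: (is_cder_eq d1).
  have := hjy yJ; rewrite /jacobi (is_cder_cderivable (is_cderM (is_cder_rc (p_is_derive yJ)) d1)).2.
  rewrite rcV /snd_der => E.
  have w0 : (weight al be y)%:C != 0 :> R[i] by rewrite rc_eq0 gt_eqF// weight_gt0.
  have p0 : (p al be y)%:C != 0 :> R[i] by rewrite rc_eq0 gt_eqF// p_gt0.
  rewrite [la * _ * _]mulrAC E.
  move: ((weight al be y)%:C) w0 ((p al be y)%:C) p0 => w w0 q q0; by field; rewrite ?w0 ?q0.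
apply: (is_cder_eq (is_cderM (is_cder_rc (p_is_derive xJ)) d1)).
have p0 : (p al be x)%:C != 0 :> R[i] by rewrite rc_eq0 gt_eqF// p_gt0.
rewrite /snd_der; move: ((p al be x)%:C) p0 => q p0; by field.
Qed.

Lemma sol_snd_der la f f1 x : sol al be la f f1 -> x \in `]-1, 1[ ->
  is_cder f1 x (snd_der la f f1 x).
Proof.
move=> sf xJ; have [df dpf] := sf x xJ.
have p0 : p al be x != 0 by rewrite gt_eqF// p_gt0.
have dp' := p_is_derive xJ.
have dpi := is_cder_rc (is_deriveV p0 dp').
have H := is_cderM dpi dpf.
apply: (@is_cder_near _ (fun y => ((p al be y)^-1)%:C * ((p al be y)%:C * f1 y))).
  near=> y; have yJ : y \in `]-1, 1[ by near: y; exact: near_J.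
  by rewrite rcV mulKf// rc_eq0 gt_eqF// p_gt0.
apply: (is_cder_eq H).
have p0' : (p al be x)%:C != 0 :> R[i] by rewrite rc_eq0.
rewrite /snd_der; move: (p al be x) (dp x) (weight al be x) p0 p0' => q d w q0 q0'.
have -> : - q ^- 2 *: d = - (d / q / q) by rewrite /GRing.scale/=; field.
rewrite rcN !rcM !rcV; move: (q%:C) q0' => r r0.
by field.
Unshelve. all: by end_near. Qed.

Lemma sol_AC_loc la f f1 : sol al be la f f1 -> AC_loc f /\ AC_loc f1.
Proof.
move=> sf; have cf1 x (xJ : x \in `]-1, 1[) := is_cder_ccvg (sol_snd_der sf xJ).
split=> s t s1 st t1; [apply: (@cabs_cont_cder _ _ _ _ f1 st)|
    apply: (@cabs_cont_cder _ _ _ _ (snd_der la f f1) st)] => x /(segment_itv s1 t1) xJ.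
- by have [] := sf x xJ.
- exact: cf1.
- exact: sol_snd_der.
- apply: continuous_snd_der => //; last exact: cf1.
  by have [d _] := sf x xJ; exact: is_cder_ccvg d.
Qed.

Lemma eqH_on_J f g : (forall x, x \in `]-1, 1[ -> f x = g x) -> eqH f g.
Proof. by move=> h; apply: aeW => x xJ; exact: h. Qed.

End Eigenfunctions.

(** * The resolvent of the extension with Gamma_0 f = 0 *)

Section ComplexPrimitives.
Variable R : realType.
Implicit Types (h : R -> R[i]) (k : R -> R) (x : R).
Local Notation mu := (@lebesgue_measure R).

Definition cintegrable h := mu.-integrable setT (fun x => (Re (h x))%:E) /\
  mu.-integrable setT (fun x => (Im (h x))%:E).

Definition cprim h x : R[i] := prim (fun t => Re (h t)) x +i* prim (fun t => Im (h t)) x.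

Lemma cprim_is_cder h : cintegrable h ->
  {ae mu, forall x, x \in `]-1, 1[ -> is_cder (cprim h) x (h x)}.
Proof.
move=> [h1 h2]; apply: ae_filterS2 (prim_is_derive h1) (prim_is_derive h2).
by move=> x d1 d2 xJ; split; [exact: d1|exact: d2].
Qed.

Lemma cprim_at_left h : cintegrable h -> ccvg (-1)^'+ (cprim h) 0.
Proof. by move=> [h1 h2]; split; exact: prim_at_left. Qed.

Lemma cprim_at_right h : cintegrable h -> ccvg 1^'- (cprim h) (cprim h 1).
Proof. by move=> [h1 h2]; split; exact: prim_at_right. Qed.

(** The factor 2 comes from bounding real and imaginary parts separately. *)
Lemma normc_cprim_le h k x : cintegrable h -> mu.-integrable setT (EFin \o k) ->
  (forall x, normc (h x) <= k x) -> normc (cprim h x) <= 2 * \int[mu]_t k t.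
Proof.
move=> [h1 h2] ik hk; rewrite mulr_natl mulr2n (le_trans (ler_normc_parts _))//.
by apply: lerD; apply: prim_bound => // t; apply: le_trans (hk t);
  [exact: ler_normc_Re|exact: ler_normc_Im].
Qed.

Lemma normc_cprim_tail_le h k x : x \in `]-1, 1[ -> cintegrable h ->
  mu.-integrable setT (EFin \o k) ->
  (forall x, normc (h x) <= k x) -> normc (cprim h 1 - cprim h x) <= 2 * \int[mu]_t k t.
Proof.
move=> xJ [h1 h2] ik hk; rewrite mulr_natl mulr2n (le_trans (ler_normc_parts _))//.
rewrite ReD ReN ImD ImN.
by apply: lerD; apply: prim_tail_bound => // t; apply: le_trans (hk t);
  [exact: ler_normc_Re|exact: ler_normc_Im].
Qed.

Lemma cprim_cabs_cont (s t : R) h : -1 < s -> t < 1 -> cintegrable h -> cabs_cont s t (cprim h).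
Proof.
move=> s1 t1 [h1 h2].
by split; [apply: abs_contS (prim_abs_cont h1)|apply: abs_contS (prim_abs_cont h2)]; exact: ltW.
Qed.

End ComplexPrimitives.

Section IntegrableLinearCombination.
Variable R : realType.
Local Notation mu := (@lebesgue_measure R).

Lemma integrable_lin (A : set R) (h k : R -> R) (r s : R) : measurable A ->
  mu.-integrable A (EFin \o h) -> mu.-integrable A (EFin \o k) ->
  mu.-integrable A (fun x => (r * h x + s * k x)%:E).
Proof.
move=> mA ih ik.
have -> : (fun x => (r * h x + s * k x)%:E) =
    (fun x => r%:E * (h x)%:E + s%:E * (k x)%:E)%E by apply/funext.
by apply: integrableD => //; apply: integrableZl.
Qed.

Lemma Rintegral_lin (A : set R) (h k : R -> R) (r s : R) : measurable A ->
  mu.-integrable A (EFin \o h) -> mu.-integrable A (EFin \o k) ->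
  \int[mu]_(x in A) (r * h x + s * k x) =
    r * (\int[mu]_(x in A) h x) + s * (\int[mu]_(x in A) k x).
Proof.
move=> mA ih ik; rewrite -RintegralZl// -RintegralZl//; apply: RintegralD => //.
  have := integrable_lin r 0 mA ih ik.
  by congr (mu.-integrable A _); apply/funext => x; rewrite mul0r addr0.
have := integrable_lin 0 s mA ih ik.
by congr (mu.-integrable A _); apply/funext => x; rewrite mul0r add0r.
Qed.

End IntegrableLinearCombination.

(** * The weighted space of square integrable functions *)

Section WeightedL2.
Variables (R : realType) (al be : R).
Implicit Types (f g : R -> R[i]) (k : R -> R) (x : R).
Local Notation mu := (@lebesgue_measure R).
Local Notation J := (`]-1, 1[%classic : set R).
Local Notation w := (weight al be).

Definition sqw f x : R := (Re (f x) ^+ 2 + Im (f x) ^+ 2) * w x.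

(** [inH] allows a change on a null set; here the function itself is measurable, so that its
    integrals can be estimated. *)
Definition L2 f := [/\ measurable_fun J (fun x => Re (f x)),
  measurable_fun J (fun x => Im (f x)) & mu.-integrable J (fun x => (sqw f x)%:E)].

Lemma weight_ge0 x : 0 <= w x.
Proof. by rewrite mulr_ge0// powR_ge0. Qed.

Lemma sqw_ge0 f x : 0 <= sqw f x.
Proof. by rewrite mulr_ge0 ?weight_ge0// addr_ge0// sqr_ge0. Qed.

Lemma sqwE f x : sqw f x = normc (f x) ^+ 2 * w x.
Proof. by rewrite normc_sqr. Qed.

Lemma measurable_weight : measurable_fun J w.
Proof.
apply: open_continuous_measurable_fun; first exact: interval_open.
by move=> x; rewrite inE; exact: continuous_weight.
Qed.

Lemma measurable_sqw f : measurable_fun J (fun x => Re (f x)) ->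
  measurable_fun J (fun x => Im (f x)) -> measurable_fun J (sqw f).
Proof.
move=> mR mI; apply: measurable_funM; last exact: measurable_weight.
by apply: measurable_funD; exact: measurable_funX.
Qed.

Lemma inH_L2 g : inH al be g -> exists2 g', eqH g g' & L2 g'.
Proof.
move=> [g' [gg' mR mI fin]]; exists g' => //; split => //.
apply/integrableP; split; first by apply/measurable_EFinP; exact: measurable_sqw.
have -> // : (\int[mu]_(x in J) `|(sqw g' x)%:E| = \int[mu]_(x in J) (sqw g' x)%:E)%E.
by apply: eq_integral => x _; rewrite gee0_abs// lee_fin sqw_ge0.
Qed.

Lemma L2_inH f g : eqH f g -> L2 g -> inH al be f.
Proof.
move=> fg [mR mI ig]; exists g; split => //.
case/integrableP : ig => _; congr (_ < _)%E.
by apply: eq_integral => x _; rewrite gee0_abs// lee_fin sqw_ge0.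
Qed.

(** Neither function has to be measurable, hence the appeal to the integral as a supremum over
    simple functions. *)
Lemma normH_eq f g : eqH f g -> normH al be f = normH al be g.
Proof.
move=> fg; congr (Num.sqrt (fine _)); apply: ge0_ae_eq_integral_patch.
- by move=> x _; rewrite lee_fin sqw_ge0.
- by move=> x _; rewrite lee_fin sqw_ge0.
- apply: ae_filterS fg.
  by move=> x fg /fg ->.
Qed.

Lemma L2_continuous f k : (forall x, x \in `]-1, 1[ -> ccvg (nbhs x) f (f x)) ->
  mu.-integrable J (EFin \o k) -> (forall x, x \in `]-1, 1[ -> sqw f x <= k x) -> L2 f.
Proof.
move=> cf ik fk.
have mR : measurable_fun J (fun x => Re (f x)).
  apply: open_continuous_measurable_fun; first exact: interval_open.
  by move=> x; rewrite inE => /cf[].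
have mI : measurable_fun J (fun x => Im (f x)).
  apply: open_continuous_measurable_fun; first exact: interval_open.
  by move=> x; rewrite inE => /cf[].
split => //; apply: le_integrable ik => //.
  by apply/measurable_EFinP; exact: measurable_sqw.
move=> x xJ; rewrite !gee0_abs ?lee_fin ?sqw_ge0//; first exact: fk.
by apply: le_trans (fk x xJ); exact: sqw_ge0.
Qed.

Lemma L2_lin f g (c d : R[i]) : L2 f -> L2 g -> L2 (fun x => c * f x + d * g x).
Proof.
move=> [fR fI fi] [gR gI gi].
have mR : measurable_fun J (fun x => Re (c * f x + d * g x)).
  have -> : (fun x => Re (c * f x + d * g x)) =
     (fun x => Re c * Re (f x) - Im c * Im (f x) + (Re d * Re (g x) - Im d * Im (g x))).
    by apply/funext => x; rewrite ReD !ReM.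
  by apply: measurable_funD; apply: measurable_funB;
    apply: measurable_funM => //; exact: measurable_cst.
have mI : measurable_fun J (fun x => Im (c * f x + d * g x)).
  have -> : (fun x => Im (c * f x + d * g x)) =
     (fun x => Re c * Im (f x) + Im c * Re (f x) + (Re d * Im (g x) + Im d * Re (g x))).
    by apply/funext => x; rewrite ImD !ImM.
  by do !apply: measurable_funD;
    apply: measurable_funM => //; exact: measurable_cst.
split => //.
have mJ : measurable J by exact: measurable_itv.
have ik := integrable_lin (2 * normc c ^+ 2) (2 * normc d ^+ 2) mJ fi gi.
apply: le_integrable ik => //; first by apply/measurable_EFinP; exact: measurable_sqw.
move=> x _; rewrite !gee0_abs ?lee_fin ?sqw_ge0//; last first.
  by rewrite addr_ge0// mulr_ge0 ?sqw_ge0// mulr_ge0// sqr_ge0.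
rewrite !sqwE; have := weight_ge0 x; move: (w x) => W W0.
have := le_normcD (c * f x) (d * g x); rewrite !normcM.
move: (normc_ge0 (c * f x + d * g x)).
move: (normc (c * f x + _)) => n n0.
move: (normc_ge0 c) (normc_ge0 d) (normc_ge0 (f x)) (normc_ge0 (g x)).
move: (normc c) (normc d) (normc (f x)) (normc (g x)) => p q r s p0 q0 r0 s0 h.
have h1 : n ^+ 2 <= (p * r + q * s) ^+ 2.
  by rewrite !expr2; apply: ler_pM.
have -> : 2 * p ^+ 2 * (r ^+ 2 * W) + 2 * q ^+ 2 * (s ^+ 2 * W) =
  (2 * (p ^+ 2 * r ^+ 2) + 2 * (q ^+ 2 * s ^+ 2)) * W by ring.
apply: ler_wpM2r => //; apply: (le_trans h1).
have := sqr_ge0 (p * r - q * s); rewrite sqrrB sqrrD !exprMn.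
lra.
Qed.

(** Extended by 0 to the whole line, where [prim] expects its integrands to be integrable. *)
Definition cut_mul f g x : R[i] := if x \in J then f x * g x * (w x)%:C else 0.

Definition cut_norm f g x : R := if x \in J then normc (f x) * normc (g x) * w x else 0.

Lemma normc_cut_mul f g x : normc (cut_mul f g x) <= cut_norm f g x.
Proof.
rewrite /cut_mul /cut_norm; case: ifP => _; last by rewrite normc0.
by rewrite !normcM normc_rc (ger0_norm (weight_ge0 x)).
Qed.

(** The Cauchy-Schwarz inequality: integrate 2 s |f| |g| <= s^2 |f|^2 + |g|^2 and optimize over s by
    [sqr_le_mulP]. *)
Lemma cut_norm_integrable f g : L2 f -> L2 g ->
  mu.-integrable setT (EFin \o cut_norm f g) /\
  (\int[mu]_x cut_norm f g x) ^+ 2 <=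
     (\int[mu]_(x in J) sqw f x) * (\int[mu]_(x in J) sqw g x).
Proof.
move=> [fR fI fi] [gR gI gi].
have mJ : measurable J by exact: measurable_itv.
have mn (h : R -> R[i]) : measurable_fun J (fun x => Re (h x)) -> measurable_fun J (fun x => Im (h x)) ->
    measurable_fun J (fun x => normc (h x)).
  move=> mR mI.
  have -> : (fun x => normc (h x)) = Num.sqrt \o (fun x => Re (h x) ^+ 2 + Im (h x) ^+ 2).
    by apply/funext => x /=; case: (h x).
  apply: measurableT_comp; first by apply: continuous_measurable_fun; exact: sqrt_continuous.
  by apply: measurable_funD; exact: measurable_funX.
pose k (x : R) : R := normc (f x) * normc (g x) * w x.
have mk : measurable_fun J k.
  by apply: measurable_funM; [apply: measurable_funM; exact: mn|exact: measurable_weight].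
have k0 x : 0 <= k x.
  by apply: mulr_ge0; [apply: mulr_ge0; exact: normc_ge0|exact: weight_ge0].
have kle s x : 2 * s * k x <= s ^+ 2 * sqw f x + sqw g x.
  rewrite !sqwE /k.
  have -> : 2 * s * (normc (f x) * normc (g x) * w x) =
    (2 * s * (normc (f x) * normc (g x))) * w x by ring.
  have -> : s ^+ 2 * (normc (f x) ^+ 2 * w x) + normc (g x) ^+ 2 * w x =
    (s ^+ 2 * normc (f x) ^+ 2 + normc (g x) ^+ 2) * w x by ring.
  apply: ler_wpM2r; first exact: weight_ge0.
  have := sqr_ge0 (s * normc (f x) - normc (g x)).
  by rewrite sqrrB exprMn; lra.
have ik : mu.-integrable J (EFin \o k).
  apply: le_integrable (integrable_lin 1 1 mJ fi gi) => //; first exact/measurable_EFinP.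
  move=> x _; rewrite /= lee_fin !mul1r !ger0_norm// ?addr_ge0 ?sqw_ge0//.
  have := kle 1 x; have := k0 x; have := sqw_ge0 f x; have := sqw_ge0 g x.
  by rewrite expr1n mul1r; lra.
have E : cut_norm f g = k \_ J by apply/funext => x; rewrite patchE.
split.
  rewrite E -restrict_EFin; apply/integrable_restrict => //.
  by rewrite setTI.
rewrite E -Rintegral_mkcond; apply: sqr_le_mulP.
- by apply: Rintegral_ge0 => x _; exact: sqw_ge0.
- by apply: Rintegral_ge0 => x _; exact: k0.
move=> s s0.
have -> : 2 * s * (\int[mu]_(x in J) k x) = \int[mu]_(x in J) (2 * s * k x + 0 * k x).
  by rewrite Rintegral_lin// mul0r addr0.
rewrite -[X in _ + X]mul1r -Rintegral_lin//; apply: le_Rintegral => //.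
- exact: integrable_lin.
- exact: integrable_lin.
- by move=> x _; rewrite mul0r addr0 mul1r.
Qed.

Lemma cut_mul_integrable f g : L2 f -> L2 g -> cintegrable (cut_mul f g).
Proof.
move=> Lf Lg; have [ik _] := cut_norm_integrable Lf Lg.
case: Lf Lg => [fR fI fi] [gR gI gi].
have mJ : measurable J by exact: measurable_itv.
have mfg : measurable_fun setT (fun x => Re (cut_mul f g x)) /\
    measurable_fun setT (fun x => Im (cut_mul f g x)).
  have -> : (fun x => Re (cut_mul f g x)) =
      (fun x => (Re (f x) * Re (g x) - Im (f x) * Im (g x)) * w x) \_ J.
    apply/funext => x; rewrite patchE /cut_mul; case: ifP => // _.
    by rewrite ReM/= mulr0 subr0 ReM.
  have -> : (fun x => Im (cut_mul f g x)) =
      (fun x => (Re (f x) * Im (g x) + Im (f x) * Re (g x)) * w x) \_ J.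
    apply/funext => x; rewrite patchE /cut_mul; case: ifP => // _.
    by rewrite ImM/= mulr0 add0r ImM.
  split; apply/(measurable_restrictT _ mJ); apply: measurable_funM;
    try exact: measurable_weight.
    by apply: measurable_funB; exact: measurable_funM.
  by apply: measurable_funD; exact: measurable_funM.
have c0 x : 0 <= cut_norm f g x by apply: le_trans (normc_cut_mul f g x); exact: normc_ge0.
split; apply: le_integrable ik => //.
- by apply/measurable_EFinP; exact: mfg.1.
- move=> x _ /=; rewrite lee_fin (ger0_norm (c0 x)).
  exact: le_trans (ler_normc_Re _) (normc_cut_mul f g x).
- by apply/measurable_EFinP; exact: mfg.2.
- move=> x _ /=; rewrite lee_fin (ger0_norm (c0 x)).
  exact: le_trans (ler_normc_Im _) (normc_cut_mul f g x).
Qed.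

End WeightedL2.

(** * Square integrability of the regular solutions *)

Section SquareIntegrableSolutions.
Variable R : realType.
Implicit Types (al be x : R) (a b : R[i]).
Local Notation mu := (@lebesgue_measure R).
Local Notation J := (`]-1, 1[%classic : set R).

(** By Euler's transformation u is (1 + x)^(-be) times a bounded function. Its square contributes
    the exponent -2 be, and the weight adds be. *)
Lemma usol_sqw_le al be a b : 0 < al -> al < 1 -> 0 < be -> be < 1 ->
  a + b = (al + be + 1)%:C ->
  exists M : R, forall x, x \in `]-1, 1[ ->
    sqw al be (usol al a b) x <= M * (1 + x) `^ (- be).
Proof.
move=> al0 al1 be0 be1 abE.
have abE' : (al%:C + 1 - a) + (al%:C + 1 - b) = (al - be + 1)%:C.
  transitivity (al%:C + al%:C + 1 + 1 - (a + b)); first by ring.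
  by rewrite abE !rcD rcN (_ : 1%:C = 1)//; ring.
have s0 : 0 <= al - be + 1 by lra.
have c0 : 0 < al + 1 by lra.
have sc : al - be + 1 < al + 1 by lra.
have [K hK] := hyp_bounded abE' s0 c0 sc.
pose D : R := 2^-1 `^ (- be).
exists (K ^+ 2 * D ^+ 2 * 2 `^ al) => x xJ.
move: (xJ); rewrite in_itv/= => /andP[x1 x2].
rewrite sqwE (usol_euler al0 al1 be0 be1 abE xJ).
have y0 : 0 < 1 + x by lra.
have t0 : 0 <= (1 - x) / 2 by lra.
have t1 : (1 - x) / 2 < 1 by lra.
have nK : normc (usol al (al%:C + 1 - a) (al%:C + 1 - b) x) <= K := hK _ t0 t1.
move: (usol al _ _ x) nK => U nK.
rewrite normcM normc_rc (ger0_norm (powR_ge0 _ _)).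
move: (normc_ge0 U) nK; move: (normc U) => n n0 nK.
rewrite /weight powRM ?invr_ge0 ?(ltW y0)// -/D.
have al2 : (1 - x) `^ al <= 2 `^ al by apply: ge0_ler_powR; rewrite ?nnegrE; lra.
have E : (1 + x) `^ (- be) * (1 + x) `^ be = 1.
  by rewrite -powRD ?addNr ?powRr0// eqxx/= gt_eqF.
have q0 := powR_ge0 (1 - x) al; have r0 := powR_ge0 (1 + x) (- be).
move: ((1 + x) `^ (- be)) ((1 + x) `^ be) ((1 - x) `^ al) (2 `^ al) E q0 r0 al2 => r r' q Q E q0 r0 qQ.
have -> : (r * D * n) ^+ 2 * (q * r') = (D ^+ 2 * r) * (n ^+ 2 * q) * (r * r') by ring.
rewrite E mulr1.
have -> : K ^+ 2 * D ^+ 2 * Q * r = (D ^+ 2 * r) * (K ^+ 2 * Q) by ring.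
apply: ler_wpM2l; first by rewrite mulr_ge0// sqr_ge0.
apply: ler_pM => //; first exact: sqr_ge0.
by rewrite !expr2; apply: ler_pM.
Qed.

(** The primitive (1 + x)^(1 - be) / (1 - be) is bounded because be < 1; [|M|] keeps the integrand
    nonnegative. *)
Lemma integrable_powR1D be (M : R) : 0 < be -> be < 1 ->
  mu.-integrable J (EFin \o (fun x => `|M| * (1 + x) `^ (- be))).
Proof.
move=> be0 be1.
have e0 : 0 < 1 - be by lra.
have e0' : 1 - be != 0 by lra.
pose k x := `|M| * (1 + x) `^ (- be).
pose F x := `|M| * ((1 - be)^-1 * (1 + x) `^ (1 - be)).
have dF x : x \in `]-1, 1[ -> is_derive x 1 F (k x).
  rewrite in_itv/= => /andP[x1 x2].
  apply: (is_derive_eq (is_deriveM (is_derive_cst _ _ _)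
     (is_deriveM (is_derive_cst _ _ _) (is_derive_powR1D (1 - be) x1)))).
  rewrite !scaler0 !addr0 /GRing.scale/=; congr (_ * _).
  by rewrite mulKf//; congr (_ `^ _); ring.
have k0 x : x \in `]-1, 1[ -> 0 <= k x by move=> _; rewrite mulr_ge0// powR_ge0.
have ck x : x \in `]-1, 1[ -> {for x, continuous k}.
  by move=> xJ; apply: cvgM; [exact: cvg_cst|exact: continuous_powR1D].
have FM x : x \in `]-1, 1[ -> `|F x| <= `|M| * ((1 - be)^-1 * 2 `^ (1 - be)).
  rewrite in_itv/= => /andP[x1 x2].
  have i0 : 0 <= (1 - be)^-1 by rewrite invr_ge0 ltW.
  rewrite /F ger0_norm ?mulr_ge0 ?powR_ge0//.
  apply: ler_wpM2l => //; apply: ler_wpM2l => //.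
  by apply: ge0_ler_powR; rewrite ?nnegrE; lra.
exact: (integrable_derivative dF k0 ck FM).
Qed.

Lemma integrable_powR1B al (M : R) : 0 < al -> al < 1 ->
  mu.-integrable J (EFin \o (fun x => `|M| * (1 - x) `^ (- al))).
Proof.
move=> al0 al1.
have e0 : 0 < 1 - al by lra.
have e0' : 1 - al != 0 by lra.
pose k x := `|M| * (1 - x) `^ (- al).
pose F x := `|M| * (- (1 - al)^-1 * (1 - x) `^ (1 - al)).
have dF x : x \in `]-1, 1[ -> is_derive x 1 F (k x).
  rewrite in_itv/= => /andP[x1 x2].
  apply: (is_derive_eq (is_deriveM (is_derive_cst _ _ _)
     (is_deriveM (is_derive_cst _ _ _) (is_derive_powR1B (1 - al) x2)))).
  rewrite !scaler0 !addr0 /GRing.scale/=; congr (_ * _).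
  by rewrite mulrNN mulKf//; congr (_ `^ _); ring.
have k0 x : x \in `]-1, 1[ -> 0 <= k x by move=> _; rewrite mulr_ge0// powR_ge0.
have ck x : x \in `]-1, 1[ -> {for x, continuous k}.
  by move=> xJ; apply: cvgM; [exact: cvg_cst|exact: continuous_powR1B].
have FM x : x \in `]-1, 1[ -> `|F x| <= `|M| * ((1 - al)^-1 * 2 `^ (1 - al)).
  rewrite in_itv/= => /andP[x1 x2].
  have i0 : 0 <= (1 - al)^-1 by rewrite invr_ge0 ltW.
  rewrite /F mulNr mulrN normrN ger0_norm ?mulr_ge0 ?powR_ge0//.
  apply: ler_wpM2l => //; apply: ler_wpM2l => //.
  by apply: ge0_ler_powR; rewrite ?nnegrE; lra.
exact: (integrable_derivative dF k0 ck FM).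
Qed.

Section Bounds.
Variables (al be : R) (a b : R[i]).
Hypotheses (al0 : 0 < al) (al1 : al < 1) (be0 : 0 < be) (be1 : be < 1).
Hypothesis abE : a + b = (al + be + 1)%:C.

Lemma usol_L2 : L2 al be (usol al a b).
Proof.
have [M hM] := usol_sqw_le al0 al1 be0 be1 abE.
apply: (L2_continuous _ (integrable_powR1D M be0 be1)).
  by move=> x /(usol_solution al0 al1 be0 be1 abE)[d _]; exact: is_cder_ccvg d.
move=> x xJ; apply: (le_trans (hM x xJ)).
by apply: ler_wpM2r; [exact: powR_ge0|exact: ler_norm].
Qed.

Lemma wsol_L2 : L2 al be (wsol be a b).
Proof.
have abE' : a + b = (be + al + 1)%:C by rewrite abE (addrC al).
have [M hM] := usol_sqw_le be0 be1 al0 al1 abE'.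
apply: (L2_continuous _ (integrable_powR1B M al0 al1)).
  by move=> x /(wsol_solution al0 al1 be0 be1 abE)[d _]; exact: is_cder_ccvg d.
move=> x xJ; have xJ' : - x \in `]-1, 1[ by move: xJ; rewrite !in_itv/= => /andP[? ?]; apply/andP; split; lra.
have -> : sqw al be (wsol be a b) x = sqw be al (usol be a b) (- x).
  by rewrite /sqw /wsol /weight opprK mulrC [X in _ = _ * X]mulrC mulrC.
apply: (le_trans (hM _ xJ')).
by apply: ler_wpM2r; [exact: powR_ge0|exact: ler_norm].
Qed.

End Bounds.

End SquareIntegrableSolutions.

(** * Green's function *)

Section GreenFunction.
Variables (R : realType) (al be : R) (la W : R[i]) (u u1 v v1 g : R -> R[i]).
Local Notation mu := (@lebesgue_measure R).
Local Notation J := (`]-1, 1[%classic : set R).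
Local Notation w := (weight al be).
Local Notation p := (p al be).
Hypotheses (su : sol al be la u u1) (sv : sol al be la v v1).
Hypotheses (Lu : L2 al be u) (Lv : L2 al be v) (Lg : L2 al be g).
Hypothesis wronsk_uv : forall x, x \in `]-1, 1[ -> wronsk al be u u1 v v1 x = W.
Hypothesis W0 : W != 0.
Implicit Types (x : R).

Let A x : R[i] := cprim (cut_mul al be v g) x.
Let B x : R[i] := cprim (cut_mul al be u g) 1 - cprim (cut_mul al be u g) x.

(* Variation of constants: A' = v g w and B' = - u g w. *)
Definition green x : R[i] := W^-1 * (u x * A x + v x * B x).
Definition green' x : R[i] := W^-1 * (u1 x * A x + v1 x * B x).

Let iA : cintegrable (cut_mul al be v g) := cut_mul_integrable Lv Lg.
Let iB : cintegrable (cut_mul al be u g) := cut_mul_integrable Lu Lg.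

Let cut_mulE f x : x \in `]-1, 1[ -> cut_mul al be f g x = f x * g x * (w x)%:C.
Proof. by move=> xJ; rewrite /cut_mul mem_set. Qed.

(** In the first derivative the terms with A' and B' cancel. In the derivative of p green' they
    combine to -W^-1 W(u, v) g w = - g w. *)
Lemma green_ae : {ae mu, forall x, x \in `]-1, 1[ -> is_cder green x (green' x) /\
  is_cder (fun y => (p y)%:C * green' y) x (- (la * (w x)%:C * green x) - g x * (w x)%:C)}.
Proof.
apply: ae_filterS2 (cprim_is_cder iA) (cprim_is_cder iB).
move=> x hA hB xJ.
have := hA xJ; rewrite (cut_mulE v xJ) => dA.
have := hB xJ; rewrite (cut_mulE u xJ) => dB.
have dB' := is_cderB (is_cder_cst (cprim (cut_mul al be u g) 1) x) dB.
have [du dpu] := su xJ; have [dv dpv] := sv xJ.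
split.
  apply: (is_cder_eq (is_cderM (is_cder_cst W^-1 x) (is_cderD (is_cderM du dA) (is_cderM dv dB')))).
  by rewrite /green' /A /B; ring.
have dpf := is_cderM (is_cder_cst W^-1 x) (is_cderD (is_cderM dpu dA) (is_cderM dpv dB')).
apply: (is_cder_near _ (is_cder_eq dpf _)).
  by near=> y; rewrite /green' /A /B; ring.
rewrite mul0r addr0 /green -/(A x) -/(B x).
transitivity (- (la * (w x)%:C * (W^-1 * (u x * A x + v x * B x)))
   - W^-1 * wronsk al be u u1 v v1 x * (g x * (w x)%:C)); first by rewrite /wronsk; ring.
by rewrite wronsk_uv// mulVf// mul1r.
Unshelve. all: by end_near. Qed.

Lemma green_AC_loc : AC_loc green /\ AC_loc green'.
Proof.
have [cu cu1] := sol_AC_loc su; have [cv cv1] := sol_AC_loc sv.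
have acA : AC_loc A by move=> s t s1 st t1; exact: cprim_cabs_cont.
have acB : AC_loc B.
  move=> s t s1 st t1.
  apply: (@cabs_cont_ext _ _ _ (fun x => cprim (cut_mul al be u g) 1
    + -1 * cprim (cut_mul al be u g) x)); first by move=> x _; rewrite mulN1r.
  apply: cabs_contD; first exact: cabs_cont_cst.
  by apply: cabs_contM => //; [exact: cabs_cont_cst|exact: cprim_cabs_cont].
split=> s t s1 st t1; apply: (cabs_contM st (cabs_cont_cst _ st));
  apply: cabs_contD; apply: (cabs_contM st).
- exact: cu.
- exact: acA.
- exact: cv.
- exact: acB.
- exact: cu1.
- exact: acA.
- exact: cv1.
- exact: acB.
Qed.

(** [green'] is continuous, so its being the derivative almost everywhere implies that it is so
    everywhere. *)
Lemma green_is_cder x : x \in `]-1, 1[ -> is_cder green x (green' x).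
Proof.
move=> xJ; apply: (AC_loc_is_cder green_AC_loc.1) xJ.
  by move=> y yJ; exact: AC_loc_ccvg green_AC_loc.2 yJ.
by apply: ae_filterS green_ae => y h /h[].
Qed.

Lemma cderive_green x : x \in `]-1, 1[ -> cderive green x = green' x.
Proof. by move=> /green_is_cder/is_cder_cderivable[]. Qed.

Lemma jacobi_green : eqH (jacobi al be green) (fun x => la * green x + 1 * g x).
Proof.
apply: ae_filterS green_ae.
move=> x h xJ; have [_ d] := h xJ.
have d' : is_cder (fun y => (p y)%:C * cderive green y) x
    (- (la * (w x)%:C * green x) - g x * (w x)%:C).
  apply: is_cder_near d; near=> y; rewrite cderive_green//.
  by near: y; exact: near_J.
rewrite /jacobi (is_cder_cderivable d').2 rcV.
have : (w x)%:C != 0 :> R[i] by rewrite rc_eq0 gt_eqF// weight_gt0.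
move: ((w x)%:C) => q q0; by field.
Unshelve. all: by end_near. Qed.

(** The constant 16: |A| and |B| are at most twice the integrals [IA] and [IB], which gives 4 after
    squaring; (y + z)^2 <= 2 (y^2 + z^2) gives another 2; and by Cauchy-Schwarz each of the two
    summands is bounded by the same product of the three norms. *)
Lemma green_L2 : L2 al be green /\
  normH al be green <= Num.sqrt (16 * (normc W)^-1 ^+ 2 *
    ((\int[mu]_(x in J) sqw al be u x) * (\int[mu]_(x in J) sqw al be v x)))
    * normH al be g.
Proof.
have [nA boundA] := cut_norm_integrable Lv Lg.
have [nB boundB] := cut_norm_integrable Lu Lg.
pose IA := \int[mu]_x cut_norm al be v g x.
pose IB := \int[mu]_x cut_norm al be u g x.
have hA x : normc (A x) <= 2 * IA.
  by apply: normc_cprim_le => //; exact: normc_cut_mul.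
have hB x : x \in `]-1, 1[ -> normc (B x) <= 2 * IB.
  by move=> xJ; apply: normc_cprim_tail_le => //; exact: normc_cut_mul.
pose r := 8 * (normc W)^-1 ^+ 2 * IA ^+ 2; pose s := 8 * (normc W)^-1 ^+ 2 * IB ^+ 2.
have key x : x \in `]-1, 1[ -> sqw al be green x <= r * sqw al be u x + s * sqw al be v x.
  move=> xJ; rewrite !sqwE /green normcM normcV.
  have := le_normcD (u x * A x) (v x * B x); rewrite !normcM.
  have := hA x; have := hB x xJ.
  move: (normc_ge0 (u x * A x + v x * B x)); move: (normc (u x * A x + _)) => n n0.
  move: (normc_ge0 (A x)) (normc_ge0 (B x)) (normc_ge0 (u x)) (normc_ge0 (v x)).
  move: (normc (A x)) (normc (B x)) (normc (u x)) (normc (v x)) => A' B' c d A0 B0 c0 d0 BI AI h.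
  have nn : n <= 2 * (c * IA + d * IB).
    apply: (le_trans h).
    have h1 : c * A' <= c * (2 * IA) by exact: ler_wpM2l.
    have h2 : d * B' <= d * (2 * IB) by exact: ler_wpM2l.
    by move: h1 h2; lra.
  have nn2 : n ^+ 2 <= 8 * ((c * IA) ^+ 2 + (d * IB) ^+ 2).
    have nn3 : n ^+ 2 <= (2 * (c * IA + d * IB)) ^+ 2 by rewrite !expr2; apply: ler_pM.
    apply: (le_trans nn3); have := sqr_ge0 (c * IA - d * IB).
    move: (c * IA) (d * IB) => y z; rewrite sqrrB exprMn sqrrD; lra.
  rewrite /r /s exprMn; have := weight_ge0 al be x; move: (w x) => q q0.
  have := sqr_ge0 (normc W)^-1; move: ((normc W)^-1 ^+ 2) => m m0.
  have -> : 8 * m * IA ^+ 2 * (c ^+ 2 * q) + 8 * m * IB ^+ 2 * (d ^+ 2 * q)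
     = m * (8 * ((c * IA) ^+ 2 + (d * IB) ^+ 2)) * q by ring.
  by apply: ler_wpM2r => //; apply: ler_wpM2l.
have mJ : measurable J by exact: measurable_itv.
have [_ _ iu] := Lu; have [_ _ iv] := Lv; have [_ _ ig] := Lg.
have ik := integrable_lin r s mJ iu iv.
have Lf : L2 al be green.
  apply: (L2_continuous _ ik key) => x xJ; exact: is_cder_ccvg (green_is_cder xJ).
split => //.
have [_ _ ifr] := Lf.
have le1 : \int[mu]_(x in J) sqw al be green x <=
    r * (\int[mu]_(x in J) sqw al be u x) + s * (\int[mu]_(x in J) sqw al be v x).
  rewrite -Rintegral_lin//; apply: le_Rintegral => //.
have N0 f : 0 <= \int[mu]_(x in J) sqw al be f x.
  by apply: Rintegral_ge0 => x _; exact: sqw_ge0.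
rewrite /normH -sqrtrM; last first.
  apply: mulr_ge0; first by apply: mulr_ge0 => //; exact: sqr_ge0.
  by apply: mulr_ge0; exact: N0.
apply: ler_wsqrtr; apply: (le_trans le1).
move: boundA boundB (N0 u) (N0 v) (N0 g); rewrite -/IA -/IB /r /s.
rewrite -[X in _ * X](_ : \int[mu]_(x in J) sqw al be g x = _)//.
move: (\int[mu]_(x in J) sqw al be u x) (\int[mu]_(x in J) sqw al be v x)
  (\int[mu]_(x in J) sqw al be g x) (IA ^+ 2) (IB ^+ 2) => Nu Nv Ng IA2 IB2 bA bB Nu0 Nv0 Ng0.
have := sqr_ge0 (normc W)^-1; move: ((normc W)^-1 ^+ 2) => m m0.
have h1 : m * IA2 * Nu <= m * (Nv * Ng) * Nu.
  by apply: ler_wpM2r => //; apply: ler_wpM2l.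
have h2 : m * IB2 * Nv <= m * (Nu * Ng) * Nv.
  by apply: ler_wpM2r => //; apply: ler_wpM2l.
move: h1 h2; lra.
Qed.

End GreenFunction.

Section Flux.
Variables (R : realType) (al be : R).
Implicit Types (f : R -> R[i]) (l m : R[i]).

(** The part of the boundary data that [infty_rel] tests, as existing limits. *)
Definition flux f1 l m := ccvg (1 : R)^'- (fun x => (p al be x)%:C * f1 x) l /\
  ccvg (-1 : R)^'+ (fun x => - ((p al be x)%:C * f1 x)) m.

Lemma bdata_flux f f1 v w : bdata al be f f1 v w -> flux f1 (v 0 0) (v 1 0).
Proof.
move=> [[a _] [b _]]; split => //; rewrite at_rightN; move: b.
congr (ccvg _ _ _); apply/funext => y /=.
by rewrite /p opprK mulrN [in LHS]mulrC [in RHS]mulrC [in LHS](mulrC (_ `^ _)).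
Qed.

Lemma flux_Gamma0 f l m : flux (cderive f) l m -> Gamma0 al be f = \col_(i < 2) (if i == 0 then l else m).
Proof.
move=> [a b]; apply/matrixP => i j; rewrite !mxE; case: ifP => _; exact: ccvg_climit.
Qed.

Lemma near_right1_J : \forall x \near (-1 : R)^'+, x \in `]-1, 1[.
Proof.
near=> x; rewrite in_itv/=; apply/andP; split; first by near: x; exact: nbhs_right_gt.
by near: x; apply: nbhs_right_lt; lra.
Unshelve. all: by end_near. Qed.

Lemma flux_ext f1 g1 l m : (forall x, x \in `]-1, 1[ -> f1 x = g1 x) ->
  flux f1 l m -> flux g1 l m.
Proof.
move=> fg [a b]; split.
  by apply: ccvg_near_eq a; apply: filterS (near_left1_J R) => x /fg ->.
by apply: ccvg_near_eq b; apply: filterS near_right1_J => x /fg ->.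
Qed.

Lemma fluxD f1 g1 l m l' m' : flux f1 l m -> flux g1 l' m' ->
  flux (fun x => f1 x + g1 x) (l + l') (m + m').
Proof.
move=> [a b] [c d]; split.
  under eq_fun do rewrite mulrDr; exact: ccvgD.
under eq_fun do rewrite mulrDr opprD; exact: ccvgD.
Qed.

End Flux.

Section GreenFlux.
Variables (R : realType) (al be : R) (u u1 v v1 g : R -> R[i]) (W : R[i]).
Hypotheses (Lu : L2 al be u) (Lv : L2 al be v) (Lg : L2 al be g).

(** At each end every product has a factor tending to 0: at 1 these are p u1 and B, at -1 they are A
    and p v1. *)
Lemma green_flux c d : flux al be u1 0 c -> flux al be v1 d 0 ->
  flux al be (green' al be W u u1 v v1 g) 0 0.
Proof.
move=> [u_r u_l] [v_r v_l].
have iA := cut_mul_integrable Lv Lg; have iB := cut_mul_integrable Lu Lg.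
pose A := cprim (cut_mul al be v g); pose B x := cprim (cut_mul al be u g) 1 - cprim (cut_mul al be u g) x.
have Bl : ccvg (-1)^'+ B (cprim (cut_mul al be u g) 1 - 0).
  by apply: ccvgB; [exact: ccvg_cst|exact: cprim_at_left].
have Br : ccvg 1^'- B (cprim (cut_mul al be u g) 1 - cprim (cut_mul al be u g) 1).
  by apply: ccvgB; [exact: ccvg_cst|exact: cprim_at_right].
split.
  have : ccvg 1^'- (fun x => W^-1 * ((p al be x)%:C * u1 x * A x + (p al be x)%:C * v1 x * B x))
      (W^-1 * (0 * A 1 + d * (cprim (cut_mul al be u g) 1 - cprim (cut_mul al be u g) 1))).
    apply: ccvgM; first exact: ccvg_cst.
    by apply: ccvgD; apply: ccvgM => //; exact: cprim_at_right.
  rewrite subrr mulr0 mul0r addr0 mulr0; congr (ccvg _ _ _); apply/funext => x.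
  by rewrite /green' /A /B; ring.
have : ccvg (-1)^'+ (fun x => W^-1 * (- ((p al be x)%:C * u1 x) * A x
     + - ((p al be x)%:C * v1 x) * B x)) (W^-1 * (c * 0 + 0 * (cprim (cut_mul al be u g) 1 - 0))).
  apply: ccvgM; first exact: ccvg_cst.
  by apply: ccvgD; apply: ccvgM => //; exact: cprim_at_left.
rewrite mulr0 mul0r addr0 mulr0; congr (ccvg _ _ _); apply/funext => x.
by rewrite /green' /A /B; ring.
Qed.

End GreenFlux.

Section Resolvent.
Variables (R : realType) (al be : R) (a b : R[i]).
Hypotheses (al0 : 0 < al) (al1 : al < 1) (be0 : 0 < be) (be1 : be < 1).
Hypothesis abE : a + b = (al + be + 1)%:C.
Hypothesis W0 : conn2 al be a b != 0.
Local Notation la := (- (a * b)).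
Local Notation mu := (@lebesgue_measure R).
Local Notation J := (`]-1, 1[%classic : set R).

Lemma wronsk_uw x : x \in `]-1, 1[ ->
  wronsk al be (usol al a b) (usol' al a b) (wsol be a b) (wsol' be a b) x = conn2 al be a b.
Proof.
move=> xJ; rewrite (bdata_wronsk (usol_solution al0 al1 be0 be1 abE)
  (wsol_solution al0 al1 be0 be1 abE) (usol_bdata al0 al1 be0 be1 abE)
  (wsol_bdata al0 al1 be0 be1 abE) xJ).
by rewrite !mxE/= mul1r mulr0 subr0.
Qed.

(** The solution k u + m v, with v the solution [wsol], has the boundary values m c_2 at 1 and k c_2
    at -1, so c_2 != 0 excludes an eigenvalue of the extension with Gamma_0 f = 0. *)
Lemma sol_flux0 f f1 : sol al be la f f1 -> flux al be f1 0 0 ->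
  forall x, x \in `]-1, 1[ -> f x = 0.
Proof.
move=> sf [f_r f_l] x xJ.
have su := usol_solution al0 al1 be0 be1 abE.
have sw := wsol_solution al0 al1 be0 be1 abE.
have zJ : (0 : R) \in `]-1, 1[ by rewrite in_itv/= ltrN10 ltr01.
have [|k [m km]] := wronsk_span sf su sw; first by exists 0 => //; rewrite wronsk_uw.
have [a_r a_l] := bdata_flux (bdata_near (fun y yJ => conj (esym (km y yJ).1) (esym (km y yJ).2))
  (bdata_lin k m (usol_bdata al0 al1 be0 be1 abE) (wsol_bdata al0 al1 be0 be1 abE))).
rewrite !mxE/= !mulr0 add0r in a_r; rewrite !mxE/= !mulr0 addr0 in a_l.
have /esym/eqP : 0 = m * conn2 al be a b by apply: ccvg_unique f_r a_r.
rewrite mulf_eq0 (negbTE W0) orbF => /eqP m0.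
have /esym/eqP : 0 = k * conn2 al be a b by apply: ccvg_unique f_l a_l.
rewrite mulf_eq0 (negbTE W0) orbF => /eqP k0.
by rewrite (km x xJ).1 k0 m0 !mul0r addr0.
Qed.

Theorem resolvent_infty : resolvent_set al be (A_ al be (@infty_rel R)) la.
Proof.
have su := usol_solution al0 al1 be0 be1 abE.
have sw := wsol_solution al0 al1 be0 be1 abE.
have Lu := usol_L2 al0 al1 be0 be1 abE.
have Lw := wsol_L2 al0 al1 be0 be1 abE.
exists (Num.sqrt (16 * (normc (conn2 al be a b))^-1 ^+ 2 *
  ((\int[mu]_(x in J) sqw al be (usol al a b) x) *
   (\int[mu]_(x in J) sqw al be (wsol be a b) x)))) => g0 /inH_L2[g gg Lg].
pose f := green al be (conn2 al be a b) (usol al a b) (wsol be a b) g.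
pose f1 := green' al be (conn2 al be a b) (usol al a b) (usol' al a b) (wsol be a b) (wsol' be a b) g.
have df x : x \in `]-1, 1[ -> is_cder f x (f1 x).
  exact: green_is_cder su sw Lu Lw Lg wronsk_uw W0 x.
have f1E x : x \in `]-1, 1[ -> cderive f x = f1 x by move=> /df/is_cder_cderivable[].
have jf : eqH (jacobi al be f) (fun x => la * f x + 1 * g x).
  exact: jacobi_green su sw Lu Lw Lg wronsk_uw W0.
have [Lf nf] : L2 al be f /\ normH al be f <=
    Num.sqrt (16 * (normc (conn2 al be a b))^-1 ^+ 2 *
    ((\int[mu]_(x in J) sqw al be (usol al a b) x) *
     (\int[mu]_(x in J) sqw al be (wsol be a b) x))) * normH al be g.
  exact: green_L2 su sw Lu Lw Lg wronsk_uw W0.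
have [acf acf1] : AC_loc f /\ AC_loc f1 by exact: (green_AC_loc _ su sw Lu Lw Lg).
have gae : {ae mu, forall x, x \in `]-1, 1[ -> is_cder f x (f1 x) /\
    is_cder (fun y => (p al be y)%:C * f1 y) x
      (- (la * (weight al be x)%:C * f x) - g x * (weight al be x)%:C)}.
  exact: green_ae su sw Lu Lw Lg wronsk_uw W0.
have fluxf1 : flux al be f1 0 0.
  have := bdata_flux (usol_bdata al0 al1 be0 be1 abE).
  have := bdata_flux (wsol_bdata al0 al1 be0 be1 abE).
  rewrite !mxE/= => h1 h2; exact: (green_flux _ Lu Lw Lg h2 h1).
clearbody f f1.
have fluxf : flux al be (cderive f) 0 0.
  by apply: flux_ext fluxf1 => x xJ; rewrite f1E.
have Df : Dmax al be f.
  split.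
  - by apply: L2_inH Lf; apply: eqH_on_J.
  - by move=> x /df/is_cder_cderivable[].
  - exact: acf.
  - move=> s t s1 st t1; apply: (@cabs_cont_ext _ _ _ f1); last exact: acf1.
    by move=> x /(segment_itv s1 t1) xJ; rewrite f1E.
  - by apply: L2_inH jf _; exact: L2_lin.
have G0 : Gamma0 al be f = 0.
  by rewrite (flux_Gamma0 fluxf); apply/matrixP => i j; rewrite !mxE if_same.
exists f; split.
- exists (jacobi al be f); first by split; [exact: Df|exact: G0|exact: eqH_on_J].
  apply: ae_filterS2 jf gg => x h1 h2 xJ.
  by rewrite h1// h2// mul1r addrC addKr.
- by rewrite (normH_eq al be gg); exact: nf.
move=> f' h' [[_ hd' _ hac' _] T' e'] he'.
(* For uniqueness, the difference solves the homogeneous equation almost everywhere, and by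
   [eigen_sol] it is then a classical solution. *)
pose d x := f' x - f x.
have dd x : x \in `]-1, 1[ -> is_cder d x (cderive f' x - f1 x).
  by move=> xJ; apply: is_cderB; [exact: cderivable_is_cder (hd' x xJ)|exact: df].
have d1E x : x \in `]-1, 1[ -> cderive d x = cderive f' x - f1 x.
  by move=> /dd/is_cder_cderivable[].
have sd : sol al be la d (cderive d).
  apply: eigen_sol.
  - by move=> x /dd/is_cder_cderivable[].
  - move=> s t s1 st t1.
    apply: (@cabs_cont_ext _ _ _ (fun x => cderive f' x + -1 * f1 x)).
      by move=> x /(segment_itv s1 t1) xJ; rewrite d1E ?mulN1r.
    apply: cabs_contD; first exact: hac'.
    apply: cabs_contM => //; first exact: cabs_cont_cst.
    exact: acf1.
  - have H1 : {ae mu, forall x, x \in `]-1, 1[ -> jacobi al be f' x - la * f' x = g x}.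
      by apply: ae_filterS3 e' he' gg => x h1 h2 h3 xJ; rewrite -h1// h2// h3.
    apply: ae_filterS3 H1 (AC_loc_cderivable hac') gae => x E1 h4 h5 xJ.
    have D1 := is_cderM (is_cder_rc (p_is_derive al be xJ)) (cderivable_is_cder (h4 xJ)).
    have [_ D2] := h5 xJ.
    have D : is_cder (fun y => (p al be y)%:C * cderive d y) x
       (cderive (fun y => (p al be y)%:C * cderive f' y) x
         - (- (la * (weight al be x)%:C * f x) - g x * (weight al be x)%:C)).
      rewrite (is_cder_cderivable D1).2.
      apply: is_cder_near (is_cderB D1 D2); near=> y.
      by rewrite d1E ?mulrBr//; near: y; exact: near_J.
    rewrite /jacobi (is_cder_cderivable D).2.
    rewrite [RHS]mulrBr -[X in _ = X - _]/(jacobi al be f' x).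
    have -> : jacobi al be f' x = g x + la * f' x by rewrite -(E1 xJ) subrK.
    rewrite rcV; have : (weight al be x)%:C != 0 :> R[i].
      by rewrite rc_eq0 gt_eqF// weight_gt0.
    rewrite /d; move: ((weight al be x)%:C) (f' x) (f x) (g x) => q y1 y2 y3 q0; by field.
(* Only here do the limits in [Gamma0 f'] turn out to exist, as those of d plus those of f; before
   that, [Gamma0 f' = 0] says nothing about convergence. *)
have [V [V' bd]] := sol_bdata al0 al1 be0 be1 abE sd.
have fd := bdata_flux bd.
have ff' : flux al be (cderive f') (V 0 0) (V 1 0).
  have := fluxD fd fluxf1; rewrite !addr0; apply: flux_ext => x xJ.
  by rewrite d1E// subrK.
move: T'; rewrite /infty_rel/= (flux_Gamma0 ff') => /matrixP V0.
have V00 : V 0 0 = 0 by have := V0 0 0; rewrite !mxE.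
have V10 : V 1 0 = 0 by have := V0 1 0; rewrite !mxE.
apply: eqH_on_J => x xJ; rewrite V00 V10 in fd.
by have := sol_flux0 sd fd xJ; rewrite /d => /eqP; rewrite subr_eq0 => /eqP.
Unshelve. all: by end_near. Qed.

End Resolvent.

(** * The dimension of the eigenspace *)

Section MainArgument.
Variables (R : realType) (al be : R).
Hypotheses (al0 : 0 < al) (al1 : al < 1) (be0 : 0 < be) (be1 : be < 1).
Local Notation C := R[i].

Theorem multiplicity_one (T : lin_relation R) (la : C) :
  (exists2 Theta : 'M[C]_2, Theta \is hermsymmx & T = graph_rel Theta) \/ T = @infty_rel R ->
  is_eigenvalue (A_ al be T) la -> ~ degenerate al be T la ->
  has_multiplicity (A_ al be T) la 1.
Proof.
move=> hT [f0 [D0 T0 e0] f0n0] hnd.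
have [z0 laE] := spectral_param_surj al be la.
have abE z : z + 1 + (- z + al%:C + be%:C) = (al + be + 1)%:C.
  by rewrite !rcD (_ : 1%:C = 1)//; ring.
have labE z : spectral_param al be z = - ((z + 1) * (- z + al%:C + be%:C)).
  by rewrite /spectral_param; ring.
have esol f : in_eigenspace (A_ al be T) la f -> sol al be la f (cderive f).
  by move=> [[_ hd _ hac _] _ e]; exact: eigen_sol.
have zJ : (0 : R) \in `]-1, 1[ by rewrite in_itv/= ltrN10 ltr01.
have s0 := esol f0 (And3 D0 T0 e0).
have dat z (lz : la = spectral_param al be z) f : sol al be la f (cderive f) ->
    sol al be (- ((z + 1) * (- z + al%:C + be%:C))) f (cderive f).
  by rewrite -labE -lz.
have [v0 [w0 b0]] := sol_bdata al0 al1 be0 be1 (abE z0) (dat z0 laE f0 s0).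
(* Either every eigenfunction has vanishing Wronskian with [f0], and the eigenspace is the line
   through [f0], or some eigenfunction forms a fundamental system with it. *)
have [all_prop|] := pselect (forall f, in_eigenspace (A_ al be T) la f ->
    wronsk al be f (cderive f) f0 (cderive f0) 0 = 0).
  exists (fun=> f0); split => //.
    move=> c; under eq_fun do rewrite big_ord1; move=> c0 i.
    rewrite ord1; apply: contrapT => /eqP c00; apply: f0n0.
    apply: ae_filterS c0.
    move=> x h xJ; have /eqP := h xJ.
    by rewrite mulf_eq0 (negbTE c00)/= => /eqP.
  move=> f ef; have sf := esol f ef.
  have [v [w bf]] := sol_bdata al0 al1 be0 be1 (abE z0) (dat z0 laE f sf).
  have := bdata_wronsk (dat z0 laE f sf) (dat z0 laE f0 s0) bf b0 zJ.
  rewrite all_prop// => W0.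
  (* The vanishing Wronskian makes the boundary data of f and f0 at 1 proportional. Those of f0 are
     not both 0, since they determine the solution. *)
  have [c [c1 c2]] : exists c, v 0 0 = c * v0 0 0 /\ w 0 0 = c * w0 0 0.
    have [v00|v00] := eqVneq (v0 0 0) 0.
      have [w00|w00] := eqVneq (w0 0 0) 0.
        exfalso; apply: f0n0; apply: eqH_on_J.
        exact: (bdata_vec_inj al0 al1 be0 be1 (abE z0) (dat z0 laE f0 s0) b0 v00 w00).
      exists (w 0 0 / w0 0 0); rewrite v00 mulr0 mulfVK//; split => //.
      move: W0; rewrite v00 mulr0 sub0r => /esym/eqP; rewrite oppr_eq0 mulf_eq0 (negbTE w00)/=.
      by move/eqP.
    exists (v 0 0 / v0 0 0); rewrite mulfVK//; split => //.
    apply: (mulIf v00); rewrite mulrAC mulfVK//.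
    by move/esym/eqP : W0; rewrite subr_eq0 => /eqP ->; rewrite mulrC.
  exists (fun=> c); apply: eqH_on_J => x xJ; rewrite big_ord1.
  have := bdata_vec_inj al0 al1 be0 be1 (abE z0)
    (sol_lin 1 (- c) (dat z0 laE f sf) (dat z0 laE f0 s0)) (bdata_lin 1 (- c) bf b0).
  rewrite !mxE c1 c2 !mul1r !mulNr !subrr => /(_ erefl erefl x xJ)/eqP.
  by rewrite mul1r mulNr subr_eq0 => /eqP.
move=> /existsNP[f /not_implyP[ef /eqP Wf]]; exfalso.
have sf := esol f ef; case: ef => Df Tf _.
have [v [w bf]] := sol_bdata al0 al1 be0 be1 (abE z0) (dat z0 laE f sf).
rewrite (bdata_wronsk (dat z0 laE f sf) (dat z0 laE f0 s0) bf b0 zJ) in Wf.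
move: Tf T0; have [-> ->] := bdata_Gamma bf; have [-> ->] := bdata_Gamma b0.
(* For {0} x C^2 both solutions have vanishing Gamma_0, which makes their Wronskian 0, a
   contradiction. *)
case: hT => [ex|->]; last first.
  rewrite /infty_rel/= => vE v0E; move: Wf.
  by rewrite vE v0E !mxE !mulr0 subrr eqxx.
case: ex => Theta hTheta TE.
rewrite TE /graph_rel/= => wE w0E; apply: hnd; exists Theta; split => //.
  rewrite laE labE; apply: (resolvent_infty al0 al1 be0 be1 (abE z0)).
  by have [] := weyl_matrix al0 al1 be0 be1 (abE z0) (dat z0 laE f sf) (dat z0 laE f0 s0)
    bf b0 Wf wE w0E.
(* The entries of Theta are required for each root z of the quadratic equation, so the Weyl matrix
   is computed again with the parameters of this z. *)
move=> z lz.
have [C0 -> -> ->] := weyl_matrix al0 al1 be0 be1 (abE z) (dat z lz f sf) (dat z lz f0 s0)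
    bf b0 Wf wE w0E.
by rewrite c2E c1E c4E// !mulNr !opprK.
Qed.

End MainArgument.

Local Close Scope complex_scope.
Local Close Scope classical_set_scope.

Theorem theorem4p9 (R : realType) (alpha beta : R)
  (halpha : 0 < alpha /\ alpha < 1) (hbeta : 0 < beta /\ beta < 1)
  (T : lin_relation R)
  (hT : (exists2 Theta : 'M[complex R]_2,
           Theta \is hermsymmx & T = graph_rel Theta)
        \/ T = @infty_rel R)
  (lambda : complex R)
  (hlambda : is_eigenvalue (A_ alpha beta T) lambda)
  (hnd : ~ degenerate alpha beta T lambda) :
  has_multiplicity (A_ alpha beta T) lambda 1.
Proof.
by have [al0 al1] := halpha; have [be0 be1] := hbeta; exact: multiplicity_one.
Qed.
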